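(* Let $n\geqslant 1$ be an integer, let $T>0$, let $\{b_t\}_{t\geqslant 0}$ be a one-dimensional standard Brownian motion with $b_0=0$, and let $X_t=(X_1(t),\ldots,X_n(t))$, $t\geqslant 0$, be the Kolmogorov diffusion on $\mathbb{R}^n$, that is, $X_1(t)=b_t$ and $X_d(t)=\int_0^t X_{d-1}(s)\,ds$ for $d=2,\ldots,n$. Let $|\cdot|$ be the Euclidean norm on $\mathbb{R}^n$. Let $\lambda_1^{(1)}$ be the lowest Dirichlet eigenvalue of $-\frac12\frac{d^2}{dx^2}$ on the interval $(-1,1)$, and let $\gamma_n\in(0,\infty)$ be the Chung constant of the component $X_n$, i.e. the deterministic constant such that $\liminf_{t\to\infty}\left(\frac{\log\log t}{t}\right)^{\frac{2n-1}{2}}\max_{0\leqslant s\leqslant t}|X_n(s)|=\gamma_n$ almost surely. Then the following three statements hold: (1) $$\lim_{\varepsilon\to 0^+}\; -\varepsilon^2\log\mathbb{P}\left(\max_{0\leqslant s\leqslant T}|X_s|<\varepsilon\right)=\lambda_1^{(1)}\,T;$$ (2) $$\liminf_{t\to 0^+}\sqrt{\frac{\log|\log t|}{t}}\;\max_{0\leqslant s\leqslant t}|X_s|=\sqrt{\lambda_1^{(1)}}\quad\text{almost surely};$$ (3) $$\liminf_{t\to\infty}\left(\frac{\log\log t}{t}\right)^{\frac{2n-1}{2}}\max_{0\leqslant s\leqslant t}|X_s|=\gamma_n\quad\text{almost surely}.$$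
   Context: The process $X_t$ is the $\mathbb{R}^n$-valued process whose components are the Brownian motion $b_t$ and its successive iterated time integrals: $X_1(t)=b_t$, $X_2(t)=\int_0^t b_s\,ds$, and $X_d(t)=\int_0^t\int_0^{t_2}\cdots\int_0^{t_{d-1}}b_{t_d}\,dt_d\cdots dt_2$ for $d=3,\ldots,n$. It is called the Kolmogorov diffusion of step $n$. The number $\lambda_1^{(n)}$ denotes in general the lowest Dirichlet eigenvalue of $-\frac12\Delta_{\mathbb{R}^n}$ on the unit ball of $\mathbb{R}^n$; only the case of dimension one, $\lambda_1^{(1)}$, is used. Definition of $\gamma_d$: it is a known result (X. Chen and W. V. Li, 2003) that for every integer $d\geqslant 1$ there exists a constant $\gamma_d\in(0,\infty)$ such that $$\lim_{\varepsilon\to 0^+}-\varepsilon^{\frac{2}{2d-1}}\log\mathbb{P}\left(\max_{0\leqslant t\leqslant 1}|X_d(t)|<\varepsilon\right)=\gamma_d^{\frac{2}{2d-1}},$$ $$\liminf_{t\to\infty}\left(\frac{\log\log t}{t}\right)^{\frac{2d-1}{2}}\max_{0\leqslant s\leqslant t}|X_d(s)|=\gamma_d\quad\text{almost surely}.$$ The existence of these constants is taken as given; $\gamma_n$ in the claim is the constant for $d=n$. *)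

(* Defs.v *)
From HB Require Import structures.
From mathcomp Require Export all_boot all_order all_algebra.
From mathcomp Require Export all_classical all_reals all_analysis.
Export Order.TTheory GRing.Theory Num.Theory.
Export numFieldNormedType.Exports.

Set Implicit Arguments.
Unset Strict Implicit.
Unset Printing Implicit Defensive.

#[global] Open Scope classical_set_scope.
#[global] Open Scope ring_scope.

Definition mutually_independent (R : realType) (d : measure_display)
    (Omega : measurableType d) (P : probability Omega R) (I : finType)
    (Y : I -> Omega -> R) : Prop :=
  forall (J : {set I}) (A : I -> set R), (forall i, measurable (A i)) ->
    P (\bigcap_(i in [set` J]) (Y i @^-1` A i)) =
    (\prod_(i in J) P (Y i @^-1` A i))%E.

(* A standard one-dimensional Brownian motion started at 0. Only the times
   t >= 0 are constrained, and every path is continuous (not merely almost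
   every path), so that the running maxima below are random variables even
   when P is not complete. The second parameter of [normal_prob] is the
   standard deviation. *)
Record brownian_motion (R : realType) (d : measure_display)
    (Omega : measurableType d) (P : probability Omega R)
    (b : R -> {RV P >-> R}) : Prop := BrownianMotion {
  bm_start : forall w, b 0 w = 0 ;
  bm_continuous : forall w, {within `[0, +oo[, continuous (fun t : R => b t w : R)} ;
  bm_gaussian : forall s t : R, 0 <= s -> s < t ->
    forall A : set R, measurable A ->
      P ((fun w => b t w - b s w) @^-1` A) = normal_prob 0 (Num.sqrt (t - s)) A ;
  bm_independent : forall (m : nat) (t : nat -> R), 0 <= t 0%N ->
    {homo t : i j / (i <= j)%N >-> i <= j} ->
    mutually_independent P
      (fun (i : 'I_m) (w : Omega) => b (t i.+1) w - b (t i) w)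
}.

Fixpoint iterated_integral (R : realType) (k : nat) (f : R -> R) : R -> R :=
  if k is k'.+1 then
    fun t => \int[lebesgue_measure]_(s in `[0, t]) iterated_integral k' f s
  else f.

(* Coordinates are numbered from 0: coordinate i is the component X_{i+1},
   the i-fold iterated time integral of the path f. *)
Definition kolmogorov (R : realType) (n : nat) (f : R -> R) (t : R) : 'rV[R]_n :=
  \row_(i < n) iterated_integral i f t.

(* The library norm on 'rV[R]_n is the sup norm. *)
Definition euclidean_norm (R : realType) (n : nat) (x : 'rV[R]_n) : R :=
  Num.sqrt (\sum_(i < n) x 0 i ^+ 2).

Definition running_max (R : realType) (g : R -> R) (t : R) : R :=
  sup (g @` `[0, t]).

(* lam is an eigenvalue of - (1/2) d^2/dx^2 on (a, b) with Dirichlet boundary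
   conditions, with eigenfunction u. *)
Definition dirichlet_eigenvalue (R : realType) (a b lam : R) : Prop :=
  exists u : R -> R,
    [/\ {within `[a, b], continuous u}, u a = 0, u b = 0,
        exists2 x, x \in `]a, b[ & u x != 0 &
        forall x, x \in `]a, b[ ->
          [/\ derivable u x 1, derivable (derive1 u) x 1 &
              - (2^-1 * derive1 (derive1 u) x) = lam * u x]].

Definition lowest_dirichlet_eigenvalue (R : realType) (a b lam : R) : Prop :=
  dirichlet_eigenvalue a b lam /\
  forall mu, dirichlet_eigenvalue a b mu -> lam <= mu.

Definition chung_scaling (R : realType) (n : nat) (t : R) : R :=
  (ln (ln t) / t) `^ ((2 * n%:R - 1) / 2).

(* The deterministic constant in Chung's law of the iterated logarithm at
   infinity for the component X_n, n >= 1, of the Kolmogorov diffusion. *)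
Definition chung_constant (R : realType) (d : measure_display)
    (Omega : measurableType d) (P : probability Omega R)
    (b : R -> {RV P >-> R}) (n : nat) (gamma : R) : Prop :=
  0 < gamma /\
  {ae P, forall w,
    limf_einf (fun t : R => (chung_scaling n t *
        running_max (fun s => `|iterated_integral n.-1 (b ^~ w) s|) t)%:E)
      (pinfty_nbhs R) = gamma%:E}.

(* Main.v *)
From HB Require Import structures.
Require Import Defs.
From mathcomp Require Import measurable_realfun.
From mathcomp Require Import ring lra.

Set Implicit Arguments.
Unset Strict Implicit.
Unset Printing Implicit Defensive.

(* The eigenvalue is lambda1 = pi^2/8.  Since cos(a b_t) exp(a^2 t/2) is a
   martingale and the sign of cos(a x) near |x| = r is known when a r >= pi/2
   (resp. a r < pi/2), the probability that |b| stays below r on [0, t] is at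
   least exp(-a^2 t/2) (resp. at most exp(-a^2 t/2) / cos(a r)); no maximal
   inequality or stopping time is needed, only one time step of a dyadic grid.

   (1) The upper bound is that of the first coordinate.  For the lower bound cut
   [0, T] into 4K blocks.  By pigeonhole some set G of paths on one block that
   stay below r has b and its integral at the end of the block prescribed up to
   a relative error K^-2, at a cost polynomial in K.  Asking the successive
   blocks to follow G, the time reversal of G, -G and the time reversal of -G
   makes b return near 0, and its integral as well, so that all the iterated
   integrals stay O(r/K) while b stays below r (1 + O(1/K)).

   (2) The lower bound is Borel-Cantelli along a geometric sequence.  For the
   upper bound the increments of b on the disjoint intervals [t_(k+1), t_k],
   t_k = ((k+1)!)^-4, are independent, and on [0, t] the other coordinates are
   bounded by multiples of t max |b|.

   (3) Almost surely max |b| <= t on [0, t] for large t, so that the coordinates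
   of index d < n are O(t^(n-1)), which is negligible against t^(n-1/2) up to
   iterated logarithms. *)

(** * Gaussian estimates *)

(** The hypothesis on b speaks of finitely many increments only. Hence every event used is a set of
    paths in the sigma-algebra of dyadic increments, and independence from what follows is carried
    from block to block as an invariant of events, [future]. A path on a grid of mesh h can jump
    over the level r. The fourth moment bounds the probability of a jump of fixed size by O(h^2);
    there are t / h steps, so the total error is O(h) and disappears with the mesh. In the lower
    bound of (1) the obstacle is to control the integral of b without loss in the exponential rate.
    Confining b on all the blocks costs exp (- a^2 T / 2) in total, as on the whole interval, and
    the price of the prescribed end values and integrals depends on K alone: its logarithm stays
    bounded as epsilon tends to 0 and is killed by the factor epsilon^2. The higher coordinates are
    iterated integrals of the second one. In (2) the power 4 makes b at t_(k+1) negligible at the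
    scale of t_k up to summable probabilities, while log |log t_k| stays close to ln k, so that the
    good events keep a divergent sum. *)

Lemma sin_le_id (R : realType) (x : R) : 0 <= x -> sin x <= x.
Proof.
move=> x0; rewrite -subr_ge0.
have -> : x - sin x = (fun y : R => y - sin y) x by [].
rewrite -[leLHS](_ : (fun y : R => y - sin y) 0 = 0); last by rewrite sin0 subr0.
apply: (@ger0_derive1_ndecry R (fun y : R => y - sin y) 0) => //.
- move=> y _; rewrite derive1E deriveB//.
  by rewrite derive_id derive_val subr_ge0 cos_le1.
- apply: derivable_within_continuous => y _; exact: derivableB.
Qed.

Lemma norm_sin_le (R : realType) (x : R) : `|sin x| <= `|x|.
Proof.
wlog x0 : x / 0 <= x => [W|].
  have [/W//|x0] := leP 0 x.
  by rewrite -normrN -sinN -(normrN x); apply: W; rewrite oppr_ge0 ltW.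
rewrite (ger0_norm x0); have [x1|x1] := leP x 1.
  rewrite ger0_norm ?sin_le_id//; apply: sin_ge0_pi; rewrite x0/=.
  by rewrite (le_trans x1)// (le_trans _ (pi_ge2 R))// ler1n.
by rewrite (le_trans (sin_max _))// ltW.
Qed.

Lemma cos_ge_quad (R : realType) (x : R) : 1 - x ^+ 2 / 2 <= cos x.
Proof.
have -> : cos x = 1 - 2 * sin (x / 2) ^+ 2.
  rewrite {1}(_ : x = (x / 2) *+ 2) ?cos_mulr2n; last by rewrite -mulr_natr; field.
  by rewrite cos2sin2 -[in LHS]mulr_natr; ring.
have : sin (x / 2) ^+ 2 <= (x / 2) ^+ 2.
  rewrite -(real_normK (num_real (sin _))) -(real_normK (num_real (_ / _))).
  by rewrite lerXn2r ?nnegrE ?normr_ge0// norm_sin_le.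
nra.
Qed.

Lemma sin_ge_cubic (R : realType) (x : R) : 0 <= x -> x - x ^+ 3 / 2 <= sin x.
Proof.
move=> x0; rewrite -subr_ge0.
pose f := @sin R - (@id R - 2^-1 *: (@id R) ^+ 3).
have fE y : f y = sin y - (y - y ^+ 3 / 2).
  by rewrite /f !fctE /GRing.scale/= mulrC.
rewrite -fE -[leLHS](_ : f 0 = 0); last first.
  by rewrite fE sin0 expr0n/= mul0r !subr0.
have df (y : R) : is_derive y 1 f (cos y - (1 - y ^+ 2 * 3 / 2)).
  apply: is_derive_eq; rewrite /GRing.scale/= ?mulr1 -mulr_natr.
  by congr (_ - (_ - _)); field.
apply: (@ger0_derive1_ndecry R f 0) => //.
- by move=> y _; rewrite derive1E derive_val; have := cos_ge_quad y; nra.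
- by apply: derivable_within_continuous => y _; exact: ex_derive.
Qed.

Lemma cos_le_quart (R : realType) (x : R) : cos x <= 1 - x ^+ 2 / 2 + x ^+ 4 / 8.
Proof.
wlog x0 : x / 0 <= x => [W|].
  have [/W//|x0] := leP 0 x.
  have := W (- x); rewrite cosN !sqrrN exprNn (_ : (-1) ^+ 4 = 1) ?mul1r; first by apply; lra.
  by rewrite -signr_odd.
have -> : cos x = 1 - 2 * sin (x / 2) ^+ 2.
  rewrite {1}(_ : x = (x / 2) *+ 2) ?cos_mulr2n; last by rewrite -mulr_natr; field.
  by rewrite cos2sin2 -[in LHS]mulr_natr; ring.
have y0 : 0 <= x / 2 by lra.
set y := x / 2 in y0 *; have -> : x = 2 * y by rewrite /y; field.
have := sin_ge_cubic y0; set s := sin y; move=> hs.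
have s0 : 0 <= s ^+ 2 by exact: sqr_ge0.
(* Below this threshold the cubic bound is nonnegative and can be squared; above it the right-hand
   side exceeds 1. *)
have [y2|y2] := leP (y ^+ 2) 2; last by nra.
have h0 : 0 <= y - y ^+ 3 / 2 by nra.
have h1 : (y - y ^+ 3 / 2) ^+ 2 <= s ^+ 2.
  by rewrite lerXn2r ?nnegrE// (le_trans h0).
have : 0 <= y ^+ 6 by rewrite (_ : y ^+ 6 = (y ^+ 3) ^+ 2) ?sqr_ge0//; ring.
nra.
Qed.

Lemma expRN_le_quad (R : realType) (y : R) : 0 <= y -> expR (- y) <= 1 - y + y ^+ 2.
Proof.
move=> y0; rewrite expRN; have h := expR_ge1Dx y.
have p1 : 0 < 1 + y by lra.
apply: (@le_trans _ _ (1 + y)^-1); first by rewrite lef_pV2 ?posrE// expR_gt0.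
by rewrite -[leLHS]mul1r ler_pdivrMr//; nra.
Qed.

(** The two functions agree to second order. Since exp (- c x^2) has an explicit Gaussian integral,
    this evaluates the integral of the cosine at the price of a fourth moment. *)
Lemma cos_sub_gauss (R : realType) (z : R) :
  `|cos z - expR (- (z ^+ 2 / 2))| <= z ^+ 4 / 4.
Proof.
have z2 : 0 <= z ^+ 2 / 2 by rewrite divr_ge0 ?sqr_ge0.
have := expRN_le_quad z2; have := expR_ge1Dx (- (z ^+ 2 / 2)).
have := cos_le_quart z; have := cos_ge_quad z.
have : 0 <= z ^+ 4 by rewrite exprn_even_ge0.
have -> : (z ^+ 2 / 2) ^+ 2 = z ^+ 4 / 4 by field.
by move=> *; rewrite ler_norml; apply/andP; split; lra.
Qed.

(** Meant for y = x^2: it bounds x^4 by exponentials of x^2 and - x^2, whose Gaussian integrals are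
    explicit. The 8 removes their value at 0, so that no term of order 0 survives. *)
Lemma sqr_le_expRD (R : realType) (y : R) :
  y ^+ 2 + 8 <= 4 * (expR y + expR (- y)).
Proof.
wlog y0 : y / 0 <= y => [W|].
  have [/W//|y0] := leP 0 y.
  by have := W (- y); rewrite sqrrN opprK addrC [expR (-y) + _]addrC addrC; apply; lra.
pose e := expR (y / 2).
have eE : expR y = e ^+ 2 by rewrite /e -expRM_natl; congr expR; lra.
have eV : expR (- y) = e^-1 ^+ 2 by rewrite expRN eE exprVn.
have e1 : 1 + y / 2 <= e := expR_ge1Dx _.
have e0 : 0 < e := expR_gt0 _.
have h : y / 2 <= e - e^-1.
  have : e^-1 <= (1 + y / 2)^-1 by rewrite lef_pV2 ?posrE//; lra.
  have : (1 + y / 2)^-1 <= 1 by rewrite invf_le1; lra.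
  lra.
have ee : e * e^-1 = 1 by rewrite divff ?gt_eqF.
have : (y / 2) ^+ 2 <= (e - e^-1) ^+ 2.
  by rewrite lerXn2r ?nnegrE//; lra.
rewrite eE eV; set v := e^-1 in ee *; nra.
Qed.

(** * Integration against a measure given by a density *)

Section density.
Context d (T : measurableType d) (R : realType).
Variables (mu nu : {measure set T -> \bar R}) (g : T -> R).
Hypotheses (mg : measurable_fun setT g) (g0 : forall x, 0 <= g x).
Hypothesis nuE : forall A, measurable A -> nu A = (\int[mu]_(x in A) (g x)%:E)%E.

Import HBNNSimple.

Lemma ge0_integral_density (f : T -> \bar R) : measurable_fun setT f ->
  (forall x, (0 <= f x)%E) ->
  (\int[nu]_x f x = \int[mu]_x (f x * (g x)%:E))%E.
Proof.
move=> mf f0; pose h := nnsfun_approx measurableT mf.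
have mgE : measurable_fun setT (EFin \o g) by exact/measurable_EFinP.
have -> : (\int[nu]_x f x = lim (\int[nu]_x (EFin \o h n) x @[n --> \oo]))%E.
  have fE x : f x = lim ((EFin \o h n) x @[n --> \oo]).
    by apply/esym/cvg_lim => //; exact: cvg_nnsfun_approx.
  under eq_integral => x _ do rewrite fE.
  apply: monotone_convergence => //.
  - by move=> n; apply/measurable_EFinP.
  - by move=> n x _ //=; rewrite lee_fin.
  - by move=> x _ a b ab; rewrite lee_fin; exact/lefP/nd_nnsfun_approx.
have -> : (\int[mu]_x (f x * (g x)%:E) =
    lim (\int[mu]_x ((EFin \o h n) x * (g x)%:E) @[n --> \oo]))%E.
  have fE x : (f x * (g x)%:E)%E = lim ((EFin \o h n) x * (g x)%:E @[n --> \oo])%E.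
    apply/esym/cvg_lim => //; apply: cvgeZr => //.
    exact: cvg_nnsfun_approx.
  under eq_integral => x _ do rewrite fE.
  apply: monotone_convergence => //.
  - by move=> n; apply/emeasurable_funM => //; exact/measurable_EFinP.
  - by move=> n x _ /=; rewrite mule_ge0// lee_fin.
  - move=> x _ a b ab/=; rewrite lee_wpmul2r ?lee_fin//.
    exact/lefP/nd_nnsfun_approx.
apply/congr_lim/funext => n.
transitivity (\int[nu]_x
   (\sum_(y \in range (h n)) (y * \1_(h n @^-1` [set y]) x)%:E))%E.
  by apply: eq_integral => t _; rewrite /= fimfunE -fsumEFin.
rewrite ge0_integral_fsum//; last 2 first.
  - by move=> r; apply/measurable_EFinP/measurable_funM.
  - by move=> m y _; exact: nnfun_muleindic_ge0.
transitivity (\int[mu]_x (\sum_(y \in range (h n))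
    (y * \1_(h n @^-1` [set y]) x)%:E * (g x)%:E))%E; last first.
  apply: eq_integral => x _.
  rewrite -ge0_mule_fsuml => [|y]; last exact: nnfun_muleindic_ge0.
  by rewrite fsumEFin // -(fimfunE _ x).
rewrite ge0_integral_fsum//; last 2 first.
  - by move=> y; apply: emeasurable_funM => //; apply/measurable_EFinP/measurable_funM.
  - by move=> m y _; rewrite mule_ge0 ?lee_fin// -lee_fin; exact: nnfun_muleindic_ge0.
apply: eq_fsbigr => r /[!inE] -[t _ <-].
under eq_integral do rewrite EFinM.
rewrite integralZl_indic_nnsfun// integral_indic// setIT nuE//.
under [RHS]eq_integral do rewrite EFinM -muleA.
rewrite ge0_integralZl//; last 3 first.
- by apply: emeasurable_funM => //; exact/measurable_EFinP.
- by move=> x _; rewrite mule_ge0 ?lee_fin.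
- by rewrite lee_fin.
congr (_ * _)%E; rewrite integral_mkcond; apply: eq_integral => x _.
by rewrite epatch_indic/= muleC.
Qed.

End density.

Notation gauss h := (normal_prob 0 (Num.sqrt h)).

Section gaussian.
Context (R : realType).
Implicit Types (h a c g : R).

Lemma ge0_integral_gauss h (f : R -> \bar R) :
  measurable_fun setT f -> (forall x, (0 <= f x)%E) ->
  (\int[gauss h]_x f x =
   \int[lebesgue_measure]_x (f x * (normal_pdf 0 (Num.sqrt h) x)%:E))%E.
Proof.
move=> mf f0; apply: ge0_integral_density => //.
- exact: measurable_normal_pdf.
- by move=> x; exact: normal_pdf_ge0.
Qed.

(** The factor exp (c x^2) turns the density of variance h into a multiple of the density of
    variance h / (1 - 2 c h). *)
Lemma gauss_exp_sqr h c : 0 < h -> 2 * c * h < 1 ->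
  (\int[gauss h]_x (expR (c * x ^+ 2))%:E = ((Num.sqrt (1 - 2 * c * h))^-1)%:E)%E.
Proof.
move=> h0 ch.
have mc : measurable_fun [set: R] (fun x : R => expR (c * x ^+ 2)).
  apply: measurableT_comp => //; apply: measurable_funM => //.
rewrite ge0_integral_gauss; last 2 first.
- exact/measurable_EFinP.
- by move=> x; rewrite lee_fin expR_ge0.
have D0 : 0 < 1 - 2 * c * h by rewrite subr_gt0.
move DE : (1 - 2 * c * h) D0 => D D0.
have h'0 : 0 < h / D by rewrite divr_gt0.
move h'E : (h / D) h'0 => h' h'0.
have sh0 : Num.sqrt h != 0 by rewrite gt_eqF// sqrtr_gt0.
have sh'0 : Num.sqrt h' != 0 by rewrite gt_eqF// sqrtr_gt0.
transitivity (\int[lebesgue_measure]_x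
   (((Num.sqrt D)^-1)%:E * (normal_pdf 0 (Num.sqrt h') x)%:E))%E.
  apply: eq_integral => x _; rewrite -!EFinM; congr EFin.
  rewrite !normal_pdfE// /normal_peak /normal_fun !sqr_sqrtr ?ltW//.
  rewrite mulrCA -expRD [RHS]mulrA; congr (_ * expR _).
    rewrite -invfM; congr (_^-1).
    rewrite -sqrtrM ?ltW//; congr Num.sqrt.
    rewrite !mulr2n -h'E; set p := pi.
    by field; rewrite gt_eqF.
  rewrite -h'E subr0 !mulr2n -DE; field.
  by rewrite DE !gt_eqF ?addr_gt0.
rewrite ge0_integralZl//; last 2 first.
- by apply/measurable_EFinP; exact: measurable_normal_pdf.
- by move=> x _; rewrite lee_fin normal_pdf_ge0.
by rewrite integral_normal_pdf mule1.
Qed.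

(** With [s] the square root of 1 - y, this and the next lemma are Taylor bounds of (1 - y)^(-1/2);
    squaring leaves polynomial inequalities. *)
Lemma inv_sqrt_le (y s : R) : y <= 1 / 2 -> 0 < s -> s ^+ 2 = 1 - y ->
  s^-1 <= 1 + y / 2 + y ^+ 2.
Proof.
move=> y2 s0 sE.
have p : 0 < 1 + y / 2 + y ^+ 2 by nra.
rewrite -[leLHS]mul1r ler_pdivrMr//.
have q : 1 <= ((1 + y / 2 + y ^+ 2) * s) ^+ 2.
  have -> : ((1 + y / 2 + y ^+ 2) * s) ^+ 2 = 1 + y ^+ 2 * (5/4 - y * 5 / 4 - y ^+ 3).
    by rewrite exprMn sE; field.
  have : 0 <= y ^+ 2 by exact: sqr_ge0.
  have : 0 <= 5/4 - y * 5 / 4 - y ^+ 3 by nra.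
  by move=> *; nra.
rewrite -(ler_pXn2r (n := 2))// ?nnegrE ?expr1n// mulr_ge0// ltW//.
Qed.

Lemma inv_sqrt_ge (y s : R) : 0 < s -> s ^+ 2 = 1 - y -> 1 + y / 2 <= s^-1.
Proof.
move=> s0 sE; have [p|p] := leP (1 + y / 2) 0.
  by rewrite (le_trans p)// invr_ge0 ltW.
rewrite -[leRHS]mul1r ler_pdivlMr// -(ler_pXn2r (n := 2))//; last 2 first.
- by rewrite nnegrE mulr_ge0// ltW.
- by rewrite nnegrE.
rewrite exprMn sE expr1n.
have y1 : y < 1 by rewrite -subr_gt0 -sE exprn_gt0.
have -> : (1 + y / 2) ^+ 2 * (1 - y) = 1 - y ^+ 2 * (3 / 4 + y / 4) by field.
have : 0 <= y ^+ 2 by exact: sqr_ge0.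
by move=> *; nra.
Qed.

(** Integrate [sqr_le_expRD] at x^2: the terms of order h of the two exponential moments cancel, and
    order h^2 is left. *)
Lemma gauss_quart h : 0 < h -> h <= 1 / 4 ->
  (\int[gauss h]_x (x ^+ 4)%:E <= (64 * h ^+ 2)%:E)%E.
Proof.
move=> h0 h4.
have mE c : measurable_fun [set: R] (fun x : R => (expR (c * x ^+ 2))%:E).
  apply/measurable_EFinP; apply: measurableT_comp => //; exact: measurable_funM.
have mX : measurable_fun [set: R] (fun x : R => (x ^+ 4)%:E).
  by apply/measurable_EFinP.
have X0 (x : R) : 0 <= x ^+ 4 by rewrite exprn_even_ge0.
have e0 c (x : R) : (0 <= (expR (c * x ^+ 2))%:E)%E by rewrite lee_fin expR_ge0.
have key : (\int[gauss h]_x ((x ^+ 4)%:E + 8%:E) <=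
   \int[gauss h]_x (4%:E * ((expR (1 * x ^+ 2))%:E + (expR ((-1) * x ^+ 2))%:E)))%E.
  apply: ge0_le_integral => //.
  - by move=> x _; rewrite lee_fin addr_ge0.
  - exact: emeasurable_funD.
  - by apply: emeasurable_funM => //; apply: emeasurable_funD; exact: mE.
  - move=> x _; rewrite -!EFinD -!EFinM lee_fin mul1r mulN1r.
    by have := sqr_le_expRD (x ^+ 2); rewrite -exprM.
move: key; rewrite ge0_integralD//; last by move=> x _; rewrite lee_fin.
rewrite ge0_integralZl//; last 2 first.
- by apply: emeasurable_funD; exact: mE.
- by move=> x _; rewrite adde_ge0.
have -> : (\int[gauss h]_x ((expR (1 * x ^+ 2))%:E + (expR ((-1) * x ^+ 2))%:E) =
    \int[gauss h]_x (expR (1 * x ^+ 2))%:E + \int[gauss h]_x (expR ((-1) * x ^+ 2))%:E)%E.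
  by apply: ge0_integralD => //; exact: mE.
have e1 : 2 * 1 * h < 1 by lra.
have e2 : 2 * (-1) * h < 1 by lra.
rewrite !gauss_exp_sqr//.
rewrite integral_cst// [X in (8%:E * X)%E](_ : _ = 1%E) ?mule1; last first.
  exact: (@probability_setT _ _ _ (gauss h)).
move=> key; rewrite -(leeD2rE _ (x := 8%:E))//; apply: (le_trans key).
rewrite -!EFinD -EFinM lee_fin.
set s1 := Num.sqrt _; set s2 := Num.sqrt _.
have s10 : 0 < s1 by rewrite sqrtr_gt0; lra.
have s20 : 0 < s2 by rewrite sqrtr_gt0; lra.
have s1E : s1 ^+ 2 = 1 - 2 * h by rewrite sqr_sqrtr; lra.
have s2E : s2 ^+ 2 = 1 - (- 2 * h) by rewrite sqr_sqrtr; lra.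
have b1 : 2 * h <= 1 / 2 by lra.
have b2 : - 2 * h <= 1 / 2 by lra.
have := inv_sqrt_le b1 s10 s1E; have := inv_sqrt_le b2 s20 s2E.
by nra.
Qed.

Lemma normal_pdfN (s x : R) : s != 0 -> normal_pdf 0 s (- x) = normal_pdf 0 s x.
Proof. by move=> s0; rewrite !normal_pdfE// /normal_fun !subr0 sqrrN. Qed.

Lemma gaussN h (A : set R) : 0 < h -> measurable A ->
  gauss h (-%R @^-1` A) = gauss h A.
Proof.
move=> h0 mA; rewrite /normal_prob.
have sh0 : Num.sqrt h != 0 by rewrite gt_eqF// sqrtr_gt0.
transitivity (\int[pushforward lebesgue_measure (-%R : R -> measurableTypeR R)]_(x in A)
   (normal_pdf 0 (Num.sqrt h) x)%:E)%E.
  rewrite ge0_integral_pushforward//; last 2 first.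
  - apply/measurable_EFinP/measurable_funTS; exact: measurable_normal_pdf.
  - by move=> x _; rewrite lee_fin normal_pdf_ge0.
  by apply: eq_integral => x _ /=; rewrite normal_pdfN.
by apply: eq_measure_integral => B mB _; exact: lebesgue_measureN.
Qed.

Lemma gauss_sin a h : 0 < h -> \int[gauss h]_x sin (a * x) = 0.
Proof.
move=> h0.
have msin : measurable_fun [set: R] (fun x : R => sin (a * x)).
  apply: measurableT_comp; last exact: measurable_funM.
  by apply: continuous_measurable_fun; exact: continuous_sin.
have isin : (gauss h).-integrable setT (EFin \o (fun x : R => sin (a * x))).
  apply: measurable_bounded_integrable => //.
    by rewrite (le_lt_trans (@probability_le1 _ _ _ (gauss h) _ _))// ltry.
  exists 1; split; first exact: num_real.
  by move=> x Mx y _ /=; rewrite (le_trans (sin_max _))// ltW.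
have isinN : (gauss h).-integrable setT (EFin \o (fun x : R => sin (a * - x))).
  have := integrableN isin; apply: eq_integrable => // x _ /=.
  by rewrite mulrN sinN.
suff : \int[gauss h]_x sin (a * x) = - \int[gauss h]_x sin (a * x) by lra.
rewrite -mulN1r -RintegralZl//.
transitivity (\int[gauss h]_x sin (a * - x)); last first.
  by apply: eq_Rintegral => x _; rewrite mulrN sinN mulN1r.
rewrite /Rintegral; congr fine.
transitivity (\int[pushforward (gauss h) (-%R : R -> measurableTypeR R)]_x (sin (a * x))%:E)%E.
  by apply: eq_measure_integral => B mB _; apply/esym; exact: gaussN.
rewrite integral_pushforward//; exact/measurable_EFinP.
Qed.


(** Markov's inequality for the fourth power. The second moment would give order h only, and the sum
    over t / h steps would not vanish with the mesh. *)
Lemma gauss_tail h g : 0 < h -> h <= 1 / 4 -> 0 < g ->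
  (gauss h [set x | (g < `|x|)%R] <= (64 * h ^+ 2 / g ^+ 4)%:E)%E.
Proof.
move=> h0 h4 g0.
have mA : measurable [set x : R | g < `|x|].
  rewrite -[X in measurable X]setTI.
  have -> : [set x : R | g < `|x|] = (fun x => `|x|) @^-1` `]g, +oo[.
    by apply/seteqP; split => x /=; rewrite in_itv/= andbT.
  by apply: (normr_measurable measurableT); exact: measurable_itv.
have g4 : 0 < g ^+ 4 by rewrite exprn_gt0.
rewrite EFinM -lee_pdivrMr ?invr_gt0// invrK muleC.
apply: le_trans (gauss_quart h0 h4).
have -> : gauss h [set x | (g < `|x|)%R] =
    (\int[gauss h]_x (\1_[set x | (g < `|x|)%R] x)%:E)%E.
  by rewrite integral_indic// setIT.
rewrite -ge0_integralZl//; last 2 first.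
- by apply/measurable_EFinP/measurable_indic.
- by rewrite lee_fin ltW.
apply: ge0_le_integral => //.
- by move=> x _; rewrite -EFinM lee_fin mulr_ge0// ltW.
- by apply/measurable_EFinP/measurable_funM => //; exact/measurable_indic.
- by apply/measurable_EFinP.
- move=> x _; rewrite -EFinM lee_fin indicE.
  case: (boolP (x \in _)) => [/[!inE]/= gx|_]; last by rewrite mulr0 exprn_even_ge0.
  rewrite mulr1 -[leRHS]ger0_norm ?exprn_even_ge0// normrX.
  by rewrite lerXn2r ?nnegrE// ltW.
Qed.

Lemma gauss_bounded_integrable h (f : R -> R) (M : R) : measurable_fun setT f ->
  (forall x, `|f x| <= M) -> (gauss h).-integrable setT (EFin \o f).
Proof.
move=> mf fM; apply: measurable_bounded_integrable => //.
  by rewrite (le_lt_trans (@probability_le1 _ _ _ (gauss h) _ _))// ltry.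
exists M; split; first exact: num_real.
by move=> x Mx y _ /=; rewrite (le_trans (fM _))// ltW.
Qed.

(** In the constant 17, a quarter of the fourth moment 64 h^2 accounts for 16, and the expansion of
    (1 + a^2 h)^(-1/2) for 1. *)
Lemma gauss_cos a h : 0 < h -> h <= 1 / 4 ->
  `|\int[gauss h]_x cos (a * x) - (1 - a ^+ 2 * h / 2)| <= 17 * a ^+ 4 * h ^+ 2.
Proof.
move=> h0 h4.
have mcos : measurable_fun [set: R] (fun x : R => cos (a * x)).
  apply: measurableT_comp; last exact: measurable_funM.
  by apply: continuous_measurable_fun; exact: continuous_cos.
have icos : (gauss h).-integrable setT (EFin \o (fun x : R => cos (a * x))).
  by apply: (@gauss_bounded_integrable _ _ 1) => // x; exact: cos_max.
pose e := fun x : R => expR (- (a ^+ 2 / 2) * x ^+ 2).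
have me : measurable_fun [set: R] e.
  by apply: measurableT_comp => //; exact: measurable_funM.
have ie : (gauss h).-integrable setT (EFin \o e).
  apply: (@gauss_bounded_integrable _ _ 1) => // x.
  rewrite ger0_norm ?expR_ge0// -expR0 ler_expR.
  by rewrite mulNr oppr_le0 mulr_ge0// ?divr_ge0// sqr_ge0.
have X0 (x : R) : 0 <= x ^+ 4 by rewrite exprn_even_ge0.
have i4 : (gauss h).-integrable setT (EFin \o (fun x : R => x ^+ 4)).
  apply/integrableP; split; first exact/measurable_EFinP.
  under eq_integral do rewrite /= ger0_norm//.
  by rewrite (le_lt_trans (gauss_quart h0 h4))// ltry.
have i4a : (gauss h).-integrable setT (EFin \o (fun x : R => (a ^+ 4 / 4) * x ^+ 4)).
  have := integrableZl measurableT (a ^+ 4 / 4) i4.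
  by apply: eq_integrable => // x _ /=; rewrite EFinM.
have eE : \int[gauss h]_x e x = (Num.sqrt (1 + a ^+ 2 * h))^-1.
  rewrite /Rintegral gauss_exp_sqr//; last first.
    by rewrite (le_lt_trans _ (ltr01))// -subr_ge0; have := sqr_ge0 a; nra.
  by rewrite /=; congr (Num.sqrt _)^-1; field.
have d1 : `|\int[gauss h]_x cos (a * x) - \int[gauss h]_x e x| <= 16 * a ^+ 4 * h ^+ 2.
  rewrite -RintegralB//.
  apply: (@le_trans _ _ (\int[gauss h]_x `|cos (a * x) - e x|)).
    by apply: le_normr_Rintegral => //; exact: (integrableB _ icos ie).
  apply: (@le_trans _ _ (\int[gauss h]_x (a ^+ 4 / 4 * x ^+ 4))).
    apply: le_Rintegral => //.
    - by apply: integrable_norm; exact: (integrableB _ icos ie).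
    - move=> x _; rewrite /= /e; have := cos_sub_gauss (a * x).
      rewrite !exprMn mulrAC; congr (`|_ - expR _| <= _); last by field.
      by field.
  rewrite RintegralZl//.
  have : \int[gauss h]_x x ^+ 4 <= 64 * h ^+ 2.
    rewrite -lee_fin /Rintegral fineK ?gauss_quart//.
    exact: integrable_fin_num.
  have : 0 <= a ^+ 4 by rewrite exprn_even_ge0.
  by nra.
set s := Num.sqrt (1 + a ^+ 2 * h) in eE.
have a2h : 0 <= a ^+ 2 * h by rewrite mulr_ge0 ?sqr_ge0// ltW.
have s0 : 0 < s by rewrite sqrtr_gt0; lra.
have sE : s ^+ 2 = 1 - (- (a ^+ 2 * h)) by rewrite sqr_sqrtr; lra.
have := inv_sqrt_ge s0 sE.
have := inv_sqrt_le (_ : - (a ^+ 2 * h) <= 1 / 2) s0 sE.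
rewrite -eE sqrrN exprMn -exprM => /(_ ltac:(lra)).
move: d1; move: (\int[gauss h]_x cos (a * x)) (\int[gauss h]_x e x) => I J.
by rewrite !ler_norml => /andP[H1 H2] H3 H4; apply/andP; split; lra.
Qed.

(** In the addition formula the sine term integrates to 0, so cos (a x) is an eigenfunction of the
    Gaussian kernel: the martingale property in one step. *)
Lemma gauss_cos_shift a h x : 0 < h ->
  \int[gauss h]_y cos (a * (x + y)) = cos (a * x) * \int[gauss h]_y cos (a * y).
Proof.
move=> h0.
have mcos : measurable_fun [set: R] (fun x : R => cos (a * x)).
  apply: measurableT_comp; last exact: measurable_funM.
  by apply: continuous_measurable_fun; exact: continuous_cos.
have msin : measurable_fun [set: R] (fun x : R => sin (a * x)).
  apply: measurableT_comp; last exact: measurable_funM.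
  by apply: continuous_measurable_fun; exact: continuous_sin.
have icos : (gauss h).-integrable setT (EFin \o (fun x : R => cos (a * x))).
  by apply: (@gauss_bounded_integrable _ _ 1) => // y; exact: cos_max.
have isin : (gauss h).-integrable setT (EFin \o (fun x : R => sin (a * x))).
  by apply: (@gauss_bounded_integrable _ _ 1) => // y; exact: sin_max.
have icos' : (gauss h).-integrable setT (EFin \o (fun y : R => cos (a * x) * cos (a * y))).
  by have := integrableZl measurableT (cos (a * x)) icos; apply: eq_integrable.
have isin' : (gauss h).-integrable setT (EFin \o (fun y : R => sin (a * x) * sin (a * y))).
  by have := integrableZl measurableT (sin (a * x)) isin; apply: eq_integrable.
under eq_Rintegral do rewrite mulrDr cosD.
by rewrite RintegralB// !RintegralZl// gauss_sin// mulr0 subr0.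
Qed.
End gaussian.

(** * Independence of the future *)

(** A pi-lambda argument with two maps: [phi] will be the moved path and [psi] the path from time 0,
    so that one identity carries both the independence from E and the equality of laws. *)
Lemma dynkin_product (R : realType) d (T : measurableType d) (P : probability T R)
    (X : Type) (G : set (set X)) (phi psi : T -> X) (E : set T) :
  measurable E -> setI_closed G ->
  let good A := [/\ measurable (phi @^-1` A), measurable (psi @^-1` A) &
    P (E `&` phi @^-1` A) = (P E * P (psi @^-1` A))%E] in
  G `<=` good -> <<s G >> `<=` good.
Proof.
move=> mE GI good Ggood; rewrite -setI_closed_g_dynkin_g_sigma_algebra//.
have PEfin : P E \is a fin_num by exact: fin_num_measure.
apply: smallest_sub => //; split.
- split; rewrite ?preimage_setT//.
  by rewrite setIT probability_setT mule1.
- move=> A [mA mA' PA]; rewrite /good -!preimage_setC; split.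
  + exact: measurableC.
  + exact: measurableC.
  + rewrite -setDE measureD ?ltey_eq ?fin_num_measure//.
    transitivity (P E - P E * P (psi @^-1` A))%E; first by congr (_ - _)%E.
    rewrite probability_setC// -(fineK PEfin) -(fineK (fin_num_measure P _ mA')).
    by rewrite -EFinM -EFinB -[1%E]/(1%:E) -EFinB -EFinM mulrBr mulr1.
- move=> F tF FG; rewrite /good !preimage_bigcup; split.
  + by apply: bigcupT_measurable => n; have [] := FG n.
  + by apply: bigcupT_measurable => n; have [] := FG n.
  + rewrite setI_bigcupr measure_bigcup//; last 2 first.
    * by move=> n _; apply: measurableI => //; have [] := FG n.
    * move/trivIsetP : tF => tF; apply/trivIsetP => i j _ _ ij.
      by rewrite setIACA -(preimage_setI phi) (tF i j)// preimage_set0 setI0.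
    rewrite measure_bigcup//; last 2 first.
    * by move=> n _; have [] := FG n.
    * move/trivIsetP : tF => tF; apply/trivIsetP => i j _ _ ij.
      by rewrite -(preimage_setI psi) (tF i j)// preimage_set0.
    rewrite -(fineK PEfin) -nneseriesZl//.
    by apply: eq_eseriesr => n _; rewrite fineK//; have [] := FG n.
Qed.

(** * Finite families of increments and moved paths *)

Section boxes.
Context (R : realType) (d : measure_display) (Omega : measurableType d)
  (P : probability Omega R) (b : R -> {RV P >-> R}).
Implicit Types (l : seq (R * set R)) (s h : R) (B : set Omega).

Fixpoint box s l : set Omega :=
  if l is (h, A) :: l' then
    [set w | A (b (s + h) w - b s w)] `&` box (s + h) l'
  else setT.

Fixpoint box_prob l : \bar R :=
  if l is (h, A) :: l' then (gauss h A * box_prob l')%E else 1%E.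

Fixpoint steps l : Prop :=
  if l is (h, A) :: l' then [/\ 0 < h, measurable A & steps l'] else True.

(** Constant past the end of the list, so that the sequence is nondecreasing on all of nat, as the
    independence of increments is stated. *)
Fixpoint times s l (i : nat) {struct i} : R :=
  if i is i'.+1 then (if l is x :: l' then times (s + x.1) l' i' else s) else s.

(* B is independent of the increments of b after time s, tested on finite
   products of Borel sets. *)
Definition future s B := measurable B /\
  forall l, steps l -> P (B `&` box s l) = (P B * box_prob l)%E.

Lemma measurable_increment s t (A : set R) : measurable A ->
  measurable [set w | A (b t w - b s w)].
Proof.
move=> mA; rewrite -[X in measurable X]setTI.
by apply: (measurable_funB (f := b t) (g := b s)).
Qed.

Lemma measurable_box s l : steps l -> measurable (box s l).
Proof.
elim: l s => [|[h A] l IH] s//= [h0 mA /IH ml].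
by apply: measurableI => //; exact: measurable_increment.
Qed.

Lemma boxE s l : box s l = [set w | forall i, (i < size l)%N ->
  (nth (0, setT) l i).2 (b (times s l i.+1) w - b (times s l i) w)].
Proof.
elim: l s => [|[h A] l IH] s /=; first by apply/seteqP; split.
rewrite IH; apply/seteqP; split => w /=.
  by move=> [Aw H] [//|i] /H.
by move=> H; split; [exact: (H 0%N)|move=> i il; exact: (H i.+1)].
Qed.

Lemma times_homo s l : steps l -> {homo times s l : i j / (i <= j)%N >-> i <= j}.
Proof.
move=> sl; apply/nondecreasing_seqP => i.
elim: i s l sl => [|i IH] s [|[h A] l] //= [h0 mA sl].
  by rewrite lerDl ltW.
exact: IH.
Qed.

Lemma box_cat s l l' : box s (l ++ l') =
  box s l `&` box (s + \sum_(x <- l) x.1) l'.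
Proof.
elim: l s => [|[h A] l IH] s /=; first by rewrite big_nil addr0 setTI.
by rewrite IH setIA big_cons addrA.
Qed.

Lemma box_prob_cat l l' : box_prob (l ++ l') = (box_prob l * box_prob l')%E.
Proof.
by elim: l => [|[h A] l IH] /=; rewrite ?mul1e// IH muleA.
Qed.

Lemma steps_cat l l' : steps l -> steps l' -> steps (l ++ l').
Proof. by elim: l => [//|[h A] l IH] /= [? ? /IH] H /H. Qed.

Lemma future_setT (hb : brownian_motion b) s : 0 <= s -> future s setT.
Proof.
move=> s0; split => // l sl; rewrite setTI probability_setT mul1e.
have [_ _ gaussb indep] := hb.
have mA i : measurable (nth (0, setT) l i).2.
  elim: l sl i => [|[h A] l IH] /=; first by move=> _ i; rewrite nth_nil; exact: measurableT.
  by move=> [_ mA /IH{}IH] [//|i]; exact: IH.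
have := indep (size l) (times s l) s0 (times_homo s sl) [set: 'I_(size l)]%SET
  (fun i => (nth (0, setT) l i).2) (fun i => mA i).
rewrite (_ : \bigcap_(i in _) _ = box s l); last first.
  rewrite boxE; apply/seteqP; split => w /= H i.
    by move=> il; have := H (Ordinal il); apply; rewrite /= inE.
  by move=> _; exact: H.
move=> ->; under eq_bigl do rewrite inE.
elim: l s s0 sl {mA} => [|[h A] l IH] s s0 /=; first by rewrite big_ord0.
move=> [h0 mA sl]; rewrite big_ord_recl IH// ?addr_ge0// ?ltW//; congr (_ * _)%E.
have sh : s < s + h by rewrite ltrDl.
by have := gaussb s (s + h) s0 sh A mA; rewrite (addrAC s h) subrr add0r.
Qed.

(* The path on [s, s + h] brought back to [0, h], possibly reversed in time and
   negated: each of the four maps preserves the law of Brownian motion. *)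
Definition moved (neg rev : bool) s h (u : R) (w : Omega) : R :=
  let x := if rev then b (s + h - u) w - b (s + h) w else b (s + u) w - b s w in
  if neg then - x else x.

Definition grid_rect h (k : nat) (A : nat -> set R) : set (R -> R) :=
  [set f | forall i, (i < k)%N -> A i (f (h * i.+1%:R) - f (h * i%:R))].

Definition grid_sets h (k : nat) : set (set (R -> R)) :=
  [set G | exists2 A : nat -> set R, (forall i, measurable (A i)) & G = grid_rect h k A].

Lemma grid_sets_setI h k : setI_closed (grid_sets h k).
Proof.
move=> _ _ [A mA ->] [A' mA' ->]; exists (fun i => A i `&` A' i).
  by move=> i; exact: measurableI.
apply/seteqP; split => f /=; first by move=> [H H'] i ik; split; [exact: H|exact: H'].
by move=> H; split => i /H[].
Qed.

Definition grid_box h (k j : nat) (A : nat -> set R) := [seq (h, A i) | i <- iota j k].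

Lemma steps_grid_box h k j A : 0 < h -> (forall i, measurable (A i)) ->
  steps (grid_box h k j A).
Proof.
move=> h0 mA; elim: k j => [//|k IH] j /=.
by split; [|exact: mA|exact: IH].
Qed.

Lemma box_grid s h k j A : box s (grid_box h k j A) =
  [set w | forall i, (i < k)%N ->
    A (j + i)%N (b (s + h * i.+1%:R) w - b (s + h * i%:R) w)].
Proof.
have hS i : h + h * i%:R = h * i.+1%:R by rewrite -natr1; ring.
elim: k s j => [|k IH] s j /=; first by apply/seteqP; split.
rewrite IH; apply/seteqP; split => w /=.
  move=> [H0 H] [|i] ik; first by rewrite addn0 mulr1 mulr0 addr0.
  have := H i ik; by rewrite addSnnS -!addrA !hS.
move=> H; split; first by have := H 0%N isT; rewrite addn0 mulr1 mulr0 addr0.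
move=> i ik; have := H i.+1 ik; by rewrite addSnnS -!addrA !hS.
Qed.

Lemma box_prob_grid h k j A :
  box_prob (grid_box h k j A) = (\prod_(i <- iota j k) gauss h (A i))%E.
Proof. by elim: k j => [|k IH] j /=; rewrite ?big_nil// big_cons IH. Qed.

Lemma sum_grid_box h k j A : \sum_(x <- grid_box h k j A) x.1 = h * k%:R.
Proof.
elim: k j => [|k IH] j /=; first by rewrite big_nil mulr0.
by rewrite big_cons IH/= -natr1 mulrDr mulr1 addrC.
Qed.

(** The condition put on the i-th increment of b itself. Reversal reads the grid backwards and also
    changes the sign of each increment, hence the exclusive or with the negation. *)
Let moved_sets (neg rev : bool) (k : nat) (A : nat -> set R) (i : nat) : set R :=
  let A' := if rev then A (k - i.+1)%N else A i in
  if neg (+) rev then -%R @^-1` A' else A'.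

Let moved_rect neg rev s h k A :
  [set w | grid_rect h k A (moved neg rev s (h * k%:R) ^~ w)] =
  box s (grid_box h k 0 (moved_sets neg rev k A)).
Proof.
rewrite box_grid; apply/seteqP; split => w /=.
- move=> H i ik; rewrite add0n /moved_sets; case: rev H => H; last first.
    have := H i ik; rewrite /moved addbF; case: neg {H} => /=; last first.
      by congr (A i _); ring.
    by congr (A i _); ring.
  have ki : (k - i.+1 < k)%N by rewrite ltn_subrL (leq_ltn_trans _ ik).
  have := H _ ki; rewrite /moved -subSn// subSS !natrB// 1?ltnW//.
  have -> : s + h * k%:R - h * (k%:R - i%:R) = s + h * i%:R by ring.
  have -> : s + h * k%:R - h * (k%:R - i.+1%:R) = s + h * i.+1%:R by ring.
  by case: neg {H} => /=; congr (A _ _); ring.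
- move=> H i ik; case: rev H => H; last first.
    have := H i ik; rewrite /moved_sets /moved add0n addbF; case: neg {H} => /=.
      by congr (A i _); ring.
    by congr (A i _); ring.
  have ki : (k - i.+1 < k)%N by rewrite ltn_subrL (leq_ltn_trans _ ik).
  have := H _ ki; rewrite /moved /moved_sets add0n -subSn// subSS subKn// 1?ltnW//.
  rewrite !natrB// 1?ltnW//.
  have -> : s + h * k%:R - h * i.+1%:R = s + h * (k%:R - i.+1%:R) by ring.
  have -> : s + h * k%:R - h * i%:R = s + h * (k%:R - i%:R) by ring.
  by case: neg {H} => /=; congr (A _ _); ring.
Qed.

Let measurable_moved_sets neg rev k A : (forall i, measurable (A i)) ->
  forall i, measurable (moved_sets neg rev k A i).
Proof.
move=> mA i; rewrite /moved_sets.
have mN (C : set R) : measurable C -> measurable (-%R @^-1` C).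
  by move=> mC; rewrite -[X in measurable X]setTI; exact: oppr_measurable.
by case: rev; case: neg => //=; exact: mN.
Qed.

Let moved_sets_prob neg rev h k A : 0 < h -> (forall i, measurable (A i)) ->
  (\prod_(i <- iota 0 k) gauss h (moved_sets neg rev k A i) =
   \prod_(i <- iota 0 k) gauss h (A i))%E.
Proof.
move=> h0 mA; transitivity (\prod_(0 <= i < k) gauss h
    (if rev then A (k - i.+1)%N else A i))%E.
  rewrite /index_iota subn0; apply: eq_bigr => i _; rewrite /moved_sets.
  by case: ifP => // _; rewrite gaussN//; case: rev.
rewrite -[in RHS](subn0 k) -/(index_iota 0 k); case: rev => //.
by rewrite [RHS]big_nat_rev/=; apply: eq_bigr => i _; rewrite add0n.
Qed.

(** Symmetry of the Gaussian law and reordering of a product give the moved path the law of b. The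
    last conclusion allows the lemma to be applied again from the end of the window. *)
Lemma markov_grid (hb : brownian_motion b) neg rev s B h k G :
  0 < h -> future s B -> <<s grid_sets h k >> G ->
  let E := [set w | G (moved neg rev s (h * k%:R) ^~ w)] in
  [/\ measurable E, measurable [set w | G (b ^~ w)],
     P (B `&` E) = (P B * P [set w | G (b ^~ w)])%E &
     future (s + h * k%:R) (B `&` E)].
Proof.
move=> h0 fB GG E.
have [mB PB] := fB.
(* The window and the steps [l] that follow it form one longer box from s, to which [future]
   applies; [l] is kept in order to obtain [future] at the end of the window. *)
have rectE (l : seq (R * set R)) A : steps l -> (forall i, measurable (A i)) ->
    P (B `&` box (s + h * k%:R) l `&`
       [set w | grid_rect h k A (moved neg rev s (h * k%:R) ^~ w)]) =
    (P B * box_prob l * \prod_(i <- iota 0 k) gauss h (A i))%E.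
  move=> sl mA; rewrite moved_rect -setIA (setIC (box _ l)).
  have mA' := measurable_moved_sets neg rev k mA.
  rewrite -{1}(sum_grid_box h k 0 (moved_sets neg rev k A)) -box_cat PB; last first.
    by apply: steps_cat => //; exact: steps_grid_box.
  by rewrite box_prob_cat box_prob_grid moved_sets_prob// -muleA (muleC (box_prob l)).
have rectb A : (forall i, measurable (A i)) ->
    P [set w | grid_rect h k A (b ^~ w)] = (\prod_(i <- iota 0 k) gauss h (A i))%E.
  move=> mA; have [_ /(_ _ (steps_grid_box k 0 h0 mA))] := future_setT hb (lexx 0).
  rewrite setTI probability_setT mul1e box_prob_grid => <-; congr (P _).
  rewrite box_grid; apply/seteqP; split => w H i ik;
  by have := H i ik; rewrite ?add0n ?add0r.
have PE (l : seq (R * set R)) : steps l ->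
    P (B `&` box (s + h * k%:R) l) = (P B * box_prob l)%E.
  move=> sl; have := rectE l (fun=> setT) sl (fun=> measurableT).
  rewrite (_ : [set w | _] = setT) ?setIT; last by apply/seteqP; split.
  rewrite -rectb// (_ : [set w | _] = setT) ?probability_setT ?mule1//.
  by apply/seteqP; split.
have main (l : seq (R * set R)) : steps l -> [/\ measurable E, measurable [set w | G (b ^~ w)] &
    P (B `&` box (s + h * k%:R) l `&` E) =
    (P (B `&` box (s + h * k%:R) l) * P [set w | G (b ^~ w)])%E].
  move=> sl; have mBl : measurable (B `&` box (s + h * k%:R) l).
    by apply: measurableI => //; exact: measurable_box.
  apply: (dynkin_product (phi := fun w u => moved neg rev s (h * k%:R) u w)
    (psi := fun w u => b u w) mBl (@grid_sets_setI h k) _ GG).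
  move=> _ [A mA ->]; split.
  - rewrite [X in measurable X](moved_rect neg rev s h k A).
    by apply: measurable_box; apply: steps_grid_box => //; exact: measurable_moved_sets.
  - rewrite [X in measurable X](_ : _ = box 0 (grid_box h k 0 A)).
      by apply: measurable_box; exact: steps_grid_box.
    rewrite box_grid; apply/seteqP; split => w H i ik;
    by have := H i ik; rewrite ?add0n ?add0r.
  - by rewrite [LHS]rectE// PE//; congr (_ * _)%E; rewrite -rectb.
have [mE mGb PE0] := main [::] I.
split => //; first by move: PE0; rewrite /= setIT.
split; first exact: measurableI.
move=> l sl; have [_ _] := main l sl; rewrite setIAC => ->.
by move: PE0; rewrite /= setIT => ->; rewrite PE// -!muleA (muleC (box_prob l)).
Qed.

End boxes.

(** * Events of a path: dyadic increments, tubes and bins *)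

Section path_sets.
Context (R : realType).
Implicit Types (h t r : R).

Lemma measurable_grid_value h k i : (i <= k)%N ->
  measurable_fun setT
    (fun f : g_sigma_algebraType (@grid_sets R h k) => f (h * i%:R) - f 0).
Proof.
elim: i => [|i IH] ik.
  rewrite (_ : (fun _ => _) = cst 0) ?mulr0; first exact: measurable_cst.
  by apply/funext => f /=; rewrite subrr.
rewrite (_ : (fun _ => _) = (fun f : g_sigma_algebraType (@grid_sets R h k) =>
    (f (h * i.+1%:R) - f (h * i%:R)) + (f (h * i%:R) - f 0))); last first.
  by apply/funext => f; rewrite addrA subrK.
apply: measurable_funD; last by apply: IH; exact: ltnW.
move=> _ A mA; rewrite setTI; apply: sub_sigma_algebra.
exists (fun j => if j == i then A else setT).
  by move=> j; case: ifP.
apply/seteqP; split => f /= H.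
  by move=> j jk; case: ifP => // /eqP ->.
by have := H i ik; rewrite eqxx.
Qed.

Lemma measurable_grid_increment h k i j (A : set R) : (i <= k)%N -> (j <= k)%N ->
  measurable A -> <<s grid_sets h k>> [set f | A (f (h * j%:R) - f (h * i%:R))].
Proof.
move=> ik jk mA.
have := measurable_funB (@measurable_grid_value h k j jk) (@measurable_grid_value h k i ik).
move=> /(_ measurableT A mA); rewrite setTI.
congr (<<s _>> _); apply/seteqP; split => f /=; congr (A _); ring.
Qed.

Lemma grid_sets_refine h k : grid_sets (2 * h) k `<=` <<s grid_sets h (2 * k)>>.
Proof.
move=> _ [A mA ->].
have -> : grid_rect (2 * h) k A =
  \bigcap_(i in [set: nat]) (if (i < k)%N then
    [set f | A i (f (h * (2 * i.+1)%N%:R) - f (h * (2 * i)%N%:R))] else setT).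
  have e f i : A i (f (2 * h * i.+1%:R) - f (2 * h * i%:R)) =
               A i (f (h * (2 * i.+1)%N%:R) - f (h * (2 * i)%N%:R)).
    by congr (A i (f _ - f _)); rewrite natrM; ring.
  apply/seteqP; split => f.
    by move=> H i _; case: ifP => //= ik; rewrite -e; exact: H.
  by move=> H i ik; rewrite e; have := H i I; rewrite ik.
apply: (@bigcapT_measurable _ (g_sigma_algebraType (grid_sets h (2 * k)))) => i.
case: ifP => ik; last exact: (@measurableT _ (g_sigma_algebraType (grid_sets h (2 * k)))).
by apply: measurable_grid_increment => //; rewrite leq_mul2l//= ltnW.
Qed.

(** The sigma-algebras increase with m, so their union is closed under finite intersections, as the
    extension to [path_sets] requires. *)
Definition path_gen t : set (set (R -> R)) :=
  \bigcup_m <<s grid_sets (t / 2 ^+ m) (2 ^ m)>>.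

Definition path_sets t := <<s path_gen t>>.

Lemma grid_sets_le t m m' : (m <= m')%N ->
  <<s grid_sets (t / 2 ^+ m) (2 ^ m)>> `<=` <<s grid_sets (t / 2 ^+ m') (2 ^ m')>>.
Proof.
elim: m' m => [|m' IH] m; first by rewrite leqn0 => /eqP ->.
rewrite leq_eqVlt => /orP[/eqP ->//|/IH]; move/subset_trans; apply.
apply: smallest_sub; first exact: smallest_sigma_algebra.
rewrite expnS (_ : t / 2 ^+ m' = 2 * (t / 2 ^+ m'.+1)); last first.
  by rewrite exprS; field; rewrite expf_neq0.
exact: grid_sets_refine.
Qed.

Lemma path_gen_setI t : setI_closed (path_gen t).
Proof.
move=> A B [m _ mA] [m' _ mB]; exists (maxn m m') => //.
apply: (@measurableI _ (g_sigma_algebraType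
   (grid_sets (t / 2 ^+ (maxn m m')) (2 ^ (maxn m m'))))).
  by apply: grid_sets_le mA; exact: leq_maxl.
by apply: grid_sets_le mB; exact: leq_maxr.
Qed.

Lemma measurable_path_value t m i : (i <= 2 ^ m)%N ->
  measurable_fun setT
    (fun f : g_sigma_algebraType (path_gen t) => f (t / 2 ^+ m * i%:R) - f 0).
Proof.
move=> im _ A mA; rewrite setTI; apply: sub_sigma_algebra; exists m => //.
have := @measurable_grid_value (t / 2 ^+ m) _ _ im measurableT _ mA.
by rewrite setTI.
Qed.

Definition grid_tube t m r : set (R -> R) :=
  [set f | forall i, (i <= 2 ^ m)%N -> `|f (t / 2 ^+ m * i%:R) - f 0| <= r].

(** Countably many times keep the set in [path_sets]; for a continuous path this is confinement on
    all of [0, t]. *)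
Definition tube t r : set (R -> R) := \bigcap_m grid_tube t m r.

Lemma path_sets_grid_tube t m r : path_sets t (grid_tube t m r).
Proof.
rewrite (_ : grid_tube _ _ _ = \bigcap_(i in [set: nat]) (if (i <= 2 ^ m)%N then
    [set f | `|f (t / 2 ^+ m * i%:R) - f 0| <= r] else setT)); last first.
  apply/seteqP; split => f.
    by move=> H i _; case: ifP => //= im; exact: H.
  by move=> H i im; have := H i I; rewrite im.
apply: (@bigcapT_measurable _ (g_sigma_algebraType (path_gen t))) => i.
case: ifP => im; last exact: (@measurableT _ (g_sigma_algebraType (path_gen t))).
have := @measurable_path_value t m i im measurableT _ (measurable_itv `[- r, r]).
rewrite setTI; congr (path_sets _ _); apply/seteqP; split => f /=;
by rewrite in_itv/= ler_norml.
Qed.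

Lemma path_sets_tube t r : path_sets t (tube t r).
Proof.
apply: (@bigcapT_measurable _ (g_sigma_algebraType (path_gen t))) => m.
exact: path_sets_grid_tube.
Qed.

Lemma grid_tube_decr t r : 0 <= t -> {homo (fun m => grid_tube t m r) : m n / (m <= n)%N >-> n `<=` m}.
Proof.
move=> t0 m n mn f H i im.
have -> : t / 2 ^+ m * i%:R = t / 2 ^+ n * (i * 2 ^ (n - m))%N%:R.
  rewrite natrM natrX -{1}(subnK mn) exprD; field.
  by rewrite !expf_neq0.
by apply: H; rewrite -{2}(subnKC mn) expnD leq_mul2r im orbT.
Qed.

Definition riemann_sum t m (f : R -> R) : R :=
  t / 2 ^+ m * \sum_(i < 2 ^ m) (f (t / 2 ^+ m * i%:R) - f 0).

(* The last condition says that the integral of f - f 0 over [0, t] lies in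
   [i, i + t nu]; Riemann sums keep it in the sigma-algebra generated by the
   dyadic increments. *)
Definition bin t (r e i nu : R) : set (R -> R) :=
  tube t r `&` [set f | e <= f t - f 0 <= e + nu] `&`
  [set f | forall k, exists m0, forall m, (m0 <= m)%N ->
     i - k.+1%:R^-1 <= riemann_sum t m f <= i + t * nu + k.+1%:R^-1].

Lemma path_sets_bin t r e i nu : path_sets t (bin t r e i nu).
Proof.
apply: (@measurableI _ (g_sigma_algebraType (path_gen t))).
  apply: (@measurableI _ (g_sigma_algebraType (path_gen t))).
    exact: path_sets_tube.
  have := @measurable_path_value t 0 1 (leqnn _) measurableT _ (measurable_itv `[e, e + nu]).
  rewrite setTI; congr (path_sets _ _); apply/seteqP; split => f /=;
  by rewrite in_itv/= expr0 divr1 mulr1.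
rewrite (_ : [set f | _] = \bigcap_(k in [set: nat]) \bigcup_(m0 in [set: nat])
    \bigcap_(m in [set: nat]) (if (m0 <= m)%N then
      [set f | i - k.+1%:R^-1 <= riemann_sum t m f <= i + t * nu + k.+1%:R^-1]
      else setT)); last first.
  apply/seteqP; split => f.
    move=> H k _; have [m0 Hm] := H k; exists m0 => // m _.
    by case: ifP => //= /Hm.
  move=> H k; have [m0 _ Hm] := H k I; exists m0 => m mm.
  by have := Hm m I; rewrite mm.
apply: (@bigcapT_measurable _ (g_sigma_algebraType (path_gen t))) => k.
apply: (@bigcupT_measurable _ (g_sigma_algebraType (path_gen t))) => m0.
apply: (@bigcapT_measurable _ (g_sigma_algebraType (path_gen t))) => m.
case: ifP => _; last exact: (@measurableT _ (g_sigma_algebraType (path_gen t))).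
have mR : measurable_fun setT (fun f : g_sigma_algebraType (path_gen t) => riemann_sum t m f).
  apply: measurable_funM; first exact: measurable_cst.
  apply: measurable_sum => j; apply: measurable_path_value.
  exact: ltnW.
have := mR measurableT _ (measurable_itv `[i - k.+1%:R^-1, i + t * nu + k.+1%:R^-1]).
by rewrite setTI; congr (path_sets _ _); apply/seteqP; split => f /=; rewrite in_itv.
Qed.

End path_sets.

Section markov.
Context (R : realType) (d : measure_display) (Omega : measurableType d)
  (P : probability Omega R) (b : R -> {RV P >-> R}).
Implicit Types (s t r : R) (B : set Omega).
Hypothesis hb : brownian_motion b.

Lemma markov neg rev s B t G : 0 < t -> future b s B -> path_sets t G ->
  let E := [set w | G (moved b neg rev s t ^~ w)] in
  [/\ measurable E, measurable [set w | G (b ^~ w)],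
     P (B `&` E) = (P B * P [set w | G (b ^~ w)])%E &
     future b (s + t) (B `&` E)].
Proof.
move=> t0 fB GG E.
have [mB PB] := fB.
have tE m : t / 2 ^+ m * (2 ^ m)%N%:R = t.
  by rewrite natrX divfK// expf_neq0.
have lev m G' : <<s grid_sets (t / 2 ^+ m) (2 ^ m)>> G' ->
  let E' := [set w | G' (moved b neg rev s t ^~ w)] in
  [/\ measurable E', measurable [set w | G' (b ^~ w)],
     P (B `&` E') = (P B * P [set w | G' (b ^~ w)])%E &
     future b (s + t) (B `&` E')].
  move=> mG'; have := @markov_grid _ _ _ _ _ hb neg rev s B (t / 2 ^+ m) (2 ^ m) G' _ fB mG'.
  rewrite tE; apply.
  by rewrite divr_gt0// exprn_gt0.
(* The trivial path event: B is independent also of the increments after s + t. *)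
have fB' : future b (s + t) B.
  have [_ _ _] := lev 0%N setT (@measurableT _ (g_sigma_algebraType (grid_sets (t / 2 ^+ 0) (2 ^ 0)))).
  by rewrite (_ : [set w | _] = setT) ?setIT//; apply/seteqP; split.
have main (l : seq (R * set R)) : steps l -> [/\ measurable E, measurable [set w | G (b ^~ w)] &
    P (B `&` box b (s + t) l `&` E) =
    (P (B `&` box b (s + t) l) * P [set w | G (b ^~ w)])%E].
  move=> sl; have mBl : measurable (B `&` box b (s + t) l).
    by apply: measurableI => //; exact: measurable_box.
  apply: (dynkin_product (phi := fun w u => moved b neg rev s t u w)
    (psi := fun w u => b u w) mBl (@path_gen_setI R t) _ GG).
  move=> G' [m _ mG']; have [mE' mG'b PE' [_ fE']] := lev m G' mG'.
  split => //; rewrite setIAC [LHS]fE'// [X in (X * _)%E = _]PE'.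
  by rewrite (proj2 fB')// -!muleA (muleC (box_prob l)).
have [mE mGb PE0] := main [::] I.
split => //; first by move: PE0; rewrite /= setIT.
split; first exact: measurableI.
move=> l sl; have [_ _] := main l sl; rewrite setIAC => ->.
by move: PE0; rewrite /= setIT => ->; rewrite (proj2 fB')// -!muleA (muleC (box_prob l)).
Qed.

End markov.

(** * Confinement of Brownian motion *)

Section restricted_law.
Context (R : realType) d (T : measurableType d) (P : probability T R) (E : set T)
  (mE : measurable E) d' (T' : measurableType d') (U : T -> T')
  (mU : measurable_fun setT U).

(** The law of U on the event E, of mass P E. Having the measurability of U as an argument lets the
    finite measure structure be attached to this term, for product measures and Fubini. *)
Definition restricted_law of measurable_fun setT U := pushforward (mrestr P mE) U.

Let m : {measure set T' -> \bar R} :=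
  measure_function_pushforward__canonical__measure_function_Measure (mrestr P mE) mU.

Local Notation law := (restricted_law mU).

HB.instance Definition _ := isMeasure.Build _ _ _ law
  (measure0 m) (measure_ge0 m) (@measure_semi_sigma_additive _ _ _ m).

Let law_fin : fin_num_fun law.
Proof.
move=> A mA; rewrite /restricted_law /pushforward /mrestr.
by apply: fin_num_measure; apply: measurableI => //; rewrite -[X in measurable X]setTI; exact: mU.
Qed.

HB.instance Definition _ := Measure_isFinite.Build _ _ _ law law_fin.

Lemma integral_restricted_law (f : T' -> R) (M : R) : measurable_fun setT f ->
  (forall x, `|f x| <= M) ->
  (\int[law]_x (f x)%:E = \int[P]_(x in E) (f (U x))%:E)%E.
Proof.
move=> mf fM.
have mfU : measurable_fun setT (f \o U) by exact: measurableT_comp.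
have mfin : (mrestr P mE setT < +oo)%E.
  by rewrite /mrestr setTI (le_lt_trans (probability_le1 P mE))// ltry.
transitivity (\int[pushforward (mrestr P mE) U]_x (f x)%:E)%E.
  exact: eq_measure_integral.
rewrite integral_pushforward//=; last 2 first.
- exact/measurable_EFinP.
- rewrite preimage_setT; apply: measurable_bounded_integrable => //.
  by exists M; split; [exact: num_real|move=> x Mx y _ /=; rewrite (le_trans (fM _))// ltW].
rewrite preimage_setT.
transitivity (\int[mrestr P mE]_(x in E) ((f (U x))%:E))%E.
  rewrite (negligible_integral (N := ~` E))//.
  - by rewrite setTD setCK.
  - exact: measurableC.
  - apply: measurable_bounded_integrable => //.
    by exists M; split; [exact: num_real|move=> x Mx y _ /=; rewrite (le_trans (fM _))// ltW].
  - exact: (etrans (congr1 P (setICl E)) (measure0 P)).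
by apply: eq_measure_integral => A mA AE; exact: (congr1 P (setIidl AE)).
Qed.

End restricted_law.

Section cos_step.
Context (R : realType) (d : measure_display) (Omega : measurableType d)
  (P : probability Omega R) (b : R -> {RV P >-> R}).
Implicit Types (s t r h a : R) (B : set Omega).

(** On B the position at time s and the next increment have a product law, so Fubini reduces the
    claim to [gauss_cos_shift]. To get this joint law, B is tested together with the position. *)
Lemma cos_step B s h a : 0 < h -> measurable B ->
  (forall A : set R, measurable A -> future b s (B `&` [set w | A (b s w)])) ->
  (\int[P]_(w in B) (cos (a * b (s + h) w))%:E =
   (\int[gauss h]_y cos (a * y))%:E * \int[P]_(w in B) (cos (a * b s w))%:E)%E.
Proof.
move=> h0 mB fB.
have mcos : measurable_fun [set: R] (fun x : R => cos (a * x)).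
  apply: measurableT_comp; last exact: measurable_funM.
  by apply: continuous_measurable_fun; exact: continuous_cos.
pose T2 := measurableTypeR R.
pose U : Omega -> T2 := b s.
pose V : Omega -> T2 := fun w => b (s + h) w - b s w.
have mV : measurable_fun setT V by exact: measurable_funB.
have mU : measurable_fun setT U by exact: (measurable_funP (b s)).
have mUV : measurable_fun setT (fun w => (U w, V w)) by exact: measurable_fun_pair.
pose F := fun z : T2 * T2 => cos (a * ((z.1 : R) + z.2)).
have mF : measurable_fun setT F.
  apply: (measurableT_comp mcos); apply: measurable_funD.
    exact: measurable_fst.
  exact: measurable_snd.
have F1 z : `|F z| <= 1 by exact: cos_max.
(* Rectangles determine the measure, and on a rectangle the hypothesis is applied to a box of one
   step. *)
have lawE (X : set (T2 * T2)) : measurable X ->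
    (restricted_law P mB mU \x gauss h)%E X = restricted_law P mB mUV X.
  apply: product_measure_unique => A A' mA mA' /=.
  rewrite /restricted_law /pushforward /mrestr.
  have mA'' : steps [:: (h, A')] by [].
  have [_ /(_ _ mA'')] := fB A mA; rewrite /= setIT mule1 setIC => PE.
  rewrite [X in _ = (X * _)%E](_ : _ = P (B `&` [set w | A (b s w)])); last first.
    by rewrite setIC.
  rewrite -PE; congr (P _).
  by apply/seteqP; split => w /=; rewrite /V; tauto.
transitivity (\int[P]_(w in B) (F (b s w, V w))%:E)%E.
  have e w : b (s + h) w = b s w + (b (s + h) w - b s w) by ring.
  by apply: eq_integral => w _; congr ((cos (a * _))%:E); exact: e.
rewrite -(integral_restricted_law P mB mUV mF F1).
transitivity (\int[(restricted_law P mB mU \x gauss h)%E]_z (F z)%:E)%E.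
  by apply: eq_measure_integral => X mX _; apply/esym; exact: lawE.
have iF : (restricted_law P mB mU \x gauss h)%E.-integrable setT (EFin \o F).
  apply: measurable_bounded_integrable => //.
    rewrite [ltLHS](lawE setT measurableT) -ge0_fin_numE//.
    exact: fin_num_measure.
  by exists 1; split; [exact: num_real|move=> x Mx y _ /=; rewrite (le_trans (F1 _))// ltW].
rewrite -(integral12_prod_meas1 iF) /fubini_F.
have icos : (gauss h).-integrable setT (EFin \o (fun x : R => cos (a * x))).
  by apply: (@gauss_bounded_integrable _ _ _ 1) => // y; exact: cos_max.
have c1 (x : R) : `|cos (a * x)| <= 1 by exact: cos_max.
have iU : (restricted_law P mB mU).-integrable setT (EFin \o (fun x : R => cos (a * x))).
  apply: measurable_bounded_integrable => //.
    by rewrite -ge0_fin_numE//; exact: fin_num_measure.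
  by exists 1; split; [exact: num_real|move=> x Mx y _ /=; rewrite (le_trans (c1 _))// ltW].
transitivity (\int[restricted_law P mB mU]_x
   ((\int[gauss h]_y cos (a * y))%:E * (cos (a * x))%:E))%E.
  apply: eq_integral => x _; rewrite -EFinM mulrC -gauss_cos_shift//.
  rewrite /Rintegral fineK//; apply: integrable_fin_num => //.
  apply: (@gauss_bounded_integrable _ _ _ 1); last by move=> y; exact: cos_max.
  by apply: (measurableT_comp mcos); exact: measurable_funD.
rewrite integralZl//; congr (_ * _)%E.
exact: (integral_restricted_law P mB mU mcos c1).
Qed.

End cos_step.

(** * The cosine martingale on a grid *)

Section confinement.
Context (R : realType) (d : measure_display) (Omega : measurableType d)
  (P : probability Omega R) (b : R -> {RV P >-> R}).
Implicit Types (s t r h a g : R) (B : set Omega).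
Hypothesis hb : brownian_motion b.

Let b0 w : b 0 w = 0. Proof. by case: hb. Qed.

Definition stays h r k : set Omega :=
  [set w | forall i, (i <= k)%N -> `|b (h * i%:R) w| <= r].

Lemma staysS h r k :
  stays h r k.+1 = stays h r k `&` [set w | `|b (h * k.+1%:R) w| <= r].
Proof.
apply/seteqP; split => w /=.
  by move=> H; split; [move=> i ik; apply: H; exact: leqW|exact: H].
by move=> [H Hk] i; rewrite leq_eqVlt => /orP[/eqP ->//|]; exact: H.
Qed.

Lemma measurable_norm_le t r : measurable [set w | `|b t w| <= r].
Proof.
have := measurable_funP (b t) measurableT _ (measurable_itv `[- r, r]).
by rewrite setTI; congr measurable; apply/seteqP; split => w /=; rewrite in_itv/= ler_norml.
Qed.

Lemma measurable_stays h r k : measurable (stays h r k).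
Proof.
elim: k => [|k IH]; last first.
  by rewrite staysS; apply: measurableI => //; exact: measurable_norm_le.
have := measurable_norm_le (h * 0%:R) r; congr measurable; apply/seteqP; split => w /=.
  by move=> H i; rewrite leqn0 => /eqP ->.
exact.
Qed.

Lemma moved0 G t : [set w | G (moved b false false 0 t ^~ w)] = [set w | G (b ^~ w)].
Proof.
apply/seteqP; split => w /=; congr G; apply/funext => u;
by rewrite /moved !add0r b0 subr0.
Qed.

(** As b starts at 0, this is a grid event of the path from time 0, and [markov_grid] applies with
    trivial past. *)
Lemma future_stays h r k (A : set R) : 0 < h -> measurable A ->
  future b (h * k%:R) (stays h r k `&` [set w | A (b (h * k%:R) w)]).
Proof.
move=> h0 mA.
pose G := [set f : R -> R | forall i, (i <= k)%N -> `|f (h * i%:R) - f 0| <= r] `&`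
  [set f | A (f (h * k%:R) - f 0)].
have mv i (C : set R) : (i <= k)%N -> measurable C ->
    <<s grid_sets h k>> [set f | C (f (h * i%:R) - f 0)].
  move=> ik mC; have := @measurable_grid_value R h k i ik measurableT C mC.
  by rewrite setTI.
have mG : <<s grid_sets h k>> G.
  apply: (@measurableI _ (g_sigma_algebraType (grid_sets h k))); last exact: mv.
  rewrite (_ : [set f | _] = \bigcap_(i in [set: nat]) (if (i <= k)%N then
      [set f | `[- r, r]%classic (f (h * i%:R) - f 0)] else setT)); last first.
    apply/seteqP; split => f.
      by move=> H i _; case: ifP => //= ik; rewrite in_itv/= -ler_norml; exact: H.
    by move=> H i ik; have := H i I; rewrite ik/= in_itv/= -ler_norml.
  apply: (@bigcapT_measurable _ (g_sigma_algebraType (grid_sets h k))) => i.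
  case: ifP => im; first exact: mv.
  exact: (@measurableT _ (g_sigma_algebraType (grid_sets h k))).
have [_ _ _] := markov_grid hb false false h0 (future_setT hb (lexx 0)) mG.
rewrite setTI add0r; congr (future b _ _).
by rewrite moved0 /G; apply/seteqP; split => w /= -[H H'];
  split => //= [i /H|]; rewrite ?b0 ?subr0//; move: H'; rewrite b0 subr0.
Qed.

Local Notation pr X := (fine (P X)).

Lemma integrable_cos B t a : measurable B ->
  P.-integrable B (EFin \o (fun w => cos (a * b t w))).
Proof.
move=> mB; apply: measurable_bounded_integrable => //.
- by rewrite (le_lt_trans (probability_le1 P mB))// ltry.
- apply: measurable_funTS; apply: (@measurableT_comp _ _ _ _ _ _ cos).
    by apply: continuous_measurable_fun; exact: continuous_cos.
  exact: measurable_funM.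
- by exists 1; split; [exact: num_real|move=> x Mx y _ /=; rewrite (le_trans (cos_max _))// ltW].
Qed.

Lemma Rintegral_le_pr B N (f : Omega -> R) : measurable B -> measurable N ->
  P.-integrable B (EFin \o f) ->
  (forall w, B w -> f w <= \1_N w) -> \int[P]_(w in B) f w <= pr N.
Proof.
move=> mB mN fi fN.
have iN : P.-integrable B (EFin \o \1_N).
  apply: (integrableS measurableT) => //; apply: integrable_indic => //.
apply: (@le_trans _ _ (\int[P]_(w in B) \1_N w)); first exact: le_Rintegral.
rewrite /Rintegral integral_indic//.
apply: fine_le; try exact: fin_num_measure.
  by apply: fin_num_measure; exact: measurableI.
by apply: le_measure; rewrite ?inE//; exact: measurableI.
Qed.

Definition tail h g (s : R) : set Omega := [set w | g < `|b (s + h) w - b s w|].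

Lemma measurable_tail h g s : measurable (tail h g s).
Proof.
have mA : measurable [set x : R | g < `|x|].
  rewrite -[X in measurable X]setTI.
  have -> : [set x : R | g < `|x|] = (fun x => `|x|) @^-1` `]g, +oo[.
    by apply/seteqP; split => x /=; rewrite in_itv/= andbT.
  by apply: (normr_measurable measurableT); exact: measurable_itv.
exact: (measurable_increment b s (s + h) mA).
Qed.

Lemma pr_tail h g s : 0 <= s -> 0 < h -> h <= 1 / 4 -> 0 < g ->
  pr (tail h g s) <= 64 * h ^+ 2 / g ^+ 4.
Proof.
move=> s0 h0 h4 g0; rewrite -lee_fin fineK; last first.
  by apply: fin_num_measure; exact: measurable_tail.
apply: le_trans (gauss_tail h0 h4 g0).
have [_ _ gaussb _] := hb.
have mA : measurable [set x : R | g < `|x|].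
  rewrite -[X in measurable X]setTI.
  have -> : [set x : R | g < `|x|] = (fun x => `|x|) @^-1` `]g, +oo[.
    by apply/seteqP; split => x /=; rewrite in_itv/= andbT.
  by apply: (normr_measurable measurableT); exact: measurable_itv.
have sh : s < s + h by rewrite ltrDl.
by have := gaussb s (s + h) s0 sh _ mA; rewrite (addrAC s h) subrr add0r => <-.
Qed.

Let phi h a := \int[gauss h]_y cos (a * y).
Let expect h r a k := \int[P]_(w in stays h r k) cos (a * b (h * k%:R) w).

Lemma expect0 h r a : 0 <= r -> expect h r a 0 = 1.
Proof.
move=> r0; rewrite /expect (_ : stays h r 0 = setT).
  under eq_Rintegral do rewrite mulr0 b0 mulr0 cos0.
  by rewrite Rintegral_cst// mul1r; exact: (congr1 fine (probability_setT P)).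
apply/seteqP; split => // w _ i; rewrite leqn0 => /eqP ->.
by rewrite mulr0 b0 normr0.
Qed.

(** [cos_step] on [stays h r k], the integral at the new time being split between the paths that
    still stay and those that leave at this step. *)
Lemma expectS h r a k : 0 < h ->
  phi h a * expect h r a k = expect h r a k.+1 +
  \int[P]_(w in stays h r k `\` stays h r k.+1) cos (a * b (h * k.+1%:R) w).
Proof.
move=> h0.
have mS := measurable_stays h r.
have hk : h * k.+1%:R = h * k%:R + h by rewrite -natr1 mulrDr mulr1.
have /(congr1 fine) := @cos_step R d Omega P b (stays h r k) (h * k%:R) h a h0 (mS k)
  (fun A mA => future_stays r k h0 mA).
rewrite fineM//; last first.
  by apply: integrable_fin_num => //; exact: integrable_cos.
rewrite -/(Rintegral _ _ _) -/(Rintegral _ _ _) -hk => <-.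
have sub : stays h r k.+1 `<=` stays h r k by rewrite staysS; exact: subIsetl.
rewrite -[in LHS](setDUK sub) Rintegral_setU//; last 3 first.
- exact: measurableD.
- by rewrite setDUK//; exact: integrable_cos.
- by apply/disj_setPS; rewrite setDE setICA setICr setI0.
Qed.

(** Here a |x| lies between pi / 2 and 3 pi / 2. *)
Lemma le_cos_annulus a r x : 0 < a -> pi / 2 <= a * r <= pi -> r < `|x| ->
  `|x| <= r + pi / (2 * a) -> cos (a * x) <= 0.
Proof.
move=> a0 /andP[r1 r2] rx xr.
rewrite -cos_norm normrM (gtr0_norm a0) -[a * _](subrK pi) cosDpi oppr_le0.
apply: cos_ge0_pihalf; have : a * r < a * `|x| by rewrite ltr_pM2l.
have : a * `|x| <= a * r + pi / 2.
  rewrite (_ : a * r + pi / 2 = a * (r + pi / (2 * a))) ?ler_pM2l//.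
  by field; rewrite gt_eqF.
move=> ? ?; apply/andP; split; lra.
Qed.

Lemma ge_cos_annulus a r x : 0 < a -> `|x| <= pi / (2 * a) -> 0 <= cos (a * x).
Proof.
move=> a0 xr; rewrite -cos_norm normrM (gtr0_norm a0).
have : a * `|x| <= pi / 2.
  rewrite (_ : pi / 2 = a * (pi / (2 * a))) ?ler_pM2l//.
  by field; rewrite gt_eqF.
have : 0 <= a * `|x| by rewrite mulr_ge0// ltW.
move=> ? ?; apply: cos_ge0_pihalf; apply/andP; split; lra.
Qed.

Let near_tail h g r k w : `|b (h * k%:R) w| <= r -> r + g < `|b (h * k.+1%:R) w| ->
  tail h g (h * k%:R) w.
Proof.
rewrite /tail/= -natr1 mulrDr mulr1 => H1 H2.
have := ler_normB (b (h * k%:R + h) w) (b (h * k%:R) w).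
have := lerB_dist (b (h * k%:R + h) w) (b (h * k%:R) w).
lra.
Qed.

(** A path that leaves contributes a nonpositive cosine, unless it jumps across the whole annulus,
    of width pi / (2 a), in one step. *)
Lemma expect_lower h r a k : 0 < h -> h <= 1 / 4 -> 0 < a -> pi / 2 <= a * r <= pi ->
  phi h a * expect h r a k - 64 * h ^+ 2 / (pi / (2 * a)) ^+ 4 <= expect h r a k.+1.
Proof.
move=> h0 h4 a0 ar; rewrite expectS// lerBlDr lerD2l.
have g0 : 0 < pi / (2 * a) by rewrite divr_gt0 ?pi_gt0 ?mulr_gt0.
have hk0 : 0 <= h * k%:R by rewrite mulr_ge0// ltW.
apply: (le_trans _ (pr_tail hk0 h0 h4 g0)).
have mD : measurable (stays h r k `\` stays h r k.+1).
  by apply: measurableD; exact: measurable_stays.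
apply: Rintegral_le_pr => //; [exact: measurable_tail|exact: integrable_cos|].
move=> w [wk wk1]; rewrite indicE.
have rb : r < `|b (h * k.+1%:R) w|.
  by rewrite ltNge; apply/negP => H; apply: wk1; rewrite staysS.
have [H|H] := leP `|b (h * k.+1%:R) w| (r + pi / (2 * a)).
  by rewrite (le_trans (le_cos_annulus a0 ar rb H)).
by rewrite mem_set ?cos_le1//; apply: near_tail H; exact: wk.
Qed.

(** The cosine stays nonnegative up to pi / (2 a), so a negative contribution needs a jump of more
    than pi / (2 a) - r. *)
Lemma expect_upper h r a k : 0 < h -> h <= 1 / 4 -> 0 < a -> a * r < pi / 2 ->
  expect h r a k.+1 <=
  phi h a * expect h r a k + 64 * h ^+ 2 / (pi / (2 * a) - r) ^+ 4.
Proof.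
move=> h0 h4 a0 ar; rewrite expectS// -addrA lerDl -lerBlDl sub0r.
have g0 : 0 < pi / (2 * a) - r.
  rewrite subr_gt0 -(ltr_pM2l a0) (_ : a * (pi / (2 * a)) = pi / 2)//.
  by field; rewrite gt_eqF.
have hk0 : 0 <= h * k%:R by rewrite mulr_ge0// ltW.
apply: (le_trans _ (pr_tail hk0 h0 h4 g0)).
have mD : measurable (stays h r k `\` stays h r k.+1).
  by apply: measurableD; exact: measurable_stays.
rewrite -mulN1r -RintegralZl//; last exact: integrable_cos.
apply: Rintegral_le_pr => //; first exact: measurable_tail.
  have := integrableZl mD (-1) (integrable_cos (h * k.+1%:R) a mD).
  by apply: eq_integrable => // w _ /=.
move=> w [wk wk1]; rewrite indicE mulN1r.
have [H|H] := leP `|b (h * k.+1%:R) w| (pi / (2 * a)).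
  by rewrite (@le_trans _ _ 0)// oppr_le0 (@ge_cos_annulus a r).
rewrite mem_set; first by have := cos_geN1 (a * b (h * k.+1%:R) w); rewrite mulr1n; lra.
by apply: near_tail (_ : r + _ < _); [exact: wk|rewrite addrC subrK].
Qed.

End confinement.

(** * Exponential bounds, from the grid to continuous time *)

Section confinement_bounds.
Context (R : realType) (d : measure_display) (Omega : measurableType d)
  (P : probability Omega R) (b : R -> {RV P >-> R}).
Implicit Types (s t r h a g : R) (B : set Omega).
Hypothesis hb : brownian_motion b.

Local Notation pr X := (fine (P X)).
Local Notation phi h a := (\int[gauss h]_y cos (a * y)).
Local Notation expect h r a k :=
  (\int[P]_(w in stays b h r k) cos (a * b (h * k%:R) w)).

Lemma expRN_le_one_sub (x : R) : 0 <= x <= 1 / 2 -> expR (- (x + 2 * x ^+ 2)) <= 1 - x.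
Proof.
move=> /andP[x0 x2].
have x1 : 0 < 1 - x by lra.
apply: (@le_trans _ _ (expR (- (x / (1 - x))))).
  rewrite ler_expR lerN2 ler_pdivrMr//.
  have : 0 <= x ^+ 2 * (1 - 2 * x) by rewrite mulr_ge0 ?sqr_ge0//; lra.
  nra.
rewrite expRN -[leRHS]invrK lef_pV2 ?posrE ?expR_gt0 ?invr_gt0//.
apply: le_trans (expR_ge1Dx _).
by rewrite le_eqVlt; apply/orP; left; apply/eqP; field; rewrite gt_eqF.
Qed.

Lemma contraction_lower (f x q k e : R) : 0 <= f -> f <= 1 -> 0 <= k -> 0 <= e ->
  q - k * e <= x -> f * q - (k + 1) * e <= f * x - e.
Proof.
move=> f0 f1 k0 e0 H; have ke : 0 <= k * e by rewrite mulr_ge0.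
have := ler_wpM2l f0 H; have := ler_wpM2r ke f1; lra.
Qed.

Lemma contraction_upper (f x q k e : R) : 0 <= f -> f <= 1 -> 0 <= k -> 0 <= e ->
  x <= q + k * e -> f * x + e <= f * q + (k + 1) * e.
Proof.
move=> f0 f1 k0 e0 H; have ke : 0 <= k * e by rewrite mulr_ge0.
have := ler_wpM2l f0 H; have := ler_wpM2r ke f1; lra.
Qed.

(** With y = a^2 h, [gauss_cos] gives at least 1 - x for x = y / 2 + 17 y^2. The bound 34 y <= 1
    yields x <= y, and then x + 2 x^2 <= y / 2 + 19 y^2. *)
Lemma phi_lower h a : 0 < h -> h <= 1 / 4 -> 34 * a ^+ 2 * h <= 1 ->
  expR (- (a ^+ 2 * h / 2 + 19 * a ^+ 4 * h ^+ 2)) <= phi h a.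
Proof.
move=> h0 h4 ah; have := gauss_cos a h0 h4.
rewrite ler_norml => /andP[H _].
set y := a ^+ 2 * h in ah *.
have y0 : 0 <= y by rewrite mulr_ge0 ?sqr_ge0// ltW.
have e4 c : c * a ^+ 4 * h ^+ 2 = c * y ^+ 2 by rewrite /y; ring.
rewrite e4 -/y in H; rewrite e4.
have y34 : 34 * y <= 1 by rewrite /y mulrA.
apply: (@le_trans _ _ (1 - (y / 2 + 17 * y ^+ 2))); last by lra.
apply: le_trans (expRN_le_one_sub _); last by apply/andP; split; nra.
rewrite ler_expR lerN2.
have : y / 2 + 17 * y ^+ 2 <= y by nra.
have : 0 <= y / 2 + 17 * y ^+ 2 by nra.
by nra.
Qed.

Lemma phi_upper h a : 0 < h -> h <= 1 / 4 ->
  phi h a <= expR (- (a ^+ 2 * h / 2) + 17 * a ^+ 4 * h ^+ 2).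
Proof.
move=> h0 h4; have := gauss_cos a h0 h4.
rewrite ler_norml => /andP[_ H].
have := expR_ge1Dx (- (a ^+ 2 * h / 2) + 17 * a ^+ 4 * h ^+ 2).
by lra.
Qed.

Lemma phi_le1 h a : 0 < h -> h <= 1 / 4 -> 34 * a ^+ 2 * h <= 1 -> phi h a <= 1.
Proof.
move=> h0 h4 ah; apply: le_trans (phi_upper a h0 h4) _.
rewrite -[leRHS]expR0 ler_expR.
have y0 : 0 <= a ^+ 2 * h by rewrite mulr_ge0 ?sqr_ge0// ltW.
have -> : 17 * a ^+ 4 * h ^+ 2 = 17 * (a ^+ 2 * h) ^+ 2 by ring.
by rewrite -mulrA in ah; nra.
Qed.

Lemma stays_ge h r a k : 0 < h -> h <= 1 / 4 -> 34 * a ^+ 2 * h <= 1 ->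
  0 < a -> pi / 2 <= a * r <= pi ->
  phi h a ^+ k - k%:R * (64 * h ^+ 2 / (pi / (2 * a)) ^+ 4) <= pr (stays b h r k).
Proof.
move=> h0 h4 ah a0 ar.
have r0 : 0 <= r.
  rewrite -(pmulr_rge0 _ a0); move: ar => /andP[+ _]; apply: le_trans.
  by rewrite divr_ge0 ?pi_ge0.
set tau := 64 * h ^+ 2 / (pi / (2 * a)) ^+ 4.
have tau0 : 0 <= tau.
  apply: divr_ge0; first by rewrite mulr_ge0 ?sqr_ge0.
  by rewrite exprn_even_ge0.
have p0 : 0 <= phi h a.
  by apply: le_trans (phi_lower h0 h4 ah); rewrite expR_ge0.
have p1 := phi_le1 h0 h4 ah.
have step : phi h a ^+ k - k%:R * tau <= expect h r a k.
  elim: k => [|k IH]; first by rewrite mul0r subr0 expr0 expect0.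
  apply: le_trans (expect_lower hb k h0 h4 a0 ar); rewrite -/tau.
  rewrite exprS -natr1.
  exact: contraction_lower.
apply: (le_trans step).
have mS := measurable_stays b h r k.
apply: Rintegral_le_pr => //; first exact: integrable_cos.
by move=> w wS; rewrite indicE mem_set// cos_le1.
Qed.

(** On the event the last position is within r of 0, where the cosine is at least cos (a r). *)
Lemma stays_le h r a k : 0 < h -> h <= 1 / 4 -> 34 * a ^+ 2 * h <= 1 ->
  0 < a -> 0 <= r -> a * r < pi / 2 ->
  cos (a * r) * pr (stays b h r k) <=
  phi h a ^+ k + k%:R * (64 * h ^+ 2 / (pi / (2 * a) - r) ^+ 4).
Proof.
move=> h0 h4 ah a0 r0 ar.
set tau := 64 * h ^+ 2 / _ ^+ 4.
have tau0 : 0 <= tau.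
  apply: divr_ge0; first by rewrite mulr_ge0 ?sqr_ge0.
  by rewrite exprn_even_ge0.
have p0 : 0 <= phi h a.
  by apply: le_trans (phi_lower h0 h4 ah); rewrite expR_ge0.
have p1 := phi_le1 h0 h4 ah.
have step : expect h r a k <= phi h a ^+ k + k%:R * tau.
  elim: k => [|k IH]; first by rewrite mul0r addr0 expr0 expect0.
  apply: (le_trans (expect_upper hb k h0 h4 a0 ar)); rewrite -/tau.
  rewrite exprS -natr1.
  exact: contraction_upper.
apply: le_trans step.
have mS := measurable_stays b h r k.
rewrite -Rintegral_cst//; apply: le_Rintegral => //; first last.
- move=> w wS; rewrite -[cos (a * b _ _)]cos_norm normrM (gtr0_norm a0).
  have wr : `|b (h * k%:R) w| <= r by exact: wS.
  have ar0 : 0 <= a * r by rewrite mulr_ge0// ltW.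
  have pi0 : 0 < pi :> R := pi_gt0 _.
  have aw0 : 0 <= a * `|b (h * k%:R) w| by rewrite mulr_ge0// ltW.
  have awr : a * `|b (h * k%:R) w| <= a * r by rewrite ler_pM2l.
  have [->//|ne] := eqVneq (a * `|b (h * k%:R) w|) (a * r).
  rewrite ltW// ltr_cos ?in_itv/= ?aw0 ?ar0/=; last 2 first.
  + by lra.
  + by lra.
  by rewrite lt_neqAle ne.
- exact: integrable_cos.
- apply: measurable_bounded_integrable => //.
    by rewrite (le_lt_trans (probability_le1 P mS))// ltry.
  by exists `|cos (a * r)|; split; [exact: num_real|move=> x Mx y _ /=; rewrite ltW].
Qed.

Definition confined t r : set Omega := [set w | tube t r (b ^~ w)].

Lemma stays_grid_tube t m r :
  [set w | grid_tube t m r (b ^~ w)] = stays b (t / 2 ^+ m) r (2 ^ m).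
Proof.
have [b0 _ _ _] := hb.
by apply/seteqP; split => w H i im; have := H i im; rewrite /= b0 subr0.
Qed.

Lemma confinedE t r : confined t r = \bigcap_m stays b (t / 2 ^+ m) r (2 ^ m).
Proof.
rewrite /confined /tube; apply/seteqP; split => w H m _.
  by rewrite -stays_grid_tube; exact: H.
by have := H m I; rewrite -stays_grid_tube.
Qed.

Lemma measurable_confined t r : measurable (confined t r).
Proof.
by rewrite confinedE; apply: bigcapT_measurable => m; exact: measurable_stays.
Qed.

Lemma cvg_confined t r : 0 <= t ->
  pr (stays b (t / 2 ^+ m) r (2 ^ m)) @[m --> \oo] --> pr (confined t r).
Proof.
move=> t0; apply: fine_cvg; rewrite fineK; last first.
  by apply: fin_num_measure; exact: measurable_confined.
rewrite confinedE; apply: nonincreasing_cvg_mu.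
- by rewrite (le_lt_trans (probability_le1 P _)) ?ltry//; exact: measurable_stays.
- by move=> m; exact: measurable_stays.
- by apply: bigcapT_measurable => m; exact: measurable_stays.
- move=> m n mn; rewrite -!stays_grid_tube; apply/subsetPset => w.
  exact: grid_tube_decr.
Qed.

Lemma cvg_mesh t : t / 2 ^+ m @[m --> \oo] --> (0 : R).
Proof.
rewrite (_ : (fun m => _) = geometric t (2^-1)).
  by apply: cvg_geometric; rewrite ger0_norm// invf_lt1// ltr1n.
by apply/funext => m; rewrite /geometric/= exprVn.
Qed.

Lemma cvg_mesh_mul t c : c * (t / 2 ^+ m) @[m --> \oo] --> (0 : R).
Proof. by rewrite -[X in _ --> X](mulr0 c); apply: cvgM (cvg_mesh t); exact: cvg_cst. Qed.

Lemma near_mesh t a : 0 < t -> \forall m \near \oo,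
  [/\ 0 < t / 2 ^+ m, t / 2 ^+ m <= 1 / 4 & 34 * a ^+ 2 * (t / 2 ^+ m) <= 1].
Proof.
move=> t0; have D0 : 0 < 34 * a ^+ 2 + 1 by have := sqr_ge0 a; lra.
near=> m.
have h0 : 0 < t / 2 ^+ m by rewrite divr_gt0// exprn_gt0.
have hs : t / 2 ^+ m < (34 * a ^+ 2 + 1)^-1.
  near: m; apply: (cvgr_lt _ (cvg_mesh t)); by rewrite invr_gt0.
split => //.
  apply: ltW; near: m; apply: (cvgr_lt _ (cvg_mesh t)); lra.
have : (34 * a ^+ 2 + 1) * (t / 2 ^+ m) < 1 by rewrite mulrC -ltr_pdivlMr// mul1r.
lra.
Unshelve. all: end_near. Qed.

(** Limit of [stays_ge] along h = t / 2^m with 2^m steps: the correction in the exponent and the sum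
    of the jump probabilities both carry a factor h. *)
Lemma confined_lower t r a : 0 < t -> 0 < a -> pi / 2 <= a * r <= pi ->
  expR (- (a ^+ 2 * t / 2)) <= pr (confined t r).
Proof.
move=> t0 a0 ar.
pose L h := expR (- (a ^+ 2 * t / 2) - 19 * a ^+ 4 * t * h) -
  64 * t / (pi / (2 * a)) ^+ 4 * h.
have cL : L (t / 2 ^+ m) @[m --> \oo] --> expR (- (a ^+ 2 * t / 2)).
  rewrite -[X in _ --> X]subr0; apply: cvgB; last exact: cvg_mesh_mul.
  apply: continuous_cvg; first exact: continuous_expR.
  rewrite -[X in _ --> X]subr0; apply: cvgB; last exact: cvg_mesh_mul.
  exact: cvg_cst.
apply: (ler_cvg_to cL (@cvg_confined t r (ltW t0))).
near=> m.
have [h0 h4 ah] : [/\ 0 < t / 2 ^+ m, t / 2 ^+ m <= 1 / 4 & 34 * a ^+ 2 * (t / 2 ^+ m) <= 1].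
  by near: m; exact: near_mesh.
apply: le_trans (stays_ge (2 ^ m) h0 h4 ah a0 ar).
have tE : (2 ^ m)%N%:R * (t / 2 ^+ m) = t.
  by rewrite natrX mulrC divfK// expf_neq0.
set h := t / 2 ^+ m in h0 h4 ah tE *.
rewrite /L; apply: lerB.
  apply: (le_trans _ (@lerXn2r _ (2 ^ m) _ _ _ _ (phi_lower h0 h4 ah))).
  - by rewrite -expRM_natl ler_expR -{1 2}tE; nra.
  - by rewrite nnegrE expR_ge0.
  - by rewrite nnegrE (le_trans _ (phi_lower h0 h4 ah))// expR_ge0.
rewrite -{1}tE le_eqVlt; apply/orP; left; apply/eqP.
by move: (_ ^+ 4) => q; ring.
Unshelve. all: end_near. Qed.

Lemma confined_upper t r a : 0 < t -> 0 < a -> 0 <= r -> a * r < pi / 2 ->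
  cos (a * r) * pr (confined t r) <= expR (- (a ^+ 2 * t / 2)).
Proof.
move=> t0 a0 r0 ar.
pose L h := expR (- (a ^+ 2 * t / 2) + 17 * a ^+ 4 * t * h) +
  64 * t / (pi / (2 * a) - r) ^+ 4 * h.
have cL : L (t / 2 ^+ m) @[m --> \oo] --> expR (- (a ^+ 2 * t / 2)).
  rewrite -[X in _ --> X]addr0; apply: cvgD; last exact: cvg_mesh_mul.
  apply: continuous_cvg; first exact: continuous_expR.
  rewrite -[X in _ --> X]addr0; apply: cvgD; last exact: cvg_mesh_mul.
  exact: cvg_cst.
have cS : cos (a * r) * pr (stays b (t / 2 ^+ m) r (2 ^ m)) @[m --> \oo] -->
    cos (a * r) * pr (confined t r).
  by apply: cvgM; [exact: cvg_cst|exact: (@cvg_confined t r (ltW t0))].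
apply: (ler_cvg_to cS cL).
near=> m.
have [h0 h4 ah] : [/\ 0 < t / 2 ^+ m, t / 2 ^+ m <= 1 / 4 & 34 * a ^+ 2 * (t / 2 ^+ m) <= 1].
  by near: m; exact: near_mesh.
apply: (le_trans (stays_le (2 ^ m) h0 h4 ah a0 r0 ar)).
have tE : (2 ^ m)%N%:R * (t / 2 ^+ m) = t.
  by rewrite natrX mulrC divfK// expf_neq0.
set h := t / 2 ^+ m in h0 h4 ah tE *.
have p0 : 0 <= phi h a.
  by apply: le_trans (phi_lower h0 h4 ah); rewrite expR_ge0.
rewrite /L; apply: lerD.
  apply: (le_trans (@lerXn2r _ (2 ^ m) _ _ _ _ (phi_upper a h0 h4))).
  - by rewrite nnegrE.
  - by rewrite nnegrE expR_ge0.
  - by rewrite -expRM_natl ler_expR -{1 2}tE; nra.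
rewrite -{1}tE le_eqVlt; apply/orP; left; apply/eqP; ring.
Unshelve. all: end_near. Qed.

End confinement_bounds.

(** * Deterministic path estimates *)

Section path_analysis.
Context (R : realType).
Implicit Types (f g : R -> R) (a b c s t T M : R).
Local Notation mu := (@lebesgue_measure R).
Local Notation integ a b f := (\int[mu]_(x in `[a, b]) f x).

Lemma within_itvW a b c e f : c <= a -> b <= e ->
  {within `[c, e], continuous f} -> {within `[a, b], continuous f}.
Proof.
move=> ca be; apply: continuous_subspaceW => x /=; rewrite !in_itv/= => /andP[ax xb].
by rewrite (le_trans ca ax) (le_trans xb be).
Qed.

Lemma within_ray a b f : 0 <= a ->
  {within `[0, +oo[, continuous f} -> {within `[a, b], continuous f}.
Proof.
move=> a0; apply: continuous_subspaceW => x /=; rewrite !in_itv/= => /andP[ax _].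
by rewrite (le_trans a0 ax).
Qed.

Lemma within_cont_eps a b f : {within `[a, b], continuous f} ->
  forall x, a <= x <= b -> forall e, 0 < e -> exists2 dl, 0 < dl &
    forall y, a <= y <= b -> `|x - y| < dl -> `|f x - f y| < e.
Proof.
move=> /subspace_continuousP cf x xab e e0.
have xA : `[a, b]%classic x by rewrite /= in_itv.
have /cvgrPdist_lt/(_ e e0) := cf x xA.
rewrite near_withinE => /nbhs_ballP[dl dl0 H]; exists dl => // y yab xy.
by apply: (H y) => //=; rewrite in_itv.
Qed.

Lemma uniform_cont a b f : {within `[a, b], continuous f} ->
  forall e, 0 < e -> exists2 dl, 0 < dl &
    forall x y, a <= x <= b -> a <= y <= b -> `|x - y| < dl -> `|f x - f y| < e.
Proof.
move=> cf e e0.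
have e2 : 0 < e / 2 by rewrite divr_gt0.
have /compact_near_coveringP/near_covering_withinP cov := @segment_compact R a b.
pose Q (dl x : R) := forall y, a <= y <= b -> `|x - y| < dl -> `|f x - f y| < e.
have : \forall dl \near (0 : R)^'+, `[a, b]%classic `<=` Q dl.
  apply: cov => x; rewrite /= in_itv/= => xab.
  have [dl dl0 H] := within_cont_eps cf xab e2.
  exists (ball x (dl / 2), [set i : R | i < dl / 2]).
    split => /=; first by apply: nbhsx_ballx; rewrite divr_gt0.
    by apply: nbhs_right_lt; rewrite divr_gt0.
  move=> [x' i] /= [xx' idl]; rewrite in_itv/= => x'ab y yab x'y.
  rewrite (splitr e) -(subrKA (f x)) (le_lt_trans (ler_normD _ _))// ltrD//.
    rewrite distrC; apply: H => //.
    by rewrite (lt_trans xx')// ltr_pdivrMr// ltr_pMr// ltr1n.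
  apply: H => //; rewrite (splitr dl) -(subrKA x') (le_lt_trans (ler_normD _ _))//.
  by rewrite ltrD// (lt_trans x'y).
move=> cov'; near (0 : R)^'+ => dl.
exists dl; first by near: dl; exact: nbhs_right_gt.
have H : `[a, b]%classic `<=` Q dl by near: dl.
by move=> x y xab; apply: (H x); rewrite /= in_itv.
Unshelve. all: end_near. Qed.

Lemma integrable_within a b f : {within `[a, b], continuous f} ->
  mu.-integrable `[a, b] (EFin \o f).
Proof. by move=> cf; apply: continuous_compact_integrable => //; exact: segment_compact. Qed.

Lemma integ_cst a b c : a <= b -> integ a b (fun=> c) = (b - a) * c.
Proof.
move=> ab; rewrite Rintegral_cst//= lebesgue_measure_itv/= lte_fin mulrC.
by move: ab; rewrite le_eqVlt => /predU1P[->|ab]; rewrite ?ltxx ?ab/= ?subrr.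
Qed.

Lemma integ_split a b c f : a <= b -> b <= c -> {within `[a, c], continuous f} ->
  integ a c f = integ a b f + integ b c f.
Proof.
move=> ab bc cf; have icf := integrable_within cf.
have := @Rintegral_itvB R f (BLeft a) (BRight c) b icf.
rewrite !bnd_simp => /(_ ab bc) H.
rewrite -[LHS](subrK (integ a b f)) H addrC; congr (_ + _).
apply: Rintegral_itv_obnd_cbnd; apply: integrableS icf => // x /=.
by rewrite !in_itv/= => /andP[bx ->]; rewrite (le_trans ab (ltW bx)).
Qed.

Lemma integ_bound a b c e f : a <= b -> {within `[a, b], continuous f} ->
  (forall x, a <= x <= b -> `|f x - c| <= e) ->
  `|integ a b f - (b - a) * c| <= (b - a) * e.
Proof.
move=> ab cf H; have icf := integrable_within cf.
have icst (k : R) : mu.-integrable `[a, b] (EFin \o (fun=> k)).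
  by apply: integrable_within; exact: cst_continuous.
have up : integ a b f <= integ a b (fun=> c + e).
  apply: le_Rintegral => // x; rewrite /= in_itv/= => /H.
  by rewrite ler_distl => /andP[].
have lo : integ a b (fun=> c - e) <= integ a b f.
  apply: le_Rintegral => // x; rewrite /= in_itv/= => /H.
  by rewrite ler_distl => /andP[].
rewrite !integ_cst// in up lo.
by rewrite ler_norml; apply/andP; split; lra.
Qed.

Lemma norm_integ_le a b M f : a <= b -> {within `[a, b], continuous f} ->
  (forall x, a <= x <= b -> `|f x| <= M) -> `|integ a b f| <= (b - a) * M.
Proof.
move=> ab cf H; have := @integ_bound a b 0 M f ab cf.
by rewrite mulr0 subr0; apply => x /H; rewrite subr0.
Qed.

Lemma riemann_error a h e f N (tag : nat -> R) : 0 <= h ->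
  {within `[a, a + h * N%:R], continuous f} ->
  (forall i x, (i < N)%N -> a + h * i%:R <= x <= a + h * i.+1%:R ->
     `|f x - f (tag i)| <= e) ->
  `|integ a (a + h * N%:R) f - h * \sum_(i < N) f (tag i)| <= h * N%:R * e.
Proof.
move=> h0; elim: N => [|N IH] cf H.
  by rewrite big_ord0 mulr0n !mulr0 subr0 addr0 set_itv1 Rintegral_set1 normr0 mul0r.
have hN : a <= a + h * N%:R by rewrite lerDl mulr_ge0.
have hN1 : a + h * N%:R <= a + h * N.+1%:R by rewrite lerD2l ler_wpM2l// ler_nat.
rewrite (integ_split hN hN1 cf) big_ord_recr/= mulrDr.
have IH' : `|integ a (a + h * N%:R) f - h * \sum_(i < N) f (tag i)| <= h * N%:R * e.
  apply: IH; first by apply: within_itvW cf.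
  by move=> i x iN; apply: H; rewrite ltnS ltnW.
have last : `|integ (a + h * N%:R) (a + h * N.+1%:R) f - h * f (tag N)| <= h * e.
  have hE : (a + h * N.+1%:R) - (a + h * N%:R) = h by rewrite -[N.+1%:R]natr1; ring.
  have cN : {within `[a + h * N%:R, a + h * N.+1%:R], continuous f}.
    by apply: within_itvW cf.
  have := @integ_bound _ _ (f (tag N)) e f hN1 cN; rewrite hE; apply.
  by move=> x xN; apply: H xN.
rewrite opprD addrACA (le_trans (ler_normD _ _))//.
rewrite [leRHS](_ : _ = h * N%:R * e + h * e) ?lerD//.
by rewrite -[N.+1%:R]natr1; ring.
Qed.

(** By uniform continuity the tags can be anywhere in the closed cells; time reversal turns left
    endpoints into right ones. *)
Lemma riemann_cvg s t f (tag : nat -> nat -> R) : 0 < t ->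
  {within `[s, s + t], continuous f} ->
  (forall m i, (i < 2 ^ m)%N ->
    s + t / 2 ^+ m * i%:R <= tag m i <= s + t / 2 ^+ m * i.+1%:R) ->
  t / 2 ^+ m * (\sum_(i < 2 ^ m) f (tag m i)) @[m --> \oo] --> integ s (s + t) f.
Proof.
move=> t0 cf Htag; apply/cvgrPdist_le => e e0.
have et0 : 0 < e / t by rewrite divr_gt0.
have [dl dl0 uc] := uniform_cont cf et0.
near=> m.
have hm0 : 0 < t / 2 ^+ m by rewrite divr_gt0// exprn_gt0.
have tE : t / 2 ^+ m * (2 ^ m)%N%:R = t by rewrite natrX divfK// expf_neq0.
have hdl : t / 2 ^+ m < dl by near: m; apply: (cvgr_lt _ (cvg_mesh t)).
have := @riemann_error s (t / 2 ^+ m) (e / t) f (2 ^ m) (tag m) (ltW hm0).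
rewrite tE (mulrC t (e / t)) divfK ?gt_eqF//; apply => // i x im /andP[x1 x2].
have /andP[y1 y2] := Htag m i im.
have i0 : s <= s + t / 2 ^+ m * i%:R by rewrite lerDl mulr_ge0// ltW.
have i1 : s + t / 2 ^+ m * i.+1%:R <= s + t.
  by rewrite lerD2l -[leRHS]tE ler_wpM2l// ?ler_nat// ltW.
apply/ltW/uc.
- by rewrite (le_trans i0 x1) (le_trans x2 i1).
- by rewrite (le_trans i0 y1) (le_trans y2 i1).
have d : t / 2 ^+ m * i.+1%:R = t / 2 ^+ m * i%:R + t / 2 ^+ m.
  by rewrite -[i.+1%:R]natr1 mulrDr mulr1.
rewrite d in x2 y2; rewrite ltr_norml; apply/andP; split; lra.
Unshelve. all: end_near. Qed.

Lemma iterated_integral_cont k f T : 0 <= T -> {within `[0, T], continuous f} ->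
  {within `[0, T], continuous (iterated_integral k f)}.
Proof.
move=> T0 cf; elim: k => [//|k IH] /=.
exact: (parameterized_integral_continuous T0 (integrable_within IH)).
Qed.

(** The definition adds integrals on the outside; taking out the innermost one lets a bound on the
    first integral of f pass to all higher ones. *)
Lemma iterated_integralS k f : iterated_integral k.+1 f =
  iterated_integral k (iterated_integral 1 f).
Proof.
elim: k => [//|k IH]; apply/funext => t.
rewrite -[RHS]/(integ 0 t (iterated_integral k (iterated_integral 1 f))).
by rewrite -IH.
Qed.

Lemma iterated_integral_le k f T M : 0 <= T -> {within `[0, T], continuous f} ->
  (forall s, 0 <= s <= T -> `|f s| <= M) ->
  forall s, 0 <= s <= T -> `|iterated_integral k f s| <= T ^+ k * M.
Proof.
move=> T0 cf H; elim: k => [|k IH] s sT; first by rewrite expr0 mul1r; exact: H.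
have /andP[s0 sT'] := sT.
have M0 : 0 <= M by rewrite (le_trans _ (H 0 _))// lexx T0.
have ck : {within `[0, s], continuous (iterated_integral k f)}.
  by apply: within_itvW (iterated_integral_cont (k := k) T0 cf).
have := @norm_integ_le 0 s (T ^+ k * M) _ s0 ck.
rewrite subr0 => /(_ _)/le_trans; apply.
  by move=> x /andP[x0 xs]; apply: IH; rewrite x0 (le_trans xs).
by rewrite exprS -mulrA ler_wpM2r// mulr_ge0// exprn_ge0.
Qed.

Lemma running_max_le g t c : 0 <= t -> (forall s, 0 <= s <= t -> g s <= c) ->
  running_max g t <= c.
Proof.
move=> t0 H; apply: ge_sup; last first.
  by move=> y [s /=]; rewrite in_itv/= => /H gs <-.
by exists (g 0), 0 => //=; rewrite in_itv/= lexx.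
Qed.

Lemma running_max_ge g t s c : (forall u, 0 <= u <= t -> g u <= c) -> 0 <= s <= t ->
  g s <= running_max g t.
Proof.
move=> H st; apply: ub_le_sup; last by exists s => //=; rewrite in_itv.
by exists c => y [u /=]; rewrite in_itv/= => /H gu <-.
Qed.

Lemma within_bounded f a b : a <= b -> {within `[a, b], continuous f} ->
  exists M, forall x, a <= x <= b -> f x <= M.
Proof.
move=> ab cf; have [c _ H] := EVT_max ab cf; exists (f c) => x xab.
by apply: H; rewrite in_itv.
Qed.

Lemma running_max_ge_within g t s : {within `[0, t], continuous g} -> 0 <= s <= t ->
  g s <= running_max g t.
Proof.
move=> cg st; have /andP[s0 st'] := st.
have [M HM] := within_bounded (le_trans s0 st') cg.
exact: running_max_ge HM st.
Qed.

Lemma within_norm f a b : {within `[a, b], continuous f} ->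
  {within `[a, b], continuous (fun x => `|f x|)}.
Proof.
move=> cf x; apply: continuous_comp; first exact: cf.
exact: norm_continuous.
Qed.

Lemma dyadic_le g a t c : 0 < t -> {within `[a, a + t], continuous g} ->
  (forall m i, (i <= 2 ^ m)%N -> g (a + t / 2 ^+ m * i%:R) <= c) ->
  forall s, a <= s <= a + t -> g s <= c.
Proof.
move=> t0 cg H s sat; rewrite leNgt; apply/negP => cgs.
have e0 : 0 < g s - c by rewrite subr_gt0.
have [dl dl0 Hd] := within_cont_eps cg sat e0.
have : \forall m \near \oo, t / 2 ^+ m < dl by apply: (cvgr_lt _ (cvg_mesh t)).
case=> m _ /(_ m (leqnn m)) /= hm.
have hm0 : 0 < t / 2 ^+ m by rewrite divr_gt0// exprn_gt0.
have tE : t / 2 ^+ m * (2 ^ m)%N%:R = t by rewrite natrX divfK// expf_neq0.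
have /andP[s1 s2] := sat.
pose x := (s - a) / (t / 2 ^+ m).
have x0 : 0 <= x by rewrite divr_ge0 ?subr_ge0// ltW.
have xE : s = a + t / 2 ^+ m * x.
  by rewrite /x mulrC divfK ?gt_eqF//; ring.
pose i := Num.trunc x.
have /andP[i1 i2] := trunc_itv x0.
have im : (i <= 2 ^ m)%N.
  rewrite -(ler_nat R) (le_trans i1)// -(ler_pM2l hm0) tE.
  by rewrite -(lerD2l a) -xE.
have hi : a <= a + t / 2 ^+ m * i%:R <= a + t.
  apply/andP; split; first by rewrite lerDl mulr_ge0// ltW.
  by rewrite lerD2l -[leRHS]tE ler_wpM2l// ?ler_nat// ltW.
have := Hd _ hi; rewrite {1}xE opprD addrACA subrr add0r -mulrBr.
rewrite normrM (gtr0_norm hm0) ger0_norm ?subr_ge0//.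
have xi1 : x - i%:R <= 1.
  by rewrite lerBlDl -natr1 in i2 *; rewrite ltW// addrC natr1.
have hx : t / 2 ^+ m * (x - i%:R) < dl.
  by rewrite (le_lt_trans _ hm)// -[leRHS]mulr1 ler_wpM2l// ltW.
move=> /(_ hx); rewrite ltr_norml => /andP[_].
by rewrite ltrD2l ltrN2 ltNge H.
Qed.

Lemma euclidean_norm_ge n (x : 'rV[R]_n) i : `|x 0 i| <= euclidean_norm x.
Proof.
rewrite /euclidean_norm -sqrtr_sqr ler_sqrt; last first.
  by apply: sumr_ge0 => j _; exact: sqr_ge0.
by rewrite (bigD1 i)//= lerDl sumr_ge0// => j _; exact: sqr_ge0.
Qed.

Lemma euclidean_norm_le n (x : 'rV[R]_n) : euclidean_norm x <= \sum_i `|x 0 i|.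
Proof.
rewrite /euclidean_norm; set S := \sum_i `|x 0 i|.
have S0 : 0 <= S by apply: sumr_ge0.
rewrite -(ger0_norm S0) -sqrtr_sqr ler_sqrt ?sqr_ge0//.
rewrite expr2 {1}/S mulr_suml; apply: ler_sum => i _.
rewrite -(real_normK (num_real _)) expr2 ler_wpM2l//.
by rewrite /S (bigD1 i)//= lerDl sumr_ge0.
Qed.

Lemma within_sum n (A : set R) (F : 'I_n -> R -> R) :
  (forall i, {within A, continuous (F i)}) ->
  {within A, continuous (fun s => \sum_(i < n) F i s)}.
Proof.
elim: n F => [|n IH] F cF.
  by under eq_fun do rewrite big_ord0; move=> x; exact: cvg_cst.
under eq_fun do rewrite big_ord_recr/=.
by move=> x; apply: cvgD; [exact: IH|exact: cF].
Qed.

Lemma kolmogorov_norm_cont n f T : 0 <= T -> {within `[0, T], continuous f} ->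
  {within `[0, T], continuous (fun s => euclidean_norm (kolmogorov n f s))}.
Proof.
move=> T0 cf x; rewrite /euclidean_norm.
apply: (@continuous_comp _ _ _ (fun s : subspace `[0, T] =>
   \sum_(i < n) (kolmogorov n f s) 0 i ^+ 2) Num.sqrt); last exact: sqrt_continuous.
apply: (@within_sum n _ (fun i s => (kolmogorov n f s) 0 i ^+ 2)) => i.
rewrite (_ : (fun s => _) = (fun s => iterated_integral i f s * iterated_integral i f s)).
  by move=> y; apply: cvgM; exact: iterated_integral_cont.
by apply/funext => s; rewrite mxE expr2.
Qed.

End path_analysis.

(** * Steering the path and its integral *)

Section steered.
Context (R : realType) (d : measure_display) (Omega : measurableType d)
  (P : probability Omega R) (b : R -> {RV P >-> R}).
Implicit Types (s t r a e i nu : R) (B : set Omega).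
Hypothesis hb : brownian_motion b.
Local Notation pr X := (fine (P X)).
Local Notation mu := (@lebesgue_measure R).
Local Notation integ a b f := (\int[mu]_(x in `[a, b]) f x).

Let b0 w : b 0 w = 0. Proof. by case: hb. Qed.

Lemma path_cont w s t : 0 <= s -> {within `[s, t], continuous (fun u : R => b u w : R)}.
Proof. by move=> s0; apply: within_ray => //; case: hb. Qed.

Let movedE neg rev s t u w : moved b neg rev s t u w = (-1) ^+ neg *
  (b (if rev then s + t - u else s + u) w - b (if rev then s + t else s) w).
Proof.
by rewrite /moved; case: neg; case: rev; rewrite ?expr1 ?expr0 ?mulN1r ?mul1r.
Qed.

Let moved_start neg rev s t w : moved b neg rev s t 0 w = 0.
Proof. by rewrite movedE subr0 addr0; case: rev; rewrite subrr mulr0. Qed.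

Let moved_end neg rev s t w : moved b neg rev s t t w =
  (-1) ^+ (neg (+) rev) * (b (s + t) w - b s w).
Proof. by rewrite movedE; case: neg; case: rev => /=; rewrite ?addrK ?expr0 ?expr1; ring. Qed.

Lemma tube_moved neg rev s t r w : 0 <= s -> 0 < t ->
  tube t r (moved b neg rev s t ^~ w) ->
  forall u, s <= u <= s + t -> `|b u w - b (if rev then s + t else s) w| <= r.
Proof.
move=> s0 t0 H; set base := if rev then _ else _.
have cb := @path_cont w s (s + t) s0.
have tE m : t / 2 ^+ m * (2 ^ m)%N%:R = t by rewrite natrX divfK// expf_neq0.
apply: (@dyadic_le R (fun u => `|b u w - b base w|)) => //.
  by apply: within_norm => x; apply: cvgB; [exact: cb|exact: cvg_cst].
move=> m j jm; move: H; rewrite /base; case: rev {base} => H.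
  have := H m I (2 ^ m - j)%N (leq_subr _ _).
  rewrite moved_start subr0 movedE normrMsign natrB// mulrBr tE.
  by congr (`|b _ w - _| <= _); ring.
by have := H m I j jm; rewrite moved_start subr0 movedE normrMsign.
Qed.

(** Negation changes the sign of both the displacement and the integral. Reversal changes that of
    the displacement only, and moves the base value from the start of the block to its end. This
    difference is what allows both to be cancelled. *)
Lemma block_facts neg rev s t r e i nu w : 0 <= s -> 0 < t ->
  bin t r e i nu (moved b neg rev s t ^~ w) ->
  let base := if rev then s + t else s in
  [/\ forall u, s <= u <= s + t -> `|b u w - b base w| <= r,
      e <= (-1) ^+ (neg (+) rev) * (b (s + t) w - b s w) <= e + nu &
      i <= (-1) ^+ neg * (integ s (s + t) (b ^~ w) - t * b base w) <= i + t * nu].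
Proof.
move=> s0 t0 [[Htube Hend] Hint] base.
have cb := @path_cont w s (s + t) s0.
have tE m : t / 2 ^+ m * (2 ^ m)%N%:R = t by rewrite natrX divfK// expf_neq0.
have mvE u : moved b neg rev s t u w = (-1) ^+ neg *
    (b (if rev then s + t - u else s + u) w - b base w) by exact: movedE.
have mv0 : moved b neg rev s t 0 w = 0 by exact: moved_start.
split.
- exact: tube_moved Htube.
- by move: Hend; rewrite /= mv0 subr0 moved_end.
- have cvgR : riemann_sum t m (moved b neg rev s t ^~ w) @[m --> \oo] -->
      (-1) ^+ neg * (integ s (s + t) (b ^~ w) - t * b base w).
    pose tag m j := if rev then s + t - t / 2 ^+ m * j%:R else s + t / 2 ^+ m * j%:R.
    (* The tags of [tag] after reversal of the order of summation, so that tag j lies in cell j. *)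
    pose tag' m j := if rev then s + t / 2 ^+ m * j.+1%:R else s + t / 2 ^+ m * j%:R.
    have sumE m : riemann_sum t m (moved b neg rev s t ^~ w) =
        (-1) ^+ neg * (t / 2 ^+ m * (\sum_(j < 2 ^ m) b (tag' m j) w) - t * b base w).
      rewrite /riemann_sum mv0; under eq_bigr do rewrite subr0 mvE -/(tag m _).
      rewrite -mulr_sumr sumrB sumr_const card_ord -[b base w *+ _]mulr_natr.
      rewrite (_ : \sum_(j < 2 ^ m) b (tag m j) w = \sum_(j < 2 ^ m) b (tag' m j) w).
        rewrite [t * b base w](_ : _ = t / 2 ^+ m * (2 ^ m)%N%:R * b base w); last by rewrite tE.
        by ring.
      rewrite /tag /tag'; case: rev {tag tag' Htube Hend Hint base mvE mv0} => //.
      rewrite -(big_mkord xpredT (fun j => b (s + t - t / 2 ^+ m * j%:R) w)) big_nat_rev/=.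
      rewrite big_mkord; apply: eq_bigr => j _; rewrite add0n natrB// mulrBr tE.
      by congr (b _ w); ring.
    under eq_fun do rewrite sumE.
    apply: cvgM; first exact: cvg_cst.
    apply: cvgB; last exact: cvg_cst.
    apply: (@riemann_cvg R s t (b ^~ w) tag' t0 cb) => m j jm.
    have hm0 : 0 <= t / 2 ^+ m by rewrite divr_ge0 ?ltW// exprn_gt0.
    have jj : s + t / 2 ^+ m * j%:R <= s + t / 2 ^+ m * j.+1%:R.
      by rewrite lerD2l ler_wpM2l// ler_nat.
    by rewrite /tag'; case: rev {Htube Hend Hint base mvE mv0 tag tag' sumE}; rewrite jj lexx.
  apply/andP; split.
  + apply/ler_addgt0Pr => k k0; rewrite -lerBlDr.
    have [k' _ kk'] : \forall k' \near \oo, k'.+1%:R^-1 < k.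
      by near=> k'; near: k'; exact: near_infty_natSinv_lt (PosNum k0).
    have [m0 Hm] := Hint k'.
    rewrite -(cvg_lim _ cvgR)//; apply: limr_ge; first by apply/cvg_ex; eexists; exact: cvgR.
    near=> m; have : (m0 <= m)%N by near: m; exact: nbhs_infty_ge.
    move=> /Hm /andP[+ _]; apply: le_trans; rewrite lerD2l lerN2 ltW//.
    exact: (kk' k' (leqnn _)).
  + apply/ler_addgt0Pr => k k0.
    have [k' _ kk'] : \forall k' \near \oo, k'.+1%:R^-1 < k.
      by near=> k'; near: k'; exact: near_infty_natSinv_lt (PosNum k0).
    have [m0 Hm] := Hint k'.
    rewrite -(cvg_lim _ cvgR)//; apply: limr_le; first by apply/cvg_ex; eexists; exact: cvgR.
    near=> m; have : (m0 <= m)%N by near: m; exact: nbhs_infty_ge.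
    move=> /Hm /andP[_ H]; apply: (le_trans H); rewrite lerD2l ltW//.
    exact: (kk' k' (leqnn _)).
Unshelve. all: end_near. Qed.

(* Block m is used plainly, reversed, negated, or negated and reversed according
   to m modulo 4, which cancels b after two blocks and its integral after four. *)
Definition steered t r e i nu : nat -> set Omega :=
  fix loop n := if n is m.+1 then
    loop m `&` [set w | bin t r e i nu (moved b (odd m./2) (odd m) (t * m%:R) t ^~ w)]
  else setT.

Lemma steered_prob t r e i nu n : 0 < t ->
  future b (t * n%:R) (steered t r e i nu n) /\
  pr (steered t r e i nu n) = pr [set w | bin t r e i nu (b ^~ w)] ^+ n.
Proof.
move=> t0; elim: n => [|n [IHf IHp]] /=.
  by rewrite mulr0n mulr0 expr0 probability_setT; split => //; exact: future_setT.
have [mE mG PE fE] := markov hb (odd n./2) (odd n) t0 IHf (@path_sets_bin R t r e i nu).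
split; first by rewrite -[n.+1%:R]natr1 mulrDr mulr1.
rewrite exprSr -IHp PE fineM// fin_num_measure//.
by case: IHf.
Qed.

Lemma steered_block t r e i nu n w m : steered t r e i nu n w -> (m < n)%N ->
  bin t r e i nu (moved b (odd m./2) (odd m) (t * m%:R) t ^~ w).
Proof.
elim: n => [//|n IH] /= [Hn Hm]; rewrite ltnS leq_eqVlt => /orP[/eqP -> //|].
exact: IH.
Qed.

Lemma pair_return (e nu x y0 y1 y2 : R) : e <= y1 - y0 <= e + nu ->
  e <= - (y2 - y1) <= e + nu -> `|y0| <= x -> `|y2| <= x + nu.
Proof.
rewrite !ler_norml => /andP[? ?] /andP[? ?] /andP[? ?].
by apply/andP; split; lra.
Qed.

Lemma pair_return' (e nu x y0 y1 y2 : R) : e <= - (y1 - y0) <= e + nu ->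
  e <= y2 - y1 <= e + nu -> `|y0| <= x -> `|y2| <= x + nu.
Proof.
rewrite !ler_norml => /andP[? ?] /andP[? ?] /andP[? ?].
by apply/andP; split; lra.
Qed.

Lemma four_integrals (i k I1 I2 I3 I4 c1 c2 c4 z1 z2 z4 : R) :
  i <= I1 - c1 <= i + k -> i <= I2 - c2 <= i + k ->
  i <= - (I3 - c2) <= i + k -> i <= - (I4 - c4) <= i + k ->
  `|c1| <= z1 -> `|c2| <= z2 -> `|c4| <= z4 ->
  `|I1 + (I2 + (I3 + I4))| <= z1 + 2 * z2 + z4 + 2 * k.
Proof.
rewrite !ler_norml => /andP[? ?] /andP[? ?] /andP[? ?] /andP[? ?] /andP[? ?]
  /andP[? ?] /andP[? ?].
by apply/andP; split; lra.
Qed.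

(** Over the four blocks the displacements have signs +, -, -, + and the integrals about the base
    values +, +, -, -. The base values are b at s, s + 2 t, s + 2 t and s + 4 t, bounded by x, x +
    nu, x + nu and x + 2 nu; with the binning error 2 t nu this gives t (4 x + 6 nu). *)
Lemma superblock t r e i nu x p n w : 0 < t -> 0 <= nu ->
  steered t r e i nu n w -> (4 * p.+1 <= n)%N ->
  let s := t * (4 * p)%N%:R in
  `|b s w| <= x ->
  [/\ `|b (s + 4 * t) w| <= x + 2 * nu,
      `|integ s (s + 4 * t) (b ^~ w)| <= t * (4 * x + 6 * nu) &
      forall u, s <= u <= s + 4 * t -> `|b u w| <= r + x + 2 * nu].
Proof.
move=> t0 nu0 st pn s bx.
have s0 : 0 <= s by rewrite mulr_ge0// ltW.
have blk (j : nat) : (j < 4)%N -> bin t r e i nu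
    (moved b (odd j./2) (odd j) (s + j%:R * t) t ^~ w).
  move=> j4; have /(steered_block st) : (4 * p + j < n)%N.
    by rewrite (leq_trans _ pn)// mulnS addnC ltn_add2r.
  rewrite (_ : t * (4 * p + j)%N%:R = s + j%:R * t); last first.
    by rewrite natrD mulrDr /s (mulrC j%:R).
  have -> : odd (4 * p + j) = odd j by rewrite oddD oddM.
  have -> // : odd (4 * p + j)./2 = odd j./2.
  rewrite halfD oddM/= add0n oddD (_ : (4 * p)./2 = (2 * p)%N) ?oddM//.
  by rewrite (_ : 4 * p = (2 * p).*2)%N ?doubleK// -mul2n mulnA.
have cbw u v : 0 <= u -> {within `[u, v], continuous (fun u : R => b u w : R)}.
  exact: path_cont.
have [|A1 B1 C1] := block_facts _ t0 (blk 0%N isT); first by rewrite mul0r addr0.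
have [|A2 B2 C2] := block_facts _ t0 (blk 1%N isT).
  by rewrite addr_ge0// mulr_ge0// ltW.
have [|A3 B3 C3] := block_facts _ t0 (blk 2%N isT).
  by rewrite addr_ge0// mulr_ge0// ltW.
have [|A4 B4 C4] := block_facts _ t0 (blk 3%N isT).
  by rewrite addr_ge0// mulr_ge0// ltW.
rewrite /= ?mulr0n ?mul0r ?addr0 ?expr0 ?expr1 ?mul1r ?mulN1r in A1 B1 C1 A2 B2 C2 A3 B3 C3 A4 B4 C4.
have e2 : s + t + t = s + 2 * t by ring.
have e3 : s + 2 * t + t = s + 3 * t by ring.
have e4 : s + 3 * t + t = s + 4 * t by ring.
rewrite e2 in A2 B2 C2; rewrite e3 in A3 B3 C3; rewrite e4 in A4 B4 C4.
have bx2 := pair_return B1 B2 bx.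
have bx4 := pair_return' B3 B4 bx2.
have lt0 (y : R) : y <= y + t by rewrite lerDl ltW.
have l1 : s <= s + t := lt0 s.
have l2 : s + t <= s + 2 * t by rewrite -e2.
have l3 : s + 2 * t <= s + 3 * t by rewrite -e3.
have l4 : s + 3 * t <= s + 4 * t by rewrite -e4.
have l24 := le_trans l3 l4; have l14 := le_trans l2 l24.
have lt (y z : R) : `|y| <= z -> `|t * y| <= t * z.
  by move=> yz; rewrite normrM (gtr0_norm t0) ler_wpM2l// ltW.
split; first by rewrite (le_trans bx4)// -addrA -mulr2n mulr_natl.
- rewrite (integ_split l1 l14 (cbw _ _ s0)).
  have s1 := le_trans s0 l1; have s2 := le_trans s1 l2.
  rewrite (integ_split l2 l24 (cbw _ _ s1)) (integ_split l3 l4 (cbw _ _ s2)).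
  apply: (le_trans (four_integrals C1 C2 C3 C4 (lt _ _ bx) (lt _ _ bx2) (lt _ _ bx4))).
  by rewrite le_eqVlt; apply/orP; left; apply/eqP; ring.
- have near_base (c y : R) u : `|b u w - b c w| <= r -> `|b c w| <= y -> `|b u w| <= r + y.
    by move=> H1 H2; rewrite -(subrK (b c w) (b u w)) (le_trans (ler_normD _ _))// lerD.
  have xn : r + x <= r + x + 2 * nu by rewrite lerDl mulr_ge0.
  have xn2 : r + (x + nu) <= r + x + 2 * nu.
    by rewrite addrA lerD2l mulr_natl mulr2n lerDl.
  have xn4 : r + (x + nu + nu) <= r + x + 2 * nu.
    by rewrite mulr_natl mulr2n !addrA.
  move=> u /andP[u1 u2]; have [v1|v1] := leP u (s + t).
    by rewrite (le_trans (near_base _ _ _ (A1 u _) bx))// u1.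
  have [v2|v2] := leP u (s + 2 * t).
    by rewrite (le_trans (near_base _ _ _ (A2 u _) bx2))// (ltW v1).
  have [v3|v3] := leP u (s + 3 * t).
    by rewrite (le_trans (near_base _ _ _ (A3 u _) bx2))// (ltW v2).
  by rewrite (le_trans (near_base _ _ _ (A4 u _) bx4))// (ltW v3).
Qed.

(** The bound x grows by 2 nu per group of four blocks, so 4 x + 6 nu stays below (8 K + 6) nu.
    Inside a group the integral moves by at most the length 4 t times the bound on b. *)
Lemma steered_path t r e i nu K w : 0 < t -> 0 <= r -> 0 <= nu -> (0 < K)%N ->
  steered t r e i nu (4 * K) w ->
  forall p, (p <= K)%N ->
  let s := t * (4 * p)%N%:R in
  [/\ `|b s w| <= 2 * p%:R * nu,
      `|integ 0 s (b ^~ w)| <= p%:R * (t * (8 * K%:R + 6) * nu),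
      (forall u, 0 <= u <= s -> `|b u w| <= r + 2 * K%:R * nu) &
      forall u, 0 <= u <= s -> `|integ 0 u (b ^~ w)| <=
         K%:R * (t * (8 * K%:R + 6) * nu) + 4 * t * (r + 2 * K%:R * nu)].
Proof.
move=> t0 r0 nu0 K0 st.
have cbw u v : 0 <= u -> {within `[u, v], continuous (fun u : R => b u w : R)}.
  exact: path_cont.
have Kn0 : 0 <= 2 * K%:R * nu :> R by rewrite !mulr_ge0.
have c0 : 0 <= t * (8 * K%:R + 6) * nu.
  by rewrite !mulr_ge0 ?addr_ge0 ?mulr_ge0// ltW.
have T0 : 0 <= K%:R * (t * (8 * K%:R + 6) * nu) + 4 * t * (r + 2 * K%:R * nu).
  by rewrite addr_ge0// mulr_ge0// ?addr_ge0// mulr_ge0// ltW.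
elim=> [|p IH] pK.
  rewrite /= muln0 mulr0n !mulr0 !mul0r b0 normr0 set_itv1 Rintegral_set1 normr0.
  by split => // u; rewrite -eq_le => /eqP <-; rewrite ?b0 ?set_itv1 ?Rintegral_set1 normr0// addr_ge0.
have [H1 H2 H3 H4] := IH (ltnW pK).
have pK4 : (4 * p.+1 <= 4 * K)%N by rewrite leq_mul2l.
have [G1 G2 G3] := superblock t0 nu0 st pK4 H1.
have sE : t * (4 * p.+1)%N%:R = t * (4 * p)%N%:R + 4 * t.
  by rewrite mulnS natrD mulrDr addrC (mulrC t 4).
rewrite sE; set s := t * (4 * p)%N%:R in H1 H2 H3 H4 G1 G2 G3 *.
have s0 : 0 <= s by rewrite mulr_ge0// ltW.
have pKR : p%:R + 1 <= K%:R :> R by rewrite natr1 ler_nat.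
have pn : 2 * p%:R * nu + 2 * nu <= 2 * K%:R * nu by nra.
split.
- by rewrite (le_trans G1)// -[p.+1%:R]natr1; lra.
- have s4 : s <= s + 4 * t by rewrite lerDl mulr_ge0// ltW.
  rewrite (integ_split s0 s4 (cbw _ _ (lexx 0))).
  have -> : p.+1%:R * (t * (8 * K%:R + 6) * nu) =
      p%:R * (t * (8 * K%:R + 6) * nu) + t * (8 * K%:R + 6) * nu.
    by rewrite -natr1; ring.
  apply: (le_trans (ler_normD _ _)); apply: lerD => //; apply: (le_trans G2).
  by rewrite -[leRHS]mulrA ler_wpM2l ?(ltW t0)//; lra.
- move=> u /andP[u0 u1]; have [us|us] := leP u s; first by apply: H3; rewrite u0.
  rewrite (le_trans (G3 u _)) ?(ltW us)//; lra.
- move=> u /andP[u0 u1]; have [us|us] := leP u s; first by apply: H4; rewrite u0.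
  rewrite (integ_split s0 (ltW us) (cbw _ _ (lexx 0))).
  rewrite (le_trans (ler_normD _ _))// lerD//.
    by rewrite (le_trans H2)// ler_wpM2r//; lra.
  have := @norm_integ_le R s u (r + 2 * K%:R * nu) (b ^~ w) (ltW us) (cbw _ _ s0).
  move=> /(_ _)/le_trans; apply.
    move=> v /andP[v0 v1]; rewrite (le_trans (G3 v _)) ?v0 ?(le_trans v1)//; lra.
  by rewrite ler_wpM2r ?addr_ge0//; lra.
Qed.

Lemma confinedP t r w : 0 < t ->
  confined b t r w <-> forall u, 0 <= u <= t -> `|b u w| <= r.
Proof.
move=> t0; split=> [H u ut|H m _ i im /=].
  apply: (@dyadic_le R (fun u => `|b u w|) 0 t) => //; rewrite ?add0r//.
    by apply: within_norm; exact: path_cont.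
  by move=> m i im; rewrite add0r; have := H m I i im; rewrite /= b0 subr0.
rewrite b0 subr0; apply: H; rewrite mulr_ge0 ?divr_ge0 ?exprn_ge0 ?(ltW t0)//=.
by rewrite mulrAC ler_pdivrMr ?exprn_gt0// ler_wpM2l ?(ltW t0)// -natrX ler_nat.
Qed.

Lemma bin_index (nu y : R) N : (0 < N)%N -> 0 <= y <= N%:R * nu ->
  exists2 i, (i < N)%N & i%:R * nu <= y <= i.+1%:R * nu.
Proof.
elim: N => [//|[|N] IH] _ /andP[y0 yN]; first by exists 0%N; rewrite // mulr0n mul0r y0.
have [H|H] := leP y (N.+1%:R * nu); last by exists N.+1; rewrite // (ltW H).
by have [//|i iN Hi] := IH isT; [rewrite y0|exists i => //; exact: ltnW].
Qed.

Lemma riemann_sum_cvg t w : 0 < t ->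
  riemann_sum t m (b ^~ w) @[m --> \oo] --> integ 0 t (b ^~ w).
Proof.
move=> t0; have := @riemann_cvg R 0 t (b ^~ w) (fun (m i : nat) => t / 2 ^+ m * i%:R) t0.
rewrite add0r => /(_ (path_cont (lexx 0))).
rewrite /riemann_sum; under [X in _ -> X @ _ --> _]eq_fun => m do under eq_bigr do rewrite b0 subr0.
apply => m i im; rewrite !add0r lexx/= ler_wpM2l ?ler_nat//.
by rewrite divr_ge0 ?ltW ?exprn_gt0.
Qed.

(** The end value and the time average of the path both lie in [- r, r], which is cut into 2 L cells
    of width r / L. *)
Lemma confined_bins t r L w : 0 < t -> 0 < r -> (0 < L)%N -> confined b t r w ->
  exists2 i, (i < 2 * L)%N & exists2 k, (k < 2 * L)%N &
    bin t r (- r + i%:R * (r / L%:R)) (t * (- r + k%:R * (r / L%:R))) (r / L%:R) (b ^~ w).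
Proof.
move=> t0 r0 L0 H; have /(confinedP _ _ t0) H' := H.
have L2 : (0 < 2 * L)%N by rewrite muln_gt0.
have nuE : (2 * L)%N%:R * (r / L%:R) = 2 * r.
  have : L%:R != 0 :> R by rewrite pnatr_eq0 -lt0n.
  by rewrite natrM => ?; field.
have locate y : `|y| <= r -> exists2 i, (i < 2 * L)%N &
    - r + i%:R * (r / L%:R) <= y <= - r + i%:R * (r / L%:R) + r / L%:R.
  rewrite ler_norml => /andP[y1 y2].
  have [|i iL /andP[Hi1 Hi2]] := @bin_index (r / L%:R) (y + r) (2 * L) L2.
    by rewrite nuE; apply/andP; split; lra.
  by exists i => //; move: Hi2; rewrite -natr1 mulrDl mul1r => Hi2; apply/andP; split; lra.
have [|i iL Hi] := locate _ (H' t _); first by rewrite lexx ltW.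
have I1 : `|integ 0 t (b ^~ w) / t| <= r.
  rewrite normrM normfV (gtr0_norm t0) ler_pdivrMr// mulrC.
  have := @norm_integ_le R 0 t r (b ^~ w) (ltW t0) (path_cont (lexx 0)).
  by rewrite subr0; exact.
have [k kL Hk] := locate _ I1.
exists i => //; exists k => //; split.
  by split => //=; rewrite b0 subr0.
move=> p /=; have /cvgrPdist_le/(_ (p.+1%:R^-1)) := @riemann_sum_cvg t w t0.
case=> [|m0 _ Hm]; first by rewrite invr_gt0.
exists m0 => m m0m; have := Hm m m0m.
move: Hk; rewrite ler_pdivlMr// ler_pdivrMr// ler_distlC => /andP[Hk1 Hk2] /andP[Hm1 Hm2].
rewrite -mulrDr !(mulrC t) (le_trans _ Hm1) ?lerB//=.
by rewrite (le_trans Hm2)// lerD2r.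
Qed.

Lemma good_bin t r L : 0 < t -> 0 < r -> (0 < L)%N -> exists e i,
  pr (confined b t r) / (2 * L)%N%:R ^+ 2 <=
    pr [set w | bin t r e i (r / L%:R) (b ^~ w)].
Proof.
move=> t0 r0 L0.
pose F (i k : nat) := [set w | bin t r (- r + i%:R * (r / L%:R)) (t * (- r + k%:R * (r / L%:R)))
  (r / L%:R) (b ^~ w)].
have mF (i k : nat) : measurable (F i k).
  by have [] := markov hb false false t0 (future_setT hb (lexx 0)) (@path_sets_bin R t r
    (- r + i%:R * (r / L%:R)) (t * (- r + k%:R * (r / L%:R))) (r / L%:R)).
set c := pr (confined b t r).
have [[i [k Hik]]|none] := pselect (exists i k : nat, c / (2 * L)%N%:R ^+ 2 <= pr (F i k)).
  by do 2 eexists; exact: Hik.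
exfalso.
have lt_c (i k : nat) : pr (F i k) < c / (2 * L)%N%:R ^+ 2.
  by rewrite ltNge; apply/negP => H; apply: none; exists i, k.
have sub : confined b t r `<=` \big[setU/set0]_(i < 2 * L) \big[setU/set0]_(k < 2 * L) F i k.
  move=> w /(confined_bins t0 r0 L0)[i iL [k kL H]].
  rewrite -(bigcup_mkord _ (fun i : nat => \big[setU/set0]_(k < 2 * L) F i k)); exists i => //.
  by rewrite -(bigcup_mkord _ (F i)); exists k.
have mU (i : nat) : measurable (\big[setU/set0]_(k < 2 * L) F i k).
  by apply: bigsetU_measurable.
have : c <= \sum_(i < 2 * L) \sum_(k < 2 * L) pr (F i k).
  rewrite -lee_fin fineK; last by rewrite fin_num_measure//; exact: measurable_confined.
  apply: (le_trans (le_measure P _ _ sub)).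
  - by rewrite inE; exact: measurable_confined.
  - by rewrite inE; apply: bigsetU_measurable => i _; exact: (mU i).
  apply: (le_trans (@Boole_inequality _ _ _ P (fun i : nat => \big[setU/set0]_(k < 2 * L) F i k) (2 * L) _)).
    by move=> i _; exact: mU.
  rewrite -sumEFin; apply: lee_sum => i _.
  apply: (le_trans (@Boole_inequality _ _ _ P (F i) (2 * L) _)).
    by move=> k _; exact: mF.
  by rewrite -sumEFin; apply: lee_sum => k _; rewrite fineK// fin_num_measure.
apply/negP; rewrite -ltNge.
have L2n : (0 < 2 * L)%N by rewrite muln_gt0.
have L2 : 0 < (2 * L)%N%:R :> R by rewrite ltr0n.
have -> : c = \sum_(i < 2 * L) \sum_(k < 2 * L) (c / (2 * L)%N%:R ^+ 2).
  rewrite !sumr_const !card_ord -mulrnA -mulr_natr natrM; field.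
  by rewrite pnatr_eq0 -lt0n.
have ne : has xpredT (index_enum 'I_(2 * L)).
  by apply/hasP; exists (Ordinal L2n); rewrite ?mem_index_enum.
by apply: ltr_sum => // i _; exact: ltr_sum.
Qed.

(** The order of quantifiers matters: C, the number of bins per block to the power of the number of
    blocks, depends neither on r nor on a. *)
Lemma steered_event T (K : nat) : 0 < T -> (0 < K)%N -> exists2 C : R, 0 < C &
  forall r a, 0 < r -> 0 < a -> pi / 2 <= a * r <= pi -> exists E : set Omega,
  [/\ measurable E, expR (- (a ^+ 2 * T / 2)) / C <= pr E &
    forall w, E w -> forall u, 0 <= u <= T ->
      `|b u w| <= r * (1 + 2 / K%:R) /\ `|integ 0 u (b ^~ w)| <= 7 * T * r / K%:R].
Proof.
(* With cells of width r / K^2 the drift 2 K nu of b is 2 r / K. The integral is then at most (T r /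
   K) (3 + 7 / (2 K)), whence the 7. *)
move=> T0 K0; pose L := (K ^ 2)%N; pose t := T / (4 * K)%N%:R.
have K4 : 0 < (4 * K)%N%:R :> R by rewrite ltr0n muln_gt0.
have K1 : 1 <= K%:R :> R by rewrite ler1n.
have t0 : 0 < t by rewrite divr_gt0.
have L0 : (0 < L)%N by rewrite expn_gt0 K0.
have D0 : 0 < (2 * L)%N%:R ^+ 2 :> R by rewrite exprn_gt0// ltr0n muln_gt0.
have tK : t * (4 * K)%N%:R = T by rewrite divfK// gt_eqF.
exists (((2 * L)%N%:R ^+ 2) ^+ (4 * K)); first by rewrite exprn_gt0.
move=> r a r0 a0 ar.
have [e [i Hei]] := good_bin t0 r0 L0.
have [[mE _] PE] := steered_prob r e i (r / L%:R) (4 * K) t0.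
exists (steered t r e i (r / L%:R) (4 * K)); split => //.
  rewrite PE -exprVn; apply: le_trans (lerXn2r _ _ _ Hei); rewrite ?nnegrE ?divr_ge0 ?fine_ge0 ?(ltW D0)//.
  rewrite exprMn ler_wpM2r ?exprn_ge0 ?invr_ge0 ?(ltW D0)//.
  apply: le_trans (lerXn2r _ _ _ (confined_lower hb t0 a0 ar)).
  - by rewrite -expRM_natr -mulNr; rewrite le_eqVlt; apply/orP; left; apply/eqP; congr expR;
      rewrite -tK; ring.
  - by rewrite nnegrE expR_ge0.
  - by rewrite nnegrE fine_ge0.
move=> w st u uT.
have nu0 : 0 <= r / L%:R by rewrite divr_ge0// ltW.
have [_ _ H3 H4] := steered_path t0 (ltW r0) nu0 K0 st (leqnn K).
rewrite tK in H3 H4; have := H3 u uT; have := H4 u uT.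
have LE : L%:R = K%:R ^+ 2 :> R by rewrite natrX.
have tE : t = T / (4 * K%:R) by rewrite /t natrM.
have Kn0 : K%:R != 0 :> R by rewrite lt0r_neq0// (lt_le_trans _ K1).
have -> : r + 2 * K%:R * (r / L%:R) = r * (1 + 2 / K%:R) by rewrite LE; field.
move=> G4 G3; split=> //; apply: (le_trans G4).
have -> : K%:R * (t * (8 * K%:R + 6) * (r / L%:R)) + 4 * t * (r * (1 + 2 / K%:R)) =
   (T * r / K%:R) * (3 + 7 / 2 / K%:R) by rewrite LE tE; field.
rewrite [leRHS](_ : _ = T * r / K%:R * 7); last by ring.
apply: ler_wpM2l; first by rewrite !mulr_ge0 ?invr_ge0 ?(ltW T0) ?(ltW r0).
have : K%:R^-1 <= 1 :> R by rewrite invf_le1// (lt_le_trans _ K1).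
by lra.
Qed.

End steered.

(** * The lowest Dirichlet eigenvalue *)

Section eigenvalue.
Context (R : realType).
Implicit Types (a c x y lam : R) (u w : R -> R).

Lemma is_derive_cosM a x : is_derive x 1 (fun x => cos (a * x)) (- a * sin (a * x)).
Proof.
have H : is_derive x 1 (fun x : R => a * x) a.
  by apply: (is_derive_eq (is_deriveZ a (is_derive_id x (1 : R)))); rewrite /GRing.scale/= mulr1.
have := @is_derive1_comp R cos (fun x => a * x) x _ _ (is_derive_cos _) H.
by move=> H'; apply: is_derive_eq; rewrite mulrC mulrN mulNr.
Qed.

Lemma is_derive_sinM a x : is_derive x 1 (fun x => sin (a * x)) (a * cos (a * x)).
Proof.
have H : is_derive x 1 (fun x : R => a * x) a.
  by apply: (is_derive_eq (is_deriveZ a (is_derive_id x (1 : R)))); rewrite /GRing.scale/= mulr1.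
have := @is_derive1_comp R sin (fun x => a * x) x _ _ (is_derive_sin _) H.
by move=> H'; apply: is_derive_eq; rewrite mulrC.
Qed.

Lemma derive1_cosM a : derive1 (fun x => cos (a * x)) = (fun x => - a * sin (a * x)).
Proof. by apply/funext => x; rewrite derive1E; have := is_derive_cosM a x; case. Qed.

Lemma is_derive2_cosM a x :
  is_derive x 1 (derive1 (fun x => cos (a * x))) (- a ^+ 2 * cos (a * x)).
Proof.
rewrite derive1_cosM; have H := is_derive_sinM a x.
have : is_derive x 1 (fun x => (- a) *: sin (a * x)) ((- a) *: (a * cos (a * x))).
  exact: is_deriveZ.
by move=> H'; apply: is_derive_eq; rewrite /GRing.scale/=; ring.
Qed.

Lemma continuous_cosM a : continuous (fun x => cos (a * x)).
Proof.
move=> x; apply: continuous_comp; last exact: continuous_cos.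
by apply: continuousM; [exact: cvg_cst|exact: cvg_id].
Qed.

Lemma cos_dirichlet_eigenvalue : dirichlet_eigenvalue (-1) 1 (pi ^+ 2 / 8 : R).
Proof.
exists (fun x => cos (pi / 2 * x)); split.
- exact/continuous_subspaceT/continuous_cosM.
- by rewrite mulrN1 cosN cos_pihalf.
- by rewrite mulr1 cos_pihalf.
- by exists 0; rewrite ?in_itv/= ?oppr_lt0 ?ltr01// mulr0 cos0 oner_neq0.
move=> x _; have H1 := is_derive_cosM (pi / 2) x; have H2 := is_derive2_cosM (pi / 2) x.
by split => //; rewrite derive1E derive_val; field.
Qed.

(** At an interior maximum the derivative vanishes; a positive second derivative makes it positive
    just to the right, and the mean value theorem gives a larger value there. *)
Lemma second_derivative_test u a c d : a < c < d ->
  (forall x, x \in `]a, d[ -> derivable u x 1) -> derivable (derive1 u) c 1 ->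
  0 < derive1 (derive1 u) c -> ~ (forall x, x \in `]a, d[ -> u x <= u c).
Proof.
move=> /andP[ac cd] du ddu pos mx.
have cad : c \in `]a, d[ by rewrite in_itv/= ac.
have u'c : derive1 u c = 0.
  have H := derive1_at_max (ltW (lt_trans ac cd)) du cad mx.
  by rewrite derive1E derive_val.
rewrite derive1E in pos.
have [L L0 H] : exists2 L : R, 0 < L &
    h^-1 *: ((derive1 u \o shift c) (h *: 1) - derive1 u c) @[h --> 0^'] --> L.
  by eexists; [exact: pos|exact: ddu].
have /cvgrPdist_lt/(_ _ L0)[e /= e0 He] := H.
pose h := Num.min (e / 2) ((d - c) / 2).
have h0 : 0 < h by rewrite lt_min !divr_gt0// subr_gt0.
have he : h < e by rewrite gt_min; apply/orP; left; lra.
have hd : c + h < d by have : h <= (d - c) / 2; [rewrite ge_min lexx orbT|lra].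
have u'pos x : x \in `]c, c + h[ -> 0 < derive1 u x.
  rewrite in_itv/= => /andP[cx xh].
  have := He (x - c); rewrite /ball_/= sub0r normrN gtr0_norm ?subr_gt0//.
  have -> : x - c < e by lra.
  rewrite gt_eqF ?subr_gt0// => /(_ isT isT) /=; rewrite /GRing.scale/= mulr1 subrK u'c subr0.
  by rewrite ltr_distl => /andP[_]; rewrite ltrDr pmulr_rgt0// invr_gt0 subr_gt0.
have [|||y yc] := @MVT R u (derive1 u) c (c + h).
- by rewrite ltrDl.
- move=> x; rewrite in_itv/= => /andP[cx xh].
  have xad : x \in `]a, d[ by rewrite in_itv/= (lt_trans ac cx) (lt_trans xh hd).
  by split; [exact: du|rewrite derive1E].
- apply: derivable_within_continuous => x; rewrite in_itv/= => /andP[cx xh].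
  by apply: du; rewrite in_itv/= (lt_le_trans ac cx) (le_lt_trans xh hd).
have := mx (c + h); rewrite in_itv/= hd (lt_trans ac) ?ltrDl// => /(_ isT) H1 H2.
have : 0 < derive1 u y * (c + h - c) by rewrite mulr_gt0 ?u'pos// addrAC subrr add0r.
by rewrite -H2 subr_gt0 ltNge H1.
Qed.

(* If lam < pi^2/8 choose a < pi/2 with 2 lam < a^2; then u / cos(a x) has a
   positive interior maximum v, where u - v cos(a x) would have a strictly
   positive second derivative. *)
Lemma dirichlet_eigenvalue_ge lam : dirichlet_eigenvalue (-1) 1 lam -> pi ^+ 2 / 8 <= lam.
Proof.
case=> u0 [cu0 u0a u0b [x0 x0I u0x0] Du0]; rewrite leNgt; apply/negP => lam_lt.
have [u [cu ua ub [x1 x1I ux1] Du]] : exists u : R -> R,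
    [/\ {within `[-1, 1], continuous u}, u (-1) = 0, u 1 = 0,
        exists2 x, x \in `]-1, 1[ & 0 < u x &
        forall x, x \in `]-1, 1[ ->
          [/\ derivable u x 1, derivable (derive1 u) x 1 &
              derive1 (derive1 u) x = - (2 * lam * u x)]].
  have [pos|neg|eq] := ltrgtP 0 (u0 x0); last by rewrite -eq eqxx in u0x0.
    exists u0; split => //; first by exists x0.
    by move=> x xI; have [? ? H] := Du0 x xI; split=> //; lra.
  exists (fun x => - u0 x); split; rewrite ?u0a ?u0b ?oppr0//.
  - by move=> x; apply: cvgN; exact: cu0.
  - by exists x0; rewrite ?oppr_gt0.
  move=> x xI; have [du ddu H] := Du0 x xI.
  have DN y : y \in `]-1, 1[ -> derive1 (- u0) y = - derive1 u0 y.
    by move=> yI; have [? _ _] := Du0 y yI; rewrite !derive1E deriveN.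
  have nI : \forall y \near x, derive1 (- u0) y = - derive1 u0 y.
    by apply: filterS (near_in_itvoo xI) => y yI; exact: DN.
  split; first exact: derivableN.
    by apply: (near_eq_derivable _ (derivableN ddu)); near=> y; rewrite (near nI y).
  by rewrite derive1E (near_eq_derive _ nI) deriveN// -derive1E; lra.
(* The maximum with 0 covers negative lam; a^2 is the midpoint of m and (pi / 2)^2. *)
pose m := Num.max (2 * lam) 0.
have m_lt : m < (pi / 2) ^+ 2.
  by rewrite gt_max; apply/andP; split; [lra|rewrite exprn_gt0// divr_gt0 ?pi_gt0].
have m0 : 0 <= m by rewrite le_max lexx orbT.
pose a := Num.sqrt ((m + (pi / 2) ^+ 2) / 2).
have a2 : a ^+ 2 = (m + (pi / 2) ^+ 2) / 2.
  by rewrite sqr_sqrtr// divr_ge0// addr_ge0// sqr_ge0.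
have lam_a : 2 * lam < a ^+ 2.
  have : 2 * lam <= m by rewrite le_max lexx.
  rewrite a2; lra.
have a0 : 0 <= a by exact: sqrtr_ge0.
have a_pi : a < pi / 2.
  by rewrite -(ltr_pXn2r (n := 2))// ?nnegrE ?divr_ge0 ?pi_ge0// a2; lra.
have cosa x : x \in `[-1, 1] -> 0 < cos (a * x).
  rewrite in_itv/= => /andP[xlo xhi]; apply: cos_gt0_pihalf.
  by apply/andP; split; nra.
pose v x := u x / cos (a * x).
have [||c cI vmax] := @EVT_max R v (-1) 1.
- by lra.
- apply/subspace_continuousP => x xI; apply: cvgM.
    by move/subspace_continuousP: cu; exact.
  apply: cvgV; first by rewrite gt_eqF// cosa.
  by apply: cvg_within_filter; exact: continuous_cosM.
have x1I' : x1 \in `[-1, 1] by apply: subset_itv_oo_cc.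
have vx1 : 0 < v x1 by rewrite divr_gt0// cosa.
have vc : 0 < v c := lt_le_trans vx1 (vmax _ x1I').
have cI' : -1 < c < 1.
  move: cI; rewrite in_itv/= => /andP[c1 c2]; rewrite !lt_neqAle c1 c2 !andbT.
  apply/andP; split; apply/eqP => cE; move: vc.
    by rewrite /v -cE ua mul0r ltxx.
  by rewrite /v cE ub mul0r ltxx.
have cIo : c \in `]-1, 1[ by rewrite in_itv.
pose w x := u x - v c * cos (a * x).
have Dw x : x \in `]-1, 1[ -> is_derive x 1 w (derive1 u x - v c * (- a * sin (a * x))).
  move=> xI; have [du _ _] := Du x xI; have Hc := is_derive_cosM a x.
  have Hu : is_derive x 1 u (derive1 u x) by split; rewrite ?derive1E.
  exact: (is_deriveB Hu (is_deriveZ (v c) Hc)).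
have nw : \forall x \near c, derive1 w x = derive1 u x - v c * (- a * sin (a * x)).
  apply: filterS (near_in_itvoo cIo) => y yI.
  by have := Dw y yI => ?; rewrite derive1E derive_val.
have DDw : is_derive c 1 (derive1 w) ((a ^+ 2 - 2 * lam) * u c).
  have [_ ddu uE] := Du c cIo.
  have Hs := is_derive_sinM a c.
  have Hu : is_derive c 1 (derive1 u) (- (2 * lam * u c)) by split; rewrite -?derive1E.
  have H := is_deriveB Hu (is_deriveZ (v c) (is_deriveZ (- a) Hs)).
  apply: (near_eq_is_derive _ _); first by near=> y; rewrite (near nw y)//; reflexivity.
  apply: (is_derive_eq H); rewrite /GRing.scale/=.
  have -> : u c = v c * cos (a * c) by rewrite /v divfK// gt_eqF// cosa.
  by ring.
apply: (@second_derivative_test w (-1) c 1 cI').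
- by move=> x xI; have [] := Dw x xI.
- by case: DDw.
- rewrite derive1E derive_val mulr_gt0 ?subr_gt0//.
  by have := mulr_gt0 vc (cosa _ cI); rewrite /v divfK// gt_eqF// cosa.
- move=> x xI; have xI' : x \in `[-1, 1] by apply: subset_itv_oo_cc.
  rewrite /w [v c * cos (a * c)]divfK ?gt_eqF ?cosa// subrr subr_le0.
  by rewrite -ler_pdivrMr ?cosa// vmax.
Unshelve. all: end_near. Qed.

Lemma lowest_dirichlet_eigenvalue_interval lam :
  lowest_dirichlet_eigenvalue (-1) 1 lam -> lam = pi ^+ 2 / 8.
Proof.
case=> /dirichlet_eigenvalue_ge lo hi; apply/le_anti.
by rewrite lo hi//; exact: cos_dirichlet_eigenvalue.
Qed.

End eigenvalue.

(** * Small balls *)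

Section norm_bounds.
Context (R : realType).
Implicit Types (f : R -> R) (s t A B : R).
Local Notation mu := (@lebesgue_measure R).

Lemma slack (k L h : R) : 0 < L -> k <= h / (6 * L) -> 3 * k * L <= h / 2.
Proof. by move=> L0; rewrite ler_pdivlMr ?mulr_gt0//; lra. Qed.

(** For k <= 1 both (1 + k)^2 - 1 and 1 - (1 - k)^2 are at most 3 k. This uses half of the tolerance
    h; the other half covers the logarithms of the constant factors. *)
Lemma slack_squeeze (k L h q x c l : R) : 0 <= L -> 0 < k <= 1 -> 3 * k * L <= h / 2 ->
  q <= h / 2 -> x <= q -> - q <= c -> - ((1 + k) ^+ 2 * L) - x <= l ->
  c + l <= - ((1 - k) ^+ 2 * L) -> `|L + l| <= h.
Proof.
move=> L0 /andP[k0 k1] kL qh xq cq lo hi; rewrite ler_norml.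
have kk : k ^+ 2 * L <= k * L by rewrite ler_wpM2r// expr2 ler_piMr// ltW.
have kk0 : 0 <= k ^+ 2 * L by rewrite mulr_ge0// sqr_ge0.
by apply/andP; split; lra.
Qed.

Definition norm_path n f s : R := euclidean_norm (kolmogorov n f s).

Lemma norm_path_le n f s : norm_path n f s <= \sum_(i < n) `|iterated_integral i f s|.
Proof.
apply: (le_trans (euclidean_norm_le _)); apply: ler_sum => i _.
by rewrite mxE.
Qed.

Lemma norm_path_ge n f s i : (i < n)%N -> `|iterated_integral i f s| <= norm_path n f s.
Proof.
move=> il; have := euclidean_norm_ge (kolmogorov n f s) (Ordinal il).
by rewrite mxE.
Qed.

Lemma norm_path_sup n f t A : 0 <= t -> {within `[0, t], continuous f} ->
  (forall s, 0 <= s <= t -> `|f s| <= A) ->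
  forall s, 0 <= s <= t -> norm_path n f s <= (\sum_(i < n) t ^+ i) * A.
Proof.
move=> t0 cf fA s st; apply: (le_trans (norm_path_le _ _ _)).
rewrite mulr_suml; apply: ler_sum => i _.
exact: (iterated_integral_le _ t0 cf fA).
Qed.

(** Every coordinate after the first is an iterated integral of the first integral of f, so A enters
    once and B carries all the rest. *)
Lemma norm_path_two n f t A B : 0 <= t -> 0 <= A -> 0 <= B ->
  {within `[0, t], continuous f} ->
  (forall s, 0 <= s <= t -> `|f s| <= A) ->
  (forall s, 0 <= s <= t -> `|\int[mu]_(x in `[0, s]) f x| <= B) ->
  forall s, 0 <= s <= t -> norm_path n f s <= A + (\sum_(i < n) t ^+ i) * B.
Proof.
move=> t0 A0 B0 cf fA fB s st; apply: (le_trans (norm_path_le _ _ _)).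
have S0 m : 0 <= (\sum_(i < m) t ^+ i) * B.
  by rewrite mulr_ge0// sumr_ge0// => i _; rewrite exprn_ge0.
case: n => [|n]; first by rewrite big_ord0 addr_ge0.
rewrite big_ord_recl; apply: lerD; first exact: fA.
apply: (@le_trans _ _ ((\sum_(i < n) t ^+ i) * B)).
  rewrite mulr_suml; apply: ler_sum => i _; rewrite lift0 iterated_integralS.
  have c1 : {within `[0, t], continuous (iterated_integral 1 f)}.
    exact: iterated_integral_cont.
  exact: (iterated_integral_le _ t0 c1 fB).
by rewrite ler_wpM2r// [leRHS]big_ord_recr/= lerDl exprn_ge0.
Qed.

End norm_bounds.

(** * Small-ball probabilities of the Euclidean norm *)

Section small_ball.
Context (R : realType) (d : measure_display) (Omega : measurableType d)
  (P : probability Omega R) (b : R -> {RV P >-> R}).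
Implicit Types (s t T r a : R) (n : nat).
Hypothesis hb : brownian_motion b.
Local Notation pr X := (fine (P X)).

Let b0 w : b 0 w = 0. Proof. by case: hb. Qed.

Definition max_norm n t w : R := running_max (norm_path n (b ^~ w)) t.

Lemma within_norm_path n t w : 0 <= t ->
  {within `[0, t], continuous (norm_path n (b ^~ w))}.
Proof. by move=> t0; apply: kolmogorov_norm_cont => //; exact: (path_cont hb). Qed.

Lemma max_norm_ge n t s w : 0 <= s <= t -> norm_path n (b ^~ w) s <= max_norm n t w.
Proof.
move=> /[dup] /andP[s0 st] H; apply: running_max_ge_within => //.
exact: within_norm_path (le_trans s0 st).
Qed.

Lemma max_norm_le n t c w : 0 <= t ->
  (forall s, 0 <= s <= t -> norm_path n (b ^~ w) s <= c) -> max_norm n t w <= c.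
Proof. by move=> t0 H; exact: running_max_le. Qed.

Lemma max_norm_homo n s t w : 0 <= s <= t -> max_norm n s w <= max_norm n t w.
Proof.
move=> /andP[s0 st]; apply: max_norm_le => // u /andP[u0 us].
by apply: max_norm_ge; rewrite u0 (le_trans us).
Qed.

Lemma measurable_iterated k t : 0 <= t ->
  measurable_fun setT (fun w => iterated_integral k (b ^~ w) t).
Proof.
elim: k t => [|k IH] t t0 /=; first exact: measurable_funP.
move: t0; rewrite le_eqVlt => /predU1P[<-|t0].
  by under eq_fun do rewrite set_itv1 Rintegral_set1; exact: measurable_cst.
apply: (@measurable_fun_cvg _ _ _ _ (fun m w =>
  t / 2 ^+ m * (\sum_(i < 2 ^ m) iterated_integral k (b ^~ w) (t / 2 ^+ m * i%:R)))).
  move=> m; apply: measurable_funM; first exact: measurable_cst.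
  apply: measurable_sum => i; apply: IH.
  by rewrite mulr_ge0// divr_ge0 ?exprn_ge0// ltW.
move=> w _; have := @riemann_cvg R 0 t (iterated_integral k (b ^~ w))
  (fun m i => t / 2 ^+ m * i%:R) t0.
rewrite add0r; apply.
  by apply: iterated_integral_cont; [exact: ltW|exact: (path_cont hb)].
move=> m i im; rewrite !add0r lexx/= ler_wpM2l ?ler_nat//.
by rewrite divr_ge0 ?exprn_ge0// ltW.
Qed.

Lemma measurable_norm_path n t : 0 <= t ->
  measurable_fun setT (fun w => norm_path n (b ^~ w) t).
Proof.
move=> t0; rewrite /norm_path /euclidean_norm.
apply: (measurableT_comp (continuous_measurable_fun (@sqrt_continuous R))).
apply: measurable_sum => i; apply: measurable_funX.
by under eq_fun do rewrite mxE; exact: measurable_iterated.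
Qed.

(** Written for measurability: a strict bound on the supremum leaves a margin 1 / (j + 1), and by
    continuity dyadic times suffice. *)
Lemma max_norm_ltE n t e : 0 < t -> [set w | max_norm n t w < e] =
  \bigcup_j \bigcap_m \bigcap_i
    [set w | (i <= 2 ^ m)%N -> norm_path n (b ^~ w) (t / 2 ^+ m * i%:R) <= e - j.+1%:R^-1].
Proof.
move=> t0; apply/seteqP; split=> w /=.
  rewrite -subr_gt0 => H.
  have [j _ /(_ j (leqnn j)) Hj] := near_infty_natSinv_lt (PosNum H).
  exists j => // m _ i _ im; rewrite lerBrDl -lerBrDr (le_trans (ltW Hj))//=.
  rewrite lerD2l lerN2 max_norm_ge//.
  rewrite mulr_ge0 ?divr_ge0 ?exprn_ge0 ?(ltW t0)//=.
  by rewrite mulrAC ler_pdivrMr ?exprn_gt0// ler_wpM2l ?(ltW t0)// -natrX ler_nat.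
case=> j _ H; apply: (@le_lt_trans _ _ (e - j.+1%:R^-1)); last first.
  by rewrite ltrBlDr ltrDl invr_gt0.
apply: max_norm_le; first exact: ltW.
move=> s st; apply: (@dyadic_le R (norm_path n (b ^~ w)) 0 t) => //; rewrite ?add0r//.
  by apply: within_norm_path; exact: ltW.
by move=> m i im; rewrite add0r; exact: (H m I i I im).
Qed.

Lemma measurable_max_norm_lt n t e : 0 < t -> measurable [set w | max_norm n t w < e].
Proof.
move=> t0; rewrite max_norm_ltE//; apply: bigcupT_measurable => j.
apply: bigcapT_measurable => m; apply: bigcapT_measurable => i.
have [im|im] := boolP (i <= 2 ^ m)%N; last first.
  by rewrite (_ : mkset _ = setT)//; apply/seteqP; split => w //= _ /(negP im).
rewrite (_ : mkset _ = (fun w => norm_path n (b ^~ w) (t / 2 ^+ m * i%:R)) @^-1`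
    `]-oo, e - j.+1%:R^-1]); last first.
  by apply/seteqP; split => w /=; rewrite in_itv/=; [exact|move=> + _].
rewrite -[X in measurable X]setTI; apply: measurable_norm_path => //.
by rewrite mulr_ge0// divr_ge0 ?exprn_ge0// ltW.
Qed.

Lemma max_norm_confined n t e w : (0 < n)%N -> 0 < t -> max_norm n t w <= e ->
  confined b t e w.
Proof.
move=> n0 t0 H; apply/(confinedP hb) => // u ut; apply: le_trans H.
exact: (le_trans (norm_path_ge (b ^~ w) u n0) (max_norm_ge n w ut)).
Qed.

Lemma pr_mono (A B : set Omega) : measurable A -> measurable B -> A `<=` B -> pr A <= pr B.
Proof.
by move=> mA mB AB; rewrite fine_le ?fin_num_measure// le_measure// inE.
Qed.

(** The choice a e = (1 - k) pi / 2 keeps away from the zero of the cosine, and makes the factor a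
    positive constant independent of e. *)
Lemma small_ball_upper n T k e : (0 < n)%N -> 0 < T -> 0 < k < 1 -> 0 < e ->
  cos ((1 - k) * pi / 2) * pr [set w | max_norm n T w < e] <=
  expR (- ((1 - k) ^+ 2 * (pi ^+ 2 / 8 * T) / e ^+ 2)).
Proof.
move=> n0 T0 /andP[k0 k1] e0; pose a := (1 - k) * pi / (2 * e).
have ae : a * e = (1 - k) * pi / 2 by rewrite /a; field; rewrite gt_eqF.
have pi0 := pi_gt0 R.
have a0 : 0 < a by rewrite !mulr_gt0 ?subr_gt0// invr_gt0 mulr_gt0.
have ae_lt : a * e < pi / 2 by rewrite ae; nra.
have cos0 : 0 < cos (a * e).
  by apply: cos_gt0_pihalf; rewrite ae_lt andbT (lt_trans _ (mulr_gt0 a0 e0))// oppr_lt0 divr_gt0.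
have := confined_upper hb T0 a0 (ltW e0) ae_lt.
rewrite -ae (_ : a ^+ 2 * T / 2 = (1 - k) ^+ 2 * (pi ^+ 2 / 8 * T) / e ^+ 2); last first.
  by rewrite /a; field; rewrite gt_eqF.
apply: le_trans; rewrite ler_wpM2l ?(ltW cos0)// pr_mono//.
- exact: measurable_max_norm_lt.
- exact: measurable_confined.
- by move=> w /= /ltW; exact: max_norm_confined.
Qed.

Lemma small_ball_lower n T k : 0 < T -> 0 < k <= 1 -> exists2 C : R, 0 < C &
  forall e, 0 < e -> expR (- ((1 + k) ^+ 2 * (pi ^+ 2 / 8 * T) / e ^+ 2)) / C <=
    pr [set w | max_norm n T w < e].
Proof.
move=> T0 /andP[k0 k1]; have pi0 := pi_gt0 R.
pose S := \sum_(i < n) T ^+ i; have S0 : 0 <= S.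
  by rewrite sumr_ge0// => i _; rewrite exprn_ge0// ltW.
(* On the steered event the norm is at most r (1 + D / K): 2 comes from b, 7 T from its integral,
   and S from the higher coordinates. K is then chosen with D / K < k. *)
pose D := 2 + S * (7 * T).
have D0 : 0 <= D by rewrite addr_ge0// mulr_ge0// mulr_ge0// ltW.
pose K := (Num.trunc (2 * D / k)).+1.
have DK : D / K%:R < k.
  rewrite ltr_pdivrMr ?ltr0n// mulrC -ltr_pdivrMr//.
  apply: (@le_lt_trans _ _ (2 * D / k)); last by exact: truncnS_gt.
  by rewrite ler_wpM2r ?invr_ge0 ?(ltW k0)// ler_peMl// ler1n.
have [C C0 HC] := steered_event hb T0 (isT : (0 < K)%N).
exists C => // e e0; pose r := e / (1 + k); pose a := pi / (2 * r).
have k10 : 0 < 1 + k by rewrite addr_gt0.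
have r0 : 0 < r by rewrite divr_gt0.
have a0 : 0 < a by rewrite divr_gt0// mulr_gt0.
have ar : a * r = pi / 2 by rewrite /a; field; rewrite gt_eqF.
have [|E [mE PE HE]] := HC r a r0 a0.
  by rewrite ar lexx/=; lra.
rewrite (_ : (1 + k) ^+ 2 * (pi ^+ 2 / 8 * T) / e ^+ 2 = a ^+ 2 * T / 2); last first.
  by rewrite /a /r; field; rewrite !gt_eqF.
apply: (le_trans PE); apply: pr_mono => //; first exact: measurable_max_norm_lt.
move=> w Ew /=; apply: (@le_lt_trans _ _ (r * (1 + D / K%:R))).
  apply: max_norm_le => [|s sT]; first exact: ltW.
  have K0 : 0 < K%:R :> R by rewrite ltr0n.
  have A0 : 0 <= r * (1 + 2 / K%:R) by rewrite mulr_ge0 ?addr_ge0 ?divr_ge0// ltW.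
  have B0 : 0 <= 7 * T * r / K%:R by apply: divr_ge0 (ltW K0); apply: mulr_ge0 (ltW r0); apply: mulr_ge0 (ltW T0).
  have := @norm_path_two R n (b ^~ w) T _ _ (ltW T0) A0 B0 (path_cont hb (lexx 0))
    (fun u uT => (HE w Ew u uT).1) (fun u uT => (HE w Ew u uT).2) s sT.
  move/le_trans; apply; rewrite -/S le_eqVlt; apply/orP; left; apply/eqP.
  by rewrite /D; field; rewrite gt_eqF.
by rewrite [ltRHS](_ : e = r * (1 + k)) ?ltr_pM2l ?ltrD2l// divfK// gt_eqF.
Qed.

Theorem small_ball n T : (0 < n)%N -> 0 < T ->
  (fun e : R => (- ((e ^+ 2)%:E * lne (P [set w | (max_norm n T w < e)%R])))%E)
    @ 0^'+ --> (pi ^+ 2 / 8 * T)%:E.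
Proof.
move=> n0 T0; pose L := pi ^+ 2 / 8 * T; pose p e := pr [set w | max_norm n T w < e].
have L0 : 0 < L by rewrite mulr_gt0// divr_gt0// exprn_gt0// pi_gt0.
(* Positivity turns the extended logarithm into a real one; the lower bound with k = 1 is enough for
   it. *)
have p0 e : 0 < e -> 0 < p e.
  move=> e0; have [|C C0 /(_ e e0)] := @small_ball_lower n T 1 T0; first by rewrite ltr01 lexx.
  by apply: lt_le_trans; rewrite divr_gt0// expR_gt0.
suff H : (fun e => - (e ^+ 2 * ln (p e))) @ 0^'+ --> L.
  have : (fun e => (- (e ^+ 2 * ln (p e)))%:E) @ 0^'+ --> L%:E.
    by apply/fine_cvgP; split; [near=> e|exact: H].
  apply: cvg_trans; apply: near_eq_cvg; near=> e.
  have e0 : 0 < e by near: e; exact: nbhs_right_gt.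
  rewrite EFinN EFinM -lne_EFin ?p0// /p fineK// fin_num_measure//.
  exact: measurable_max_norm_lt.
apply/cvgrPdist_le => h h0.
pose k := Num.min (1 / 2) (h / (6 * L)).
have k0 : 0 < k by rewrite lt_min !divr_gt0// mulr_gt0.
have k12 : k <= 1 / 2 by rewrite ge_min lexx.
have kL : 3 * k * L <= h / 2.
  by apply: slack => //; rewrite ge_min lexx orbT.
have k01 : 0 < k <= 1 by apply/andP; split => //; lra.
have k1 : 0 < k < 1 by apply/andP; split => //; lra.
have [C C0 lo] := small_ball_lower n T0 k01.
pose c := cos ((1 - k) * pi / 2).
have c0 : 0 < c.
  apply: cos_gt0_pihalf; have := pi_gt0 R => pi0.
  by apply/andP; split; nra.
(* Dominates the logarithms of both constants; the added 1 allows division by Q. *)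
pose Q := `|ln C| + `|ln c| + 1.
have Q0 : 0 < Q by rewrite ltr_pwDr// addr_ge0.
near=> e.
have e0 : 0 < e by near: e; exact: nbhs_right_gt.
have e20 : 0 < e ^+ 2 by rewrite exprn_gt0.
have e1 : e < 1 by near: e; exact: nbhs_right_lt.
have eQ : e ^+ 2 * Q <= h / 2.
  have : e < h / (2 * Q) by near: e; apply: nbhs_right_lt; rewrite divr_gt0// mulr_gt0.
  rewrite ltr_pdivlMr ?mulr_gt0// => eQ.
  have : e ^+ 2 * Q <= e * Q by rewrite ler_wpM2r ?(ltW Q0)// expr2 ler_piMr// ltW.
  by lra.
have mul_e (x : R) : e ^+ 2 * (x / e ^+ 2) = x by rewrite mulrCA mulfV ?mulr1// gt_eqF.
have pe0 := p0 e e0.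
have lo1 : - ((1 + k) ^+ 2 * L) - e ^+ 2 * ln C <= e ^+ 2 * ln (p e).
  have := lo e e0; rewrite -/(p e) -/L -ler_ln ?posrE ?divr_gt0 ?expR_gt0//.
  rewrite ln_div ?posrE ?expR_gt0// expRK => /(ler_wpM2l (ltW e20)).
  by rewrite mulrBr mulrN mul_e.
have hi1 : e ^+ 2 * ln c + e ^+ 2 * ln (p e) <= - ((1 - k) ^+ 2 * L).
  have := small_ball_upper n0 T0 k1 e0; rewrite -/(p e) -/L -/c.
  rewrite -ler_ln ?posrE ?mulr_gt0 ?expR_gt0// lnM ?posrE// expRK => /(ler_wpM2l (ltW e20)).
  by rewrite mulrDr mulrN mul_e.
have lnC : e ^+ 2 * ln C <= e ^+ 2 * Q.
  rewrite ler_wpM2l ?(ltW e20)// (le_trans (ler_norm _))// /Q -addrA lerDl addr_ge0//.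
have lnc : - (e ^+ 2 * Q) <= e ^+ 2 * ln c.
  rewrite -mulrN ler_wpM2l ?(ltW e20)// lerNl (le_trans (ler_norm _))// normrN /Q.
  by rewrite [`|_| + `|_|]addrC -addrA lerDl addr_ge0.
by rewrite opprK; exact: (slack_squeeze (ltW L0) k01 kL eQ lnC lnc lo1 hi1).
Unshelve. all: end_near. Qed.

End small_ball.

(** * Lower limits *)

Section lower_limits.
Context (R : realType) (F : set_system R) (FF : Filter F) (f : R -> R) (c : R).
Local Notation liminf := (limf_einf (fun t => (f t)%:E) F).

Lemma limf_einf_eq :
  (forall e, 0 < e -> \forall x \near F, c - e <= f x) ->
  (forall e, 0 < e -> forall V, F V -> exists2 x, V x & f x <= c + e) ->
  liminf = c%:E.
Proof.
move=> lo hi; rewrite limf_einfE; apply/le_anti/andP; split.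
  apply: ge_ereal_sup => _ [V FV <-]; apply/lee_addgt0Pr => e e0.
  have [x Vx fx] := hi e e0 V FV; apply: (@le_trans _ _ (f x)%:E).
    by apply: ereal_inf_lbound; exists x.
  by rewrite -EFinD lee_fin.
apply/lee_subgt0Pr => e e0; have FV := lo e e0.
apply: (@le_trans _ _ (ereal_inf [set (f t)%:E | t in [set x | c - e <= f x]])).
  by apply: le_ereal_inf_tmp => _ [x /= Hx <-]; rewrite -EFinB lee_fin.
by apply: ereal_sup_ubound; exists [set x | c - e <= f x].
Qed.

Lemma limf_einf_near e : liminf = c%:E -> 0 < e -> \forall x \near F, c - e <= f x.
Proof.
rewrite limf_einfE => H e0; have : ((c - e)%:E < c%:E)%E by rewrite lte_fin ltrBlDr ltrDl.
rewrite -H => /ereal_sup_gt[_ [V FV <-] HV].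
apply: filterS FV => x Vx; rewrite -lee_fin (le_trans (ltW HV))//.
by apply: ereal_inf_lbound; exists x.
Qed.

Lemma limf_einf_frequently e V : liminf = c%:E -> 0 < e -> F V ->
  exists2 x, V x & f x <= c + e.
Proof.
rewrite limf_einfE => H e0 FV; apply: contrapT => none.
have : (c%:E < (c + e)%:E)%E by rewrite lte_fin ltrDl.
apply/negP; rewrite -leNgt -[leRHS]H.
apply: (@le_trans _ _ (ereal_inf [set (f t)%:E | t in V])).
  apply: le_ereal_inf_tmp => _ [x Vx <-]; rewrite lee_fin leNgt; apply/negP => /ltW fx.
  by apply: none; exists x.
by apply: ereal_sup_ubound; exists V.
Qed.

End lower_limits.

(** * Borel-Cantelli arguments *)

Section borel_cantelli.
Context (R : realType) (d : measure_display) (Omega : measurableType d)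
  (P : probability Omega R).
Local Notation pr X := (fine (P X)).

(* Summability is asked in telescoping form, which avoids infinite series. *)
Lemma borel_cantelli (A : nat -> set Omega) (u : nat -> R) N :
  (forall k, measurable (A k)) -> (forall k, 0 <= u k) ->
  (forall k, (N <= k)%N -> pr (A k) <= u k - u k.+1) ->
  {ae P, forall w, exists m, forall k, (m <= k)%N -> ~ A k w}.
Proof.
move=> mA u0 H; pose F k := A (N + k)%N.
have mF k : measurable (F k) by exact: mA.
exists (lim_sup_set F); split.
- by apply: bigcapT_measurable => n; apply: bigcup_measurable => j _.
- apply: lim_sup_set_cvg0 => //; apply: (@le_lt_trans _ _ (u N)%:E); last exact: ltry.
  apply: lime_le; first by apply: is_cvg_nneseries.
  apply: nearW => n; apply: (@le_trans _ _ (u N - u (N + n)%N)%:E); last first.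
    by rewrite lee_fin lerBlDr lerDl.
  elim: n => [|n IH]; first by rewrite big_geq// addn0 subrr.
  rewrite big_nat_recr//= -[P (F n)]fineK ?fin_num_measure//.
  apply: (le_trans (leeD IH (_ : _ <= (u (N + n)%N - u (N + n).+1)%:E)%E)).
    by rewrite lee_fin H// leq_addr.
  by rewrite -EFinD lee_fin addnS addrA subrK.
- move=> w /= Hw n _; apply: contrapT => none; apply: Hw.
  exists (N + n)%N => k nk Akw; apply: none; exists (k - N)%N => /=.
    by rewrite leq_subRL// (leq_trans _ nk)// leq_addr.
  by rewrite /F subnKC// (leq_trans _ nk)// leq_addr.
Qed.

(** Takes the place of the second Borel-Cantelli lemma: it asks for small probabilities that none of
    finitely many events occurs, which [markov] delivers block by block. *)
Lemma ae_infinitely_often (A : nat -> set Omega) N :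
  (forall k, measurable (A k)) ->
  (forall m, (N <= m)%N -> forall e, 0 < e -> exists j,
     pr (\bigcap_(i in [set i | (i < j)%N]) ~` A (m + i)%N) <= e) ->
  {ae P, forall w m, exists2 k, (m <= k)%N & A k w}.
Proof.
move=> mA H; apply/ae_foralln => m.
pose D := \bigcap_i ~` A (N + m + i)%N.
have mD : measurable D by apply: bigcapT_measurable => i; exact: measurableC.
exists D; split => //.
- apply/eqP; rewrite -fine_eq0 ?fin_num_measure//; apply/eqP/le_anti.
  rewrite fine_ge0// andbT; apply/ler_addgt0Pr => e e0; rewrite add0r.
  have [j] := H (N + m)%N (leq_addr _ _) e e0; apply: le_trans.
  rewrite fine_le ?fin_num_measure//; last first.
    rewrite le_measure ?inE//.
      by apply: bigcap_measurableType => i _; exact: measurableC.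
    by move=> w Dw i _; exact: Dw.
  by apply: bigcap_measurableType => i _; exact: measurableC.
- move=> w /= Hw i _ Ai; apply: Hw; exists (N + m + i)%N => //.
  by rewrite addnAC leq_addl.
Qed.

End borel_cantelli.

Section estimates.
Context (R : realType).
Implicit Types (s x e : R).

Lemma ln_nat_ge0 k : 0 <= ln (k.+1%:R : R).
Proof. by rewrite ln_ge0// ler1n. Qed.

(** The terms (k + 2)^(- 1 - s) are dominated by telescoping differences of (k + 1)^(- s), as
    [borel_cantelli] asks; this follows from ln (k + 2) - ln (k + 1) >= 1 / (k + 2). *)
Lemma power_tail s k : 0 < s -> s * expR (- (1 + s) * ln k.+2%:R) <=
  expR (- s * ln k.+1%:R) - expR (- s * ln k.+2%:R).
Proof.
move=> s0; have k0 : 0 < k.+2%:R :> R by rewrite ltr0n.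
have k10 : 0 < k.+1%:R :> R by rewrite ltr0n.
have D : k.+2%:R^-1 <= ln k.+2%:R - ln (k.+1%:R : R).
  have := @le_ln1Dx R (- k.+2%:R^-1); rewrite ltrN2 invf_lt1 ?ltr1n// => /(_ isT).
  have -> : 1 - k.+2%:R^-1 = k.+1%:R / k.+2%:R :> R.
    have E : k.+2%:R = k.+1%:R + 1 :> R by rewrite natr1.
    have : k.+1%:R + 1 != 0 :> R by rewrite -E gt_eqF.
    by rewrite E; move: (k.+1%:R : R) => y y1; field.
  by rewrite ln_div ?posrE// => H; rewrite -opprB lerNr.
have -> : - s * ln k.+1%:R = - s * ln k.+2%:R + s * (ln k.+2%:R - ln k.+1%:R) by ring.
rewrite expRD -[X in _ - X]mulr1 -mulrBr.
have -> : - (1 + s) * ln k.+2%:R = - s * ln k.+2%:R + - ln k.+2%:R :> R by ring.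
rewrite expRD expRN lnK ?posrE// mulrCA ler_wpM2l ?expR_ge0//.
have := @expR_ge1Dx R (s * (ln k.+2%:R - ln k.+1%:R)); rewrite -lerBrDl.
by apply: le_trans; rewrite ler_wpM2l// ltW.
Qed.

(** The graph of ln lies below its tangent at 1 / e. *)
Lemma ln_le_linear e x : 0 < e -> 0 < x -> ln x <= e * x - ln e - 1.
Proof.
move=> e0 x0; have ex : 0 < e * x by rewrite mulr_gt0.
have := @le_ln1Dx R (e * x - 1); rewrite (_ : 1 + (e * x - 1) = e * x); last by ring.
have -> : -1 < e * x - 1 by lra.
by move=> /(_ isT); rewrite lnM ?posrE//; lra.
Qed.

End estimates.

Section exit_bound.
Context (R : realType) (d : measure_display) (Omega : measurableType d)
  (P : probability Omega R) (b : R -> {RV P >-> R}).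
Hypothesis hb : brownian_motion b.

(** From [confined_lower] with a = pi / r and 1 - exp (- x) <= x; it does the work of a maximal
    inequality. *)
Lemma not_confined_le (t r : R) : 0 < t -> 0 < r ->
  fine (P (~` confined b t r)) <= pi ^+ 2 * t / (2 * r ^+ 2).
Proof.
move=> t0 r0; have pi0 := pi_gt0 R.
have mC := measurable_confined hb t r.
rewrite probability_setC// fineB ?fin_num_measure//= lerBlDr.
have ar : pi / 2 <= pi / r * r <= pi by rewrite divfK ?gt_eqF// lexx andbT; lra.
have := confined_lower hb t0 (divr_gt0 pi0 r0) ar.
have := @expR_ge1Dx R (- ((pi / r) ^+ 2 * t / 2)).
have -> : (pi / r) ^+ 2 * t / 2 = pi ^+ 2 * t / (2 * r ^+ 2).
  by field; rewrite gt_eqF.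
lra.
Qed.

End exit_bound.

(** * The law at zero *)

Section scales.
Context (R : realType).
Implicit Types (t l x q h : R) (k : nat).

Lemma sqrt_ratio l t : 0 < l -> 0 < t -> Num.sqrt (l / t) * Num.sqrt (t / l) = 1.
Proof.
move=> l0 t0; rewrite -sqrtrM ?divr_ge0 ?ltW// (_ : l / t * (t / l) = 1) ?sqrtr1//.
by field; rewrite !gt_eqF.
Qed.

(** For rho = (1 + q) / 2, both q < rho and q <= rho^2. It makes the exponent rho^3 / q^2 of the
    lower bound at zero exceed 1. *)
Lemma sqr_lt_cube_mid q : 0 < q < 1 -> q ^+ 2 < ((1 + q) / 2) ^+ 3.
Proof.
move=> /andP[q0 q1]; have q_lt : q < (1 + q) / 2 by lra.
have q_le : q <= ((1 + q) / 2) ^+ 2 by have := sqr_ge0 (1 - q); lra.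
rewrite expr2 exprSr (@lt_le_trans _ _ (q * ((1 + q) / 2)))// ?ltr_pM2l//.
by rewrite ler_wpM2r// ltW// (lt_trans q0).
Qed.

Lemma half_ratio x q : q != 0 -> x / (2 * q) * q = x / 2.
Proof. by move=> q0; field. Qed.

(* The logarithm of (k + 1)!. *)
Definition log_fact (k : nat) : R := \sum_(i < k) ln (i.+2%:R : R).

Lemma log_factS k : log_fact k.+1 = log_fact k + ln k.+2%:R.
Proof. by rewrite /log_fact big_ord_recr. Qed.

Lemma log_fact_ge k : ln (k.+1%:R : R) <= log_fact k.
Proof.
case: k => [|k]; first by rewrite ln1 /log_fact big_ord0.
by rewrite log_factS lerDr sumr_ge0// => i _; exact: ln_nat_ge0.
Qed.

Lemma ler_ln_nat (i j : nat) : (i <= j)%N -> ln (i.+1%:R : R) <= ln j.+1%:R.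
Proof. by move=> ij; rewrite ler_ln ?posrE ?ltr0n// ler_nat. Qed.

Lemma log_fact_le k : log_fact k <= k.+1%:R * ln (k.+1%:R : R).
Proof.
elim: k => [|k IH]; first by rewrite ln1 mulr0 /log_fact big_ord0.
have -> : k.+2%:R * ln k.+2%:R = k.+1%:R * ln k.+2%:R + ln k.+2%:R :> R.
  by rewrite -{1}(natr1 k.+1) mulrDl mul1r.
rewrite log_factS lerD2r.
by apply: (le_trans IH); rewrite ler_wpM2l// ler_ln_nat.
Qed.

Lemma ln_nat_large x : exists N, forall k, (N <= k)%N -> x <= ln (k.+1%:R : R).
Proof.
exists (Num.trunc (expR x)) => k Nk; rewrite -(expRK x) ler_ln ?posrE ?expR_gt0 ?ltr0n//.
by rewrite ltW// (lt_le_trans (truncnS_gt _))// ler_nat.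
Qed.

Lemma log_log_aux h g x : 0 < h <= 1 -> 0 < x -> 1 <= ln x ->
  ln 4 - ln h - 1 <= h * ln x -> ln x <= g <= x * ln x ->
  0 < ln (4 * g) <= (1 + h) ^+ 2 * ln x.
Proof.
move=> /andP[h0 h1] x0 y1 yh /andP[yg gx]; have y0 : 0 < ln x by lra.
have g0 : 0 < g by lra.
apply/andP; split; first by rewrite ln_gt0//; lra.
have : ln (4 * g) <= ln (4 * (x * ln x)) by rewrite ler_ln ?posrE ?mulr_gt0// ler_wpM2l.
have := ln_le_linear h0 y0.
have : 0 <= h ^+ 2 * ln x by rewrite mulr_ge0 ?sqr_ge0// ltW.
rewrite !lnM ?posrE ?mulr_gt0//; lra.
Qed.

(** For t_k = ((k + 1)!)^-4 the middle term is log |log t_k|. As ln (k + 1)! <= (k + 1) ln (k + 1),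
    it exceeds ln (k + 1) only by an iterated logarithm and a constant. *)
Lemma log_log_fact h : 0 < h <= 1 -> exists N, forall k, (N <= k)%N ->
  0 < ln (4 * log_fact k) <= (1 + h) ^+ 2 * ln k.+1%:R.
Proof.
move=> /andP[h0 h1].
have [N1 H1] := ln_nat_large 1; have [N2 H2] := ln_nat_large ((ln 4 - ln h - 1) / h).
exists (maxn N1 N2) => j; rewrite geq_max => /andP[/H1 y1 /H2].
rewrite ler_pdivrMr// mulrC => yh.
by apply: log_log_aux; rewrite ?h0// ?log_fact_ge ?log_fact_le.
Qed.

End scales.

Section chung_at_zero.
Context (R : realType) (d : measure_display) (Omega : measurableType d)
  (P : probability Omega R) (b : R -> {RV P >-> R}).
Implicit Types (s t q h : R) (n k : nat).
Hypothesis hb : brownian_motion b.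
Local Notation pr X := (fine (P X)).
Local Notation c := (Num.sqrt (pi ^+ 2 / 8 : R)).
Local Notation scale t := (Num.sqrt (ln `|ln t| / t)).

Let L0 : 0 < pi ^+ 2 / 8 :> R.
Proof. by rewrite divr_gt0// exprn_gt0// pi_gt0. Qed.

Lemma chung_zero_lower n q : (0 < n)%N -> 0 < q < 1 ->
  {ae P, forall w, \forall t \near 0^'+, q * c <= scale t * max_norm b n t w}.
Proof.
move=> n0 /andP[q0 q1]; pose rho := (1 + q) / 2; pose dl := - ln rho.
have rho0 : 0 < rho by rewrite divr_gt0// addr_gt0.
have rho1 : rho < 1 by rewrite /rho; lra.
have dl0 : 0 < dl by rewrite oppr_gt0 ln_lt0// rho0.
have dlE : expR (- dl) = rho by rewrite /dl opprK lnK.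
(* This is rho^k, written so that |ln (t k)| = k dl. *)
pose t (k : nat) := expR (- (k%:R * dl)).
have t0 k : 0 < t k by exact: expR_gt0.
have tS k : t k.+1 = rho * t k.
  by rewrite /t -dlE -expRD -natr1; congr expR; ring.
pose l (k : nat) := ln (k%:R * dl).
pose r k := q * c * Num.sqrt (t k / l k).
(* Two powers of rho come from [small_ball_upper] with slack 1 - rho, the third from t_(k+1) = rho
   t_k, and q^2 from the radius. The probabilities are of order k^(- th), summable since th > 1. *)
pose th := rho ^+ 3 / q ^+ 2; pose s := th - 1.
have s0 : 0 < s.
  by rewrite subr_gt0 ltr_pdivlMr ?exprn_gt0// mul1r; apply: sqr_lt_cube_mid; rewrite q0.
pose C := cos ((1 - (1 - rho)) * pi / 2).
have C0 : 0 < C.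
  rewrite /C opprB addrC subrK; apply: cos_gt0_pihalf; have := pi_gt0 R => pi0.
  by apply/andP; split; nra.
have [N HN] : exists N, forall k, (N <= k)%N -> 1 < k%:R * dl.
  exists (Num.trunc (dl^-1)).+1 => k Nk; rewrite -ltr_pdivrMr// div1r.
  by rewrite (lt_le_trans (truncnS_gt _))// ler_nat.
have l0 k : (N <= k)%N -> 0 < l k by move=> /HN H; rewrite ln_gt0.
pose B := expR (- th * ln dl) / (s * C).
have B0 : 0 < B by rewrite divr_gt0 ?expR_gt0// mulr_gt0.
(* The shift matches [power_tail] at j when k = j + 2, hence the start at 2 or later below. *)
pose u (k : nat) := B * expR (- s * ln k.-1%:R).
have := @borel_cantelli R d Omega P (fun k => [set w | max_norm b n (t k.+1) w < r k]) u
  (maxn N 2) _ _ _.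
case=> [|k|k|D [mD PD HD]].
- by move=> k; exact: measurable_max_norm_lt.
- by rewrite mulr_ge0 ?expR_ge0// ltW.
- rewrite geq_max => /andP[Nk k2]; have lk := l0 k Nk.
  have r0 : 0 < r k by rewrite /r !mulr_gt0// sqrtr_gt0// divr_gt0.
  have r2 : r k ^+ 2 = q ^+ 2 * (pi ^+ 2 / 8) * (t k / l k).
    by rewrite !exprMn !sqr_sqrtr// ltW// divr_gt0.
  have k1 : 0 < 1 - rho < 1 by apply/andP; split; lra.
  have := small_ball_upper hb n0 (t0 k.+1) k1 r0; rewrite -/C.
  have -> : (1 - (1 - rho)) ^+ 2 * (pi ^+ 2 / 8 * t k.+1) / r k ^+ 2 = th * l k.
    have := L0; rewrite r2 tS /th; move: (pi ^+ 2 / 8) => L L00.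
    by field; rewrite !gt_eqF// t0.
  rewrite -ler_pdivlMl// => H; apply: (le_trans H).
  case: k k2 Nk lk {r0 r2 H} => [//|[//|j]] _ Nk lk.
  have -> : - (th * l j.+2) = - th * ln dl + - (1 + s) * ln j.+2%:R.
    by rewrite /l lnM ?posrE ?ltr0n// /s; ring.
  rewrite expRD /u -mulrBr/= (mulrC C^-1) /B -!mulrA ler_wpM2l ?expR_ge0//.
  rewrite invfM [leRHS]mulrAC ler_wpM2r ?invr_ge0 ?(ltW C0)//.
  by rewrite ler_pdivlMl// power_tail.
exists D; split=> // w /= Hw; apply: HD => /= -[m Hm]; apply: Hw.
near=> x.
have x0 : 0 < x by near: x; exact: nbhs_right_gt.
have xm : x < t (maxn m N).
  by near: x; apply: nbhs_right_lt; exact: t0.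
pose k := Num.trunc (- ln x / dl).
have lnx : (maxn m N)%:R * dl < - ln x.
  by rewrite ltrNr -[ltRHS]expRK ltr_ln ?posrE ?expR_gt0.
have lnx0 : 0 <= - ln x.
  by rewrite (le_trans _ (ltW lnx))// mulr_ge0// ltW.
have mNk : (maxn m N <= k)%N.
  by rewrite /k truncn_ge_nat ?divr_ge0 ?(ltW dl0)// ler_pdivlMr// ltW.
have [mk Nk] : (m <= k)%N /\ (N <= k)%N by apply/andP; rewrite -geq_max.
have /andP[xk xk1] := truncn_itv (divr_ge0 lnx0 (ltW dl0)).
rewrite -/k ler_pdivlMr// in xk; rewrite -/k ltr_pdivrMr// in xk1.
have xtk : x <= t k by rewrite -ler_ln ?posrE// expRK; lra.
have txk : t k.+1 <= x by rewrite -ler_ln ?posrE// expRK; lra.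
have lk := l0 k Nk; have HNk := HN k Nk.
have := Hm k mk => /negP; rewrite -leNgt => rM.
have rM' : r k <= max_norm b n x w.
  by apply: (le_trans rM); apply: max_norm_homo => //; rewrite txk ltW.
(* For t_(k+1) <= x <= t_k the scale is at least its value at t_k, and the maximum at least the one
   on [0, t_(k+1)]; the events above mix the two indices for this reason. *)
apply: (@le_trans _ _ (Num.sqrt (l k / t k) * r k)).
  by rewrite /r mulrCA sqrt_ratio// mulr1.
apply: ler_pM => //; rewrite ?sqrtr_ge0//.
  by rewrite !mulr_ge0 ?sqrtr_ge0// ltW.
have nx : `|ln x| = - ln x by rewrite -normrN ger0_norm.
rewrite nx; apply: ler_wsqrtr; rewrite ler_pM ?invr_ge0 ?(ltW lk) ?(ltW (t0 k))//.
  have kd0 : 0 < k%:R * dl by rewrite (lt_trans ltr01).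
  by rewrite ler_ln ?posrE// (lt_le_trans kd0).
by rewrite lef_pV2 ?posrE.
Unshelve. all: end_near. Qed.

(** * Upper bound at zero along the times ((k + 1)!)^-4 *)

Section upper.
Variables (h : R) (h0 : 0 < h).
Local Notation tk k := (expR (- (4 * @log_fact R k))).
Local Notation lk k := (ln (4 * @log_fact R k)).
Local Notation rk k := ((1 + h) * c * Num.sqrt (tk k / lk k)).

Let tkS k : tk k.+1 = tk k / k.+2%:R ^+ 4.
Proof.
rewrite log_factS mulrDr opprD expRD; congr (_ * _).
by rewrite expRN mulrC expRM_natr lnK// posrE ltr0n.
Qed.

Let tk_gt0 k : 0 < tk k. Proof. exact: expR_gt0. Qed.

Let tk_decr k : tk k.+1 < tk k.
Proof.
rewrite tkS ltr_pdivrMr ?exprn_gt0 ?ltr0n// ltr_pMr ?tk_gt0//.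
by rewrite exprn_egt1// ltr1n.
Qed.

Let rk_sqr k : 0 < lk k -> rk k ^+ 2 = (1 + h) ^+ 2 * (pi ^+ 2 / 8) * (tk k / lk k).
Proof. by move=> l0; rewrite !exprMn !sqr_sqrtr// ltW// divr_gt0. Qed.

Let rk_gt0 k : 0 < lk k -> 0 < rk k.
Proof.
by move=> l0; rewrite !mulr_gt0 ?addr_gt0// sqrtr_gt0// divr_gt0.
Qed.

Definition quiet k : set Omega :=
  [set w | tube (tk k - tk k.+1) (rk k) (moved b false false (tk k.+1) (tk k - tk k.+1) ^~ w)].

Let noisy k j := \bigcap_(i in [set i | (i < j)%N]) ~` quiet (k + i).

Let dt_gt0 k : 0 < tk k - tk k.+1. Proof. by rewrite subr_gt0. Qed.

Let measurable_quiet k : measurable (quiet k).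
Proof.
by have [] := markov hb false false (dt_gt0 k) (future_setT hb (ltW (tk_gt0 k.+1)))
  (@path_sets_tube R _ (rk k)).
Qed.

(** The factor (1 + h)^2 gained from the enlarged radius absorbs that of [log_log_fact]; what
    remains is 1 / (k + 1), just enough for divergence. *)
Let quiet_ge k : 0 < lk k <= (1 + h) ^+ 2 * ln k.+1%:R ->
  k.+1%:R^-1 <= pr (confined b (tk k - tk k.+1) (rk k)).
Proof.
move=> /andP[l0 l1]; have r0 := rk_gt0 l0; have pi0 := pi_gt0 R.
have ar : pi / 2 <= pi / (2 * rk k) * rk k <= pi.
  have -> : pi / (2 * rk k) * rk k = pi / 2 by rewrite half_ratio// gt_eqF.
  by rewrite lexx/=; lra.
have a0 : 0 < pi / (2 * rk k) by rewrite divr_gt0// mulr_gt0.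
apply: le_trans (confined_lower hb (dt_gt0 k) a0 ar).
have k0 : 0 < k.+1%:R :> R by rewrite ltr0n.
rewrite -[k.+1%:R](@lnK R) ?posrE// -expRN ler_expR lerN2.
apply: (@le_trans _ _ ((pi / (2 * rk k)) ^+ 2 * tk k / 2)).
  by rewrite ler_wpM2r// ler_wpM2l ?sqr_ge0// lerBlDr lerDl ltW.
have -> : (pi / (2 * rk k)) ^+ 2 * tk k / 2 = lk k / (1 + h) ^+ 2.
  have h10 : 0 < 1 + h by rewrite addr_gt0.
  rewrite exprMn exprVn exprMn rk_sqr//.
  by move: (tk_gt0 k) pi0 l0; move: (tk k) (lk k) pi => x y z x0 y0 z0; field; rewrite !gt_eqF.
by rewrite ler_pdivrMr ?exprn_gt0 ?addr_gt0// [leRHS]mulrC.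
Qed.

Let noisyS k j : noisy k j.+1 = noisy k.+1 j `&` ~` quiet k.
Proof.
apply/seteqP; split=> w /=.
  move=> H; split; last by have := H 0%N isT; rewrite addn0.
  by move=> i /= ij; rewrite addSnnS; exact: H.
move=> [H1 H2] [|i] /= ij; first by rewrite addn0.
by rewrite -addSnnS; exact: H1.
Qed.

(** The times decrease with k, so the event of index k is the latest one: the induction on j
    detaches it by [markov] from t_(k+1). The product of the 1 - 1 / (k + i + 1) telescopes to k /
    (k + j). *)
Let noisy_le N : (0 < N)%N ->
  (forall k, (N <= k)%N -> 0 < lk k <= (1 + h) ^+ 2 * ln k.+1%:R) ->
  forall j k, (N <= k)%N -> future b (tk k) (noisy k j) /\
    pr (noisy k j) <= k%:R / (k + j)%N%:R.
Proof.
move=> N0 H; elim=> [|j IH] k Nk.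
  have k0 : (0 < k)%N := leq_trans N0 Nk.
  have -> : noisy k 0 = setT by apply/seteqP; split => w.
  split; first by apply: (future_setT hb); exact: ltW.
  by rewrite addn0 divff ?pnatr_eq0 -?lt0n// probability_setT.
have [fD PD] := IH k.+1 (leqW Nk).
have mG : path_sets (tk k - tk k.+1) (~` tube (tk k - tk k.+1) (rk k)).
  apply: (@measurableC _ (g_sigma_algebraType (path_gen (tk k - tk k.+1)))).
  exact: path_sets_tube.
have [mE mE' PE] := markov hb false false (dt_gt0 k) fD mG.
rewrite addrC subrK noisyS; split => //.
rewrite [X in pr X](_ : _ = noisy k.+1 j `&` [set w | (~` tube (tk k - tk k.+1) (rk k))
   (moved b false false (tk k.+1) (tk k - tk k.+1) ^~ w)]); last by [].
rewrite PE fineM ?fin_num_measure//; last by case: fD.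
have q := quiet_ge (H k Nk).
have -> : pr [set w | (~` tube (tk k - tk k.+1) (rk k)) (b ^~ w)] =
    1 - pr (confined b (tk k - tk k.+1) (rk k)).
  rewrite [X in pr X](_ : _ = ~` confined b (tk k - tk k.+1) (rk k)); last by [].
  have mC := measurable_confined hb (tk k - tk k.+1) (rk k).
  by rewrite probability_setC// fineB ?fin_num_measure.
have k1 : 0 < k.+1%:R :> R by rewrite ltr0n.
have kj : 0 < (k + j.+1)%N%:R :> R by rewrite ltr0n addnS.
apply: (@le_trans _ _ (k.+1%:R / (k.+1 + j)%N%:R * (1 - k.+1%:R^-1))).
  apply: ler_pM => //; first exact: fine_ge0.
    rewrite subr_ge0 -lee_fin fineK ?fin_num_measure ?probability_le1//.
    - exact: measurable_confined.
    - exact: measurable_confined.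
  by rewrite lerD2l lerN2.
rewrite addSnnS le_eqVlt; apply/orP; left; apply/eqP.
rewrite -mulrA mulrCA mulrBr mulr1 mulfV ?gt_eqF// -natr1 addrK.
by rewrite mulrC.
Qed.

Lemma ae_quiet : h <= 1 -> {ae P, forall w m, exists2 k, (m <= k)%N & quiet k w}.
Proof.
move=> h1; have [|N HN] := @log_log_fact R h; first by rewrite h0.
apply: (@ae_infinitely_often _ _ _ P quiet N.+1 measurable_quiet) => m Nm e e0.
exists (Num.trunc (m%:R / e)).+1.
have [_ H] := noisy_le (ltn0Sn N) (fun k kN => HN k (ltnW kN)) (Num.trunc (m%:R / e)).+1 Nm.
apply: (le_trans H); rewrite ler_pdivrMr ?ltr0n ?addnS// mulrC -ler_pdivrMr//.
by rewrite ltW// (lt_le_trans (truncnS_gt _))// ler_nat -addnS leq_addl.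
Qed.

(** By [not_confined_le] and t_(k+1) / t_k = (k + 2)^-4, the exit probabilities are summable even
    with the crude bound ln (k + 1) <= k + 1. *)
Lemma ae_start_small : h <= 1 ->
  {ae P, forall w, exists m, forall k, (m <= k)%N -> confined b (tk k.+1) (h * rk k) w}.
Proof.
move=> h1; have [|N HN] := @log_log_fact R h; first by rewrite h0.
pose u k : R := 4 / h ^+ 2 / k.+1%:R.
have H := @borel_cantelli _ _ _ P (fun k => ~` confined b (tk k.+1) (h * rk k)) u N _ _ _.
apply: filterS (H _ _ _) => [w [m Hm]|k|k|k Nk].
- by exists m => k mk; apply: contrapT; exact: Hm.
- by apply: measurableC; exact: measurable_confined.
- by rewrite !divr_ge0// sqr_ge0.
have /andP[l0 l1] := HN k Nk; have r0 := rk_gt0 l0.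
apply: (le_trans (not_confined_le hb (tk_gt0 k.+1) (mulr_gt0 h0 r0))).
have k1 : 0 < k.+1%:R :> R by rewrite ltr0n.
have kE : k.+2%:R = k.+1%:R + 1 :> R by rewrite natr1.
have lnk : ln k.+1%:R <= k.+1%:R :> R by rewrite ltW// ln_sublinear.
have h10 : 0 < (1 + h) ^+ 2 by rewrite exprn_gt0// addr_gt0.
have {lnk}l1 : lk k <= (1 + h) ^+ 2 * k.+1%:R by rewrite (le_trans l1)// ler_wpM2l// ltW.
rewrite exprMn rk_sqr// tkS /u kE; move: (tk_gt0 k) (pi_gt0 R) l0 l1 k1 h10.
move: ((1 + h) ^+ 2) (tk k) (lk k) (k.+1%:R : R) pi => A x l y p x0 p0 l0 l1 y0 A0.
have -> : p ^+ 2 * (x / (y + 1) ^+ 4) / (2 * (h ^+ 2 * (A * (p ^+ 2 / 8) * (x / l)))) =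
    4 / h ^+ 2 * (l / (A * (y + 1) ^+ 4)) by field; rewrite !gt_eqF// addr_gt0.
rewrite -mulrBr ler_wpM2l ?divr_ge0 ?sqr_ge0//.
have y10 : 0 < y + 1 by rewrite addr_gt0.
have -> : y^-1 - (y + 1)^-1 = (y * (y + 1))^-1 by field; rewrite !gt_eqF.
rewrite ler_pdivrMr ?mulr_gt0 ?exprn_gt0// mulrC ler_pdivlMr ?mulr_gt0//.
apply: (@le_trans _ _ (A * y * (y * (y + 1)))); first by rewrite ler_wpM2r// mulr_ge0// ltW.
rewrite -!mulrA ler_wpM2l ?(ltW A0)//; nra.
Qed.

(** The three factors 1 + h come from the radius, from the value of b at t_(k+1), and from the other
    coordinates. *)
Lemma chung_zero_upper n : h <= 1 -> {ae P, forall w V, nbhs 0^'+ V ->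
  exists2 t, V t & scale t * max_norm b n t w <= (1 + h) ^+ 3 * c}.
Proof.
move=> h1; have [|N HN] := @log_log_fact R h; first by rewrite h0.
apply: filterS2 (ae_quiet h1) (ae_start_small h1) => w Hq [m0 Hm] V [e /= e0 HV].
(* Makes t_k small enough to lie in V and for the other coordinates to add at most h in relative
   terms; the 1 gives the strict inequality. *)
have [N2 HN2] := ln_nat_large (Num.max 1 (- ln (Num.min e (h / n.+1%:R)))).
have [k] := Hq (maxn (maxn m0 N) N2); rewrite !geq_max => /andP[/andP[mk Nk] N2k] Qk.
have /andP[l0 l1] := HN k Nk; have r0 := rk_gt0 l0.
have n10 : 0 < n.+1%:R :> R by rewrite ltr0n.
have min0 : 0 < Num.min e (h / n.+1%:R) by rewrite lt_min e0 divr_gt0.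
have tk1 : tk k < Num.min e (h / n.+1%:R).
  rewrite -[ltRHS](@lnK R) ?posrE// ltr_expR ltrNl.
  have := HN2 k N2k; rewrite ge_max => /andP[y1 y2]; have := @log_fact_ge R k; lra.
move: tk1; rewrite lt_min => /andP[tke tkh].
exists (tk k); first by apply: HV; rewrite //= sub0r normrN gtr0_norm.
have dt0 := ltW (tk_gt0 k.+1).
have bmax u : 0 <= u <= tk k -> `|b u w| <= (1 + h) * rk k.
  move=> /andP[u0 uk]; have /(confinedP hb _ _ (tk_gt0 k.+1)) Hs := Hm k mk.
  have [us|us] := leP u (tk k.+1).
    rewrite (le_trans (Hs u _)) ?u0// ler_wpM2r ?(ltW r0)//; lra.
  have := tube_moved hb dt0 (dt_gt0 k) Qk (u := u); rewrite /= (ltW us) addrC subrK uk.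
  move=> /(_ isT) H1; have := Hs (tk k.+1); rewrite lexx dt0 => /(_ isT) H2.
  rewrite -(subrK (b (tk k.+1) w) (b u w)) (le_trans (ler_normD _ _))//.
  by rewrite [leRHS](_ : _ = rk k + h * rk k) ?lerD//; ring.
have t0 := tk_gt0 k.
have Mle : max_norm b n (tk k) w <= (1 + h) * ((1 + h) * rk k).
  apply: max_norm_le => [|s st]; first exact: ltW.
  apply: (le_trans (norm_path_sup n (ltW t0) (path_cont hb (lexx 0)) bmax st)).
  rewrite ler_wpM2r ?mulr_ge0 ?addr_ge0 ?(ltW r0) ?(ltW h0)//.
  have t1 : tk k <= 1.
    have : h / n.+1%:R <= 1 by rewrite ler_pdivrMr// mul1r (le_trans h1)// ler1n.
    by apply: le_trans; exact: ltW.
  apply: (@le_trans _ _ (1 + n%:R * tk k)); last first.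
    rewrite lerD2l (@le_trans _ _ (n.+1%:R * tk k))//.
      by rewrite ler_wpM2r ?(ltW t0)// ler_nat.
    by rewrite mulrC -ler_pdivlMr// ltW.
  case: n {n10 min0 tkh HN2} => [|n']; first by rewrite big_ord0 mul0r addr0.
  rewrite big_ord_recl expr0 lerD2l.
  apply: (@le_trans _ _ (\sum_(i < n') tk k)).
    by apply: ler_sum => i _; rewrite lift0 exprS ler_piMr ?(ltW t0)// exprn_ile1// ltW.
  by rewrite sumr_const card_ord -[tk k *+ n']mulr_natl ler_wpM2r ?(ltW t0)// ler_nat.
have -> : `|ln (tk k)| = 4 * log_fact R k.
  rewrite expRK normrN ger0_norm// mulr_ge0//.
  exact: le_trans (ln_nat_ge0 R k) (log_fact_ge R k).
apply: (@le_trans _ _ (Num.sqrt (lk k / tk k) * ((1 + h) * ((1 + h) * rk k)))).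
  by rewrite ler_wpM2l ?sqrtr_ge0.
rewrite [leLHS](_ : _ = (1 + h) ^+ 3 * c * (Num.sqrt (lk k / tk k) * Num.sqrt (tk k / lk k))).
  by rewrite sqrt_ratio// mulr1.
by ring.
Qed.

End upper.

Theorem chung_zero n : (0 < n)%N -> {ae P, forall w,
  limf_einf (fun t : R => (scale t * max_norm b n t w)%:E) (0 : R)^'+ = c%:E}.
Proof.
move=> n0; have c0 : 0 < c by rewrite sqrtr_gt0.
(* Sequences of constants, so that only countably many null sets are discarded. *)
pose q j : R := 1 - j.+2%:R^-1; pose h j : R := j.+1%:R^-1.
have q01 j : 0 < q j < 1.
  by rewrite /q subr_gt0 invf_lt1 ?ltr1n// ltrBlDr ltrDl invr_gt0 ltr0n.
have h0 j : 0 < h j by rewrite invr_gt0 ltr0n.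
have h1 j : h j <= 1 by rewrite invf_le1 ?ltr0n// ler1n.
have lo := ae_foralln (fun j => chung_zero_lower n0 (q01 j)).
have hi := ae_foralln (fun j => chung_zero_upper (h0 j) n (h1 j)).
apply: filterS2 lo hi => w lo hi; apply: limf_einf_eq => e e0.
  have [j _ /(_ j (leqnn j)) Hj] := near_infty_natSinv_lt (PosNum (divr_gt0 e0 c0)).
  apply: filterS (lo j) => t; apply: le_trans.
  rewrite /q mulrBl mul1r lerD2l lerN2 -ler_pdivlMr// (le_trans _ (ltW Hj))//=.
  by rewrite lef_pV2 ?posrE ?ltr0n// ler_nat.
move=> V FV.
(* The 7 comes from (1 + x)^3 <= 1 + 7 x on [0, 1]. *)
have [j _ /(_ j (leqnn j)) Hj] := near_infty_natSinv_lt (PosNum (divr_gt0 e0 (mulr_gt0 (ltr0n _ 7) c0))).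
have [t Vt Ht] := hi j V FV; exists t => //; apply: (le_trans Ht).
have : h j * (7 * c) <= e by rewrite -ler_pdivlMr ?mulr_gt0// ltW.
have := h1 j; have := h0 j; move: (h j) => x x0 x1 xe.
have -> : (1 + x) ^+ 3 = 1 + 3 * x + 3 * (x * x) + x * (x * x) by ring.
have xx : x * x <= x by rewrite ler_piMr// ltW.
have xxx : x * (x * x) <= x by rewrite ler_piMr ?(ltW x0)// (le_trans xx).
have : (1 + 3 * x + 3 * (x * x) + x * (x * x)) * c <= (1 + 7 * x) * c.
  by rewrite ler_wpM2r ?(ltW c0)//; lra.
move/le_trans; apply; lra.
Qed.

End chung_at_zero.

(** * The law at infinity *)

(** In logarithms the powers of t leave - (ln t) / 2, as p = n + 1 / 2. The choice p h = 1 / 4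
    bounds the cost of the iterated logarithm by (ln t) / 4 up to a constant, and C collects the
    constants. *)
Lemma chung_scaling_decay (R : realType) n (e : R) : 0 < e ->
  \forall t \near +oo, chung_scaling n.+1 t * (n.+1%:R * t ^+ n) <= e.
Proof.
move=> e0; pose p : R := (2 * n.+1%:R - 1) / 2.
have n0 : 0 <= n%:R :> R by exact: ler0n.
have pE : p = n%:R + 1 / 2 by rewrite /p -natr1; field.
have p0 : 0 < p by rewrite pE; lra.
pose h : R := (4 * p)^-1; have h0 : 0 < h by rewrite invr_gt0 mulr_gt0.
pose C := p * (- ln h - 1) + ln n.+1%:R - ln e.
near=> t.
have t_large : expR (Num.max 2 (4 * C)) <= t by near: t; exact: nbhs_pinfty_ge.
have t0 : 0 < t by rewrite (lt_le_trans _ t_large)// expR_gt0.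
have x_large : Num.max 2 (4 * C) <= ln t.
  by rewrite -[leLHS]expRK ler_ln ?posrE ?expR_gt0.
move: x_large; rewrite ge_max => /andP[x2 xC].
have x0 : 0 < ln t by lra.
have lx0 : 0 < ln (ln t) by rewrite ln_gt0//; lra.
have tE : t = expR (ln t) by rewrite lnK.
have lnx : ln (ln t) <= h * ln t - ln h - 1 by exact: ln_le_linear.
have lnlnx : ln (ln (ln t)) <= ln (ln t) by rewrite ltW// ln_sublinear.
have -> : chung_scaling n.+1 t = expR (p * (ln (ln (ln t)) - ln t)).
  rewrite /chung_scaling -/p /powR gt_eqF ?divr_gt0//.
  by rewrite ln_div ?posrE.
have -> : t ^+ n = expR (n%:R * ln t) by rewrite mulrC expRM_natr -tE.
rewrite mulrCA -expRD -[n.+1%:R]lnK ?posrE// -expRD -[leRHS]lnK ?posrE// ler_expR.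
have ph : p * h = 1 / 4 by rewrite /h; field; rewrite gt_eqF.
have : p * (ln (ln (ln t)) - ln t) <= p * (h * ln t - ln h - 1 - ln t).
  by rewrite ler_wpM2l ?(ltW p0)//; lra.
have -> : p * (h * ln t - ln h - 1 - ln t) = p * h * ln t + p * (- ln h - 1) - p * ln t by ring.
rewrite ph => H.
have pt : p * ln t = n%:R * ln t + ln t / 2 by rewrite pE; field.
rewrite /C in xC; lra.
Unshelve. all: end_near. Qed.

Section chung_at_infinity.
Context (R : realType) (d : measure_display) (Omega : measurableType d)
  (P : probability Omega R) (b : R -> {RV P >-> R}).
Implicit Types (s t : R) (n : nat).
Hypothesis hb : brownian_motion b.

(** On [0, 2^(k+1)] the path leaves [- 2^k, 2^k] with probability at most pi^2 / 2^k, which is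
    [u k - u k.+1]. For t between 2^k and 2^(k+1) the radius 2^k is at most t. *)
Lemma ae_linear_growth : {ae P, forall w, \forall t \near +oo,
  forall u, 0 <= u <= t -> `|b u w| <= t}.
Proof.
pose A k := ~` confined b (2 ^+ k.+1) (2 ^+ k).
pose u k : R := 2 * pi ^+ 2 / 2 ^+ k.
have x0 k : 0 < 2 ^+ k :> R by rewrite exprn_gt0.
apply: filterS (@borel_cantelli _ _ _ P A u 0 _ _ _) => [w [m Hm]|k|k|k _].
- near=> t.
  have mt : 2 ^+ m <= t by near: t; exact: nbhs_pinfty_ge.
  have t0 : 0 <= t by rewrite (le_trans _ mt)// ltW.
  have /andP[nt tn] := truncn_itv t0.
  have mn : (2 ^ m <= Num.trunc t)%N by rewrite truncn_ge_nat// natrX.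
  have n0 : (0 < Num.trunc t)%N by rewrite (leq_trans _ mn)// expn_gt0.
  have /andP[kn nk] := trunc_log_bounds (isT : (1 < 2)%N) n0.
  move: kn nk; set k := trunc_log _ _ => kn nk.
  have mk : (m <= k)%N by rewrite trunc_log_max.
  have kt : 2 ^+ k <= t by rewrite (le_trans _ nt)// -natrX ler_nat.
  have tk : t <= 2 ^+ k.+1 by rewrite (le_trans (ltW tn))// -natrX ler_nat.
  have /contrapT/(confinedP hb _ _ (x0 _)) H := Hm k mk.
  by move=> v /andP[v0 vt]; rewrite (le_trans (H v _)) ?v0 ?(le_trans vt).
- by apply: measurableC; exact: measurable_confined.
- by apply: divr_ge0 (ltW (x0 k)); apply: mulr_ge0 => //; exact: sqr_ge0.
apply: (le_trans (not_confined_le hb (x0 _) (x0 _))).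
rewrite le_eqVlt; apply/orP; left; apply/eqP; rewrite /u [2 ^+ k.+1]exprS.
by move: (x0 k); move: (2 ^+ k) (pi : R) => x p xx0; field; rewrite gt_eqF.
Unshelve. all: end_near. Qed.

Lemma running_max_le_max_norm n t w : 0 <= t ->
  running_max (fun s => `|iterated_integral n (b ^~ w) s|) t <= max_norm b n.+1 t w.
Proof.
move=> t0; apply: running_max_le => // s st.
exact: le_trans (norm_path_ge _ _ (ltnSn n)) (max_norm_ge hb _ _ st).
Qed.

(** Coordinate i < n is at most t^i t, hence at most t^n since t >= 1; only the last coordinate can
    be larger. *)
Lemma max_norm_le_running_max n t w : 1 <= t ->
  (forall u, 0 <= u <= t -> `|b u w| <= t) ->
  max_norm b n.+1 t w <=
    running_max (fun s => `|iterated_integral n (b ^~ w) s|) t + n.+1%:R * t ^+ n.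
Proof.
move=> t1 bt; have t0 : 0 <= t by rewrite (le_trans ler01).
have cb : {within `[0, t], continuous (fun u : R => b u w : R)} by exact: path_cont.
apply: max_norm_le => // s st; apply: (le_trans (norm_path_le _ _ _)).
rewrite big_ord_recr/= addrC lerD//.
  apply: (@running_max_ge_within R (fun s => `|iterated_integral n (b ^~ w) s|)) => //.
  by apply: within_norm; exact: iterated_integral_cont.
apply: (@le_trans _ _ (\sum_(i < n) t ^+ n)).
  apply: ler_sum => i _; apply: (le_trans (iterated_integral_le i t0 cb bt st)).
  by rewrite -exprSr ler_weXn2l.
by rewrite sumr_const card_ord -[_ *+ n]mulr_natl ler_wpM2r ?exprn_ge0// ler_nat.
Qed.

Theorem chung_infinity n gamma : (0 < n)%N -> chung_constant b n gamma -> {ae P, forall w,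
  limf_einf (fun t : R => (chung_scaling n t * max_norm b n t w)%:E)
    (pinfty_nbhs R) = gamma%:E}.
Proof.
case: n => [//|n] _ [_ Hgamma].
apply: filterS2 Hgamma ae_linear_growth => w Hg Hb; apply: limf_einf_eq => e e0.
  have Hn : \forall t \near +oo, gamma - e <= chung_scaling n.+1 t *
      running_max (fun s => `|iterated_integral n (b ^~ w) s|) t.
    exact: (limf_einf_near _ Hg e0).
  near=> t; have t0 : 0 <= t by near: t; exact: nbhs_pinfty_ge.
  apply: le_trans (near Hn t _) _ => //.
  by rewrite ler_wpM2l ?powR_ge0// running_max_le_max_norm.
move=> V FV; have e20 : 0 < e / 2 by rewrite divr_gt0.
have good : \forall t \near +oo, [/\ V t, 1 <= t,
    forall u, 0 <= u <= t -> `|b u w| <= t &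
    chung_scaling n.+1 t * (n.+1%:R * t ^+ n) <= e / 2].
  near=> t; split; near: t => //.
  - exact: nbhs_pinfty_ge.
  - exact: chung_scaling_decay.
have [t [Vt t1 bt decay] Ht] := limf_einf_frequently Hg e20 good.
exists t => //; apply: (@le_trans _ _ (chung_scaling n.+1 t *
  (running_max (fun s => `|iterated_integral n (b ^~ w) s|) t + n.+1%:R * t ^+ n))).
  by rewrite ler_wpM2l ?powR_ge0// max_norm_le_running_max.
by rewrite mulrDr; move: Ht decay => /=; lra.
Unshelve. all: end_near. Qed.

End chung_at_infinity.

Theorem theorem2p6 (R : realType) (d : measure_display)
    (Omega : measurableType d) (P : probability Omega R)
    (b : R -> {RV P >-> R}) (hb : brownian_motion b)
    (n : nat) (hn : (1 <= n)%N) (T : R) (hT : 0 < T)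
    (lambda1 : R) (hlambda1 : lowest_dirichlet_eigenvalue (-1) 1 lambda1)
    (gamma : R) (hgamma : chung_constant b n gamma) :
  let M (t : R) (w : Omega) : R :=
    running_max (fun s => euclidean_norm (kolmogorov n (b ^~ w) s)) t in
  [/\ (fun eps : R => (- ((eps ^+ 2)%:E * lne (P [set w | (M T w < eps)%R])))%E)
        @ 0^'+ --> (lambda1 * T)%:E,
      {ae P, forall w,
        limf_einf (fun t : R => (Num.sqrt (ln `|ln t| / t) * M t w)%:E)
          (0 : R)^'+ = (Num.sqrt lambda1)%:E} &
      {ae P, forall w,
        limf_einf (fun t : R => (chung_scaling n t * M t w)%:E)
          (pinfty_nbhs R) = gamma%:E}].
Proof.
move=> M; rewrite (lowest_dirichlet_eigenvalue_interval hlambda1); split.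
- exact: small_ball.
- exact: chung_zero.
- exact: chung_infinity.
Qed.
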